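(* Let $U\subset\mathbb R^n$ be an open neighborhood of the origin and let $f:U\to\mathbb R$ be a $C^\infty$ function with $f(0)=0$, $\nabla f(0)=0$ and $\Gamma_+(f)\neq\emptyset$, which belongs to $\hat{\mathcal E}(U)$ and is nondegenerate over $\mathbb R$ with respect to $\Gamma_+(f)$. Then there is a neighborhood $V$ of the origin such that for every $C^\infty$ function $\varphi:\mathbb R^n\to\mathbb C$ with support contained in $V$, the oscillatory integral $I(t;\varphi)=\int_{\mathbb R^n}e^{itf(x)}\varphi(x)\,dx$ admits an asymptotic expansion, as $t\to+\infty$, of the form $$I(t;\varphi)\sim\sum_{\alpha}\sum_{k=1}^{n}C_{\alpha k}(\varphi)\,t^{\alpha}(\log t)^{k-1},$$ where the exponents $\alpha$ (which do not depend on $\varphi$) all belong to the set $$\Big\{-\frac{\langle a\rangle+\nu}{l(a)}:\ \nu\in\mathbb Z_+,\ a\in\Sigma^{(1)},\ l(a)>0\Big\}\cup(-\mathbb N).$$ In particular the exponents belong to the same set as for the phase $f_*$ (the principal part of $f$), since $\Gamma_+(f)=\Gamma_+(f_* )$.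
   Context: Notation: $\mathbb Z_+,\mathbb R_+$ denote nonnegative integers/reals; $\langle a,x\rangle$ is the standard inner product, and for $a\in\mathbb R^n$, $\langle a\rangle=a_1+\dots+a_n$. For $(a,l)\in\mathbb R^n\times\mathbb R$, $H(a,l)=\{x:\langle a,x\rangle=l\}$, $H^+(a,l)=\{x:\langle a,x\rangle\ge l\}$. A polyhedron is a finite intersection of sets $H^+(a,l)$ with $(a,l)\in\mathbb Z^n\times\mathbb Z$. A pair $(a,l)\in\mathbb Z^n\times\mathbb Z$ is valid for a polyhedron $P$ if $P\subset H^+(a,l)$; a face of $P$ is a set $P\cap H(a,l)$ with $(a,l)$ valid, and $(a,l)$ is said to define the face $\gamma$ if $P\cap H(a,l)=\gamma$. Newton polyhedron: for a $C^\infty$ function $f$ near $0$ with Taylor series $\sum_\alpha c_\alpha x^\alpha$, $\Gamma_+(f)$ is the convex hull of $\bigcup\{\alpha+\mathbb R_+^n: c_\alpha\ne0\}$. The principal part is $f_*=\sum_{\alpha\in\Gamma(f)\cap\mathbb Z_+^n}c_\alpha x^\alpha$, where $\Gamma(f)$ is the union of compact faces of $\Gamma_+(f)$. $\gamma$-part and classes: let $P\subset\mathbb R_+^n$ be a polyhedron with $P+\mathbb R_+^n\subset P$, $f\in C^\infty(U)$ with $\Gamma_+(f)\subset P$, and $\gamma$ a face of $P$. $f$ admits the $\gamma$-part on $U$ if for every $x\in U$ the limit $\lim_{t\to0^+}f(t^{a_1}x_1,\dots,t^{a_n}x_n)/t^l$ exists for all valid pairs $(a,l)\in\mathbb Z_+^n\times\mathbb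 Z_+$ defining $\gamma$; the (common) value is $f_\gamma(x)$. $\hat{\mathcal E}[P](U)$ ($P\ne\emptyset$) is the set of $f\in C^\infty(U)$ with $\Gamma_+(f)\subset P$ admitting the $\gamma$-part on $U$ for every face $\gamma$ of $P$; $\hat{\mathcal E}(U)=\{f\in C^\infty(U): f\in\hat{\mathcal E}[\Gamma_+(f)](U)\}$. Nondegeneracy: $f$ is nondegenerate over $\mathbb R$ with respect to $\Gamma_+(f)$ if for every compact face $\gamma$ of $\Gamma_+(f)$, the polynomial $f_\gamma=\sum_{\alpha\in\gamma}c_\alpha x^\alpha$ satisfies $\nabla f_\gamma\neq0$ on $U\cap(\mathbb R\setminus\{0\})^n$. Fan: with $P=\Gamma_+(f)$, for $a\in\mathbb R_+^n$ let $l(a)=\min\{\langle a,\alpha\rangle:\alpha\in P\}$. For each face $\gamma$ of $P$ let $\gamma^*=\{a\in\mathbb R_+^n: H(a,l(a))\cap P=\gamma\}$; the closures of the $\gamma^*$ form a fan $\Sigma_0$ with support $\mathbb R_+^n$. Fix a simplicial subdivision $\Sigma$ of $\Sigma_0$: a fan of strongly convex rational polyhedral cones with the same support, each cone contained in a cone of $\Sigma_0$, and such that the primitive integer generators (skeleton) of every cone can be completed to a basis of $\mathbb Z^n$. $\Sigma^{(1)}$ denotes the set of primitive integer generators of the one-dimensional cones of $\Sigma$. *)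

(* Defs.v *)
From HB Require Import structures.
From mathcomp Require Import all_boot all_order all_algebra.
From mathcomp Require Import all_classical all_reals all_analysis.
From mathcomp Require Import complex.

Set Implicit Arguments.
Unset Strict Implicit.
Unset Printing Implicit Defensive.

Import Order.TTheory GRing.Theory Num.Theory.
Import numFieldNormedType.Exports.

Local Open Scope classical_set_scope.
Local Open Scope ring_scope.

Section Defs.
Variables (R : realType) (n : nat).
Implicit Types (x y : 'rV[R]_n) (U A P gam : set 'rV[R]_n).

Definition dotp (a x : 'rV[R]_n) : R := \sum_(i < n) a ord0 i * x ord0 i.
Definition sumz (a : 'rV[int]_n) : int := \sum_(i < n) a ord0 i.
Definition intR (a : 'rV[int]_n) : 'rV[R]_n := \row_i (a ord0 i)%:~R.
Definition natR (a : 'rV[nat]_n) : 'rV[R]_n := \row_i (a ord0 i)%:R.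
Definition evec (j : 'I_n) : 'rV[R]_n := delta_mx 0 j.
Definition orthant : set 'rV[R]_n := [set x | forall i, 0 <= x ord0 i].
Definition hyp (a : 'rV[R]_n) (l : R) := [set x | dotp a x = l].
Definition hyp_plus (a : 'rV[R]_n) (l : R) := [set x | l <= dotp a x].

Definition pd (j : 'I_n) (g : 'rV[R]_n -> R) : 'rV[R]_n -> R :=
  fun x => derive g x (evec j).
Definition iterpd (js : seq 'I_n) (g : 'rV[R]_n -> R) : 'rV[R]_n -> R :=
  foldr pd g js.
Definition smooth_on U (g : 'rV[R]_n -> R) : Prop :=
  forall js : seq 'I_n, forall x, U x ->
    {for x, continuous (iterpd js g)} /\
    forall j, derivable (iterpd js g) x (evec j).
Definition dmulti (al : 'rV[nat]_n) (g : 'rV[R]_n -> R) : 'rV[R]_n -> R :=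
  iterpd (flatten [seq nseq (al ord0 i) i | i <- enum 'I_n]) g.
Definition mfact (al : 'rV[nat]_n) : nat := \prod_(i < n) (al ord0 i)`!.
Definition taylor_coef (g : 'rV[R]_n -> R) (al : 'rV[nat]_n) : R :=
  dmulti al g 0 / (mfact al)%:R.
Definition monom (al : 'rV[nat]_n) (x : 'rV[R]_n) : R :=
  \prod_(i < n) x ord0 i ^+ al ord0 i.

Definition conv_hull A : set 'rV[R]_n :=
  [set x | exists (k : nat) (w : 'I_k -> R) (p : 'I_k -> 'rV[R]_n),
     [/\ forall i, 0 <= w i, \sum_(i < k) w i = 1, forall i, A (p i)
       & x = \sum_(i < k) w i *: p i]].
Definition newton (g : 'rV[R]_n -> R) : set 'rV[R]_n :=
  conv_hull (\bigcup_(al in [set al | taylor_coef g al != 0])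
               [set x | forall i, (al ord0 i)%:R <= x ord0 i]).
Definition valid P (a : 'rV[int]_n) (l : int) : Prop :=
  P `<=` hyp_plus (intR a) l%:~R.
Definition is_face P gam : Prop :=
  exists (a : 'rV[int]_n) (l : int), valid P a l /\ P `&` hyp (intR a) l%:~R = gam.
Definition is_compact_face P gam : Prop :=
  is_face P gam /\ gam !=set0 /\ compact gam.

Definition tscale (a : 'rV[nat]_n) (t : R) x : 'rV[R]_n :=
  \row_i (t ^+ a ord0 i * x ord0 i).
(* g admits the gam-part on U (w.r.t. the polyhedron P): for every x in U and
   every valid pair (a,l) in Z_+^n x Z_+ defining gam, the limit
   lim_{t -> 0+} g(t^a x)/t^l exists (the expression being defined, i.e.
   t^a x in U, for all small t > 0). *)
Definition admits_part P U (g : 'rV[R]_n -> R) gam : Prop :=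
  forall x, U x -> forall (a : 'rV[nat]_n) (l : nat),
    P `<=` hyp_plus (natR a) l%:R -> P `&` hyp (natR a) l%:R = gam ->
    (\forall t \near 0^'+, U (tscale a t x)) /\
    exists v : R, (fun t => g (tscale a t x) / t ^+ l) @ 0^'+ --> v.
Definition hatE_P P U (g : 'rV[R]_n -> R) : Prop :=
  [/\ P !=set0, smooth_on U g, newton g `<=` P &
      forall gam, is_face P gam -> admits_part P U g gam].
Definition hatE U (g : 'rV[R]_n -> R) : Prop := hatE_P (newton g) U g.

Definition gam_part_poly (g : 'rV[R]_n -> R) gam : 'rV[R]_n -> R :=
  fun x => (\sum_(al \in [set al : 'rV[nat]_n | gam (natR al)])
              taylor_coef g al * monom al x)%R.
Definition nondeg_over_R U (g : 'rV[R]_n -> R) : Prop :=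
  forall gam, is_compact_face (newton g) gam ->
    forall x, U x -> (forall i, x ord0 i != 0) ->
      exists j, pd j (gam_part_poly g gam) x != 0.

Definition newton_boundary (g : 'rV[R]_n -> R) : set 'rV[R]_n :=
  \bigcup_(gam in [set gam | is_compact_face (newton g) gam]) gam.
Definition principal_part (g : 'rV[R]_n -> R) : 'rV[R]_n -> R :=
  gam_part_poly g (newton_boundary g).

Definition lmin P (a : 'rV[R]_n) : R := inf [set dotp a al | al in P].
Definition dual_cone P gam : set 'rV[R]_n :=
  [set a | orthant a /\ hyp a (lmin P a) `&` P = gam].
Definition gcone (S : seq 'rV[int]_n) : set 'rV[R]_n :=
  [set x | exists lam : nat -> R, (forall i, 0 <= lam i) /\
     x = \sum_(i < size S) lam i *: intR (nth 0 S i)].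
Definition cone_face (C F : set 'rV[R]_n) : Prop :=
  exists u : 'rV[R]_n, (forall x, C x -> 0 <= dotp u x) /\
    F = C `&` hyp u 0.
(* a fan of strongly convex rational polyhedral cones, each cone given by
   a finite list of integer generators *)
Definition is_fan (Sig : seq (seq 'rV[int]_n)) : Prop :=
  [/\ forall S, S \in Sig -> forall F, cone_face (gcone S) F ->
        exists2 T, T \in Sig & F = gcone T,
      forall S T, S \in Sig -> T \in Sig ->
        cone_face (gcone S) (gcone S `&` gcone T) /\
        cone_face (gcone T) (gcone S `&` gcone T) &
      forall S, S \in Sig ->
        gcone S `&` [set - x | x in gcone S] = [set 0]].
Definition completes_to_basis (S : seq 'rV[int]_n) : Prop :=
  (size S <= n)%N /\
  exists B : 'M[int]_n, B \in unitmx /\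
    forall i : 'I_n, (i < size S)%N -> row i B = nth 0 S i.
(* Sig is a simplicial subdivision of the fan Sigma_0 associated with P,
   with cones given by their skeletons *)
Definition simplicial_subdivision P (Sig : seq (seq 'rV[int]_n)) : Prop :=
  [/\ is_fan Sig,
      \bigcup_(S in [set S | S \in Sig]) gcone S = orthant,
      forall S, S \in Sig -> exists gam, is_face P gam /\
        gcone S `<=` closure (dual_cone P gam) &
      forall S, S \in Sig -> completes_to_basis S].
(* Sigma^(1): primitive generators of the one-dimensional cones *)
Definition skeleton1 (Sig : seq (seq 'rV[int]_n)) : set 'rV[int]_n :=
  [set a | [:: a] \in Sig].
Definition exponent_set P (Sig : seq (seq 'rV[int]_n)) : set R :=
  [set al | (exists (nu : nat) (a : 'rV[int]_n), [/\ skeleton1 Sig a,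
               0 < lmin P (intR a) &
               al = - (((sumz a)%:~R + nu%:R) / lmin P (intR a))])
            \/ (exists m : nat, (0 < m)%N /\ al = - m%:R)].

Fixpoint intn (m : nat) : ('rV[R]_m -> R) -> R :=
  match m return ('rV[R]_m -> R) -> R with
  | 0 => fun g => g 0
  | m'.+1 => fun g => Rintegral lebesgue_measure setT
      (fun s : R => intn (fun y : 'rV[R]_m' =>
         g (\row_(i < m'.+1) match unlift ord0 i with
                             | Some j => y ord0 j | None => s end)))
  end.

End Defs.

Local Open Scope complex_scope.

(* I(t; phi) = int e^{i t f(x)} phi(x) dx, phi : R^n -> C *)
Definition osc_int (R : realType) (n : nat) (f : 'rV[R]_n -> R)
  (phi : 'rV[R]_n -> R[i]) (t : R) : R[i] :=
  (intn (fun x => cos (t * f x) * complex.Re (phi x)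
                  - sin (t * f x) * complex.Im (phi x)))
  +i* (intn (fun x => sin (t * f x) * complex.Re (phi x)
                  + cos (t * f x) * complex.Im (phi x))).

Definition asymp_expansion (R : realType) (n : nat) (I : R -> R[i])
  (A : set R) (C : R -> nat -> R[i]) : Prop :=
  forall N : nat, exists K T : R, forall t : R, T <= t ->
    Normc.normc (I t - (\sum_(al \in A `&` [set al | - N%:R <= al])
        \sum_(1 <= k < n.+1) C al k * (t `^ al * (ln t) ^+ (k.-1))%:C))
    <= K * t `^ (- N%:R).

Definition csupport (R : realType) (n : nat) (phi : 'rV[R]_n -> R[i]) :=
  closure [set x | phi x != 0].

(* Main.v *)
Require Import Defs.
From HB Require Import structures.
From mathcomp Require Import all_boot all_order all_algebra.
From mathcomp Require Import all_classical all_reals all_analysis.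
From mathcomp Require Import measurable_realfun complex ring lra zify.

(** In logarithmic coordinates |x_i| = exp (- u_i) a cone of the subdivision with generators
    a_1, ..., a_n becomes the region where the coordinates s_j of u in the basis (a_j) are
    nonnegative, and x^alpha becomes exp (- <alpha, u>).  Weighted symbol classes replace the toric
    resolution: h has weights nu when h = O(exp (- sum_j nu_j s_j)) on every chart and each operator
    D_{a_j} + nu_j raises the weight at a_j by one.  Admission of the gamma-parts puts the phase F in
    the class of weights l(a); nondegeneracy on the compact faces, by a compactness argument along the
    charts, bounds |grad F|^2 below by the square of its weight.

    Integration by parts against grad F / |grad F|^2 trades a factor t for the loss of the weights l,
    and integration by parts along a generator a shows that
    l(a) t d/dt + <a> + nu_a maps oscillatory integrals of symbols of weights nu to those of symbols
    of weights nu + 1_a.  Starting from a symbol localized near one maximal cone (whose weights away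
    from the generators of that cone are arbitrarily large), finitely many such first order operators
    lead to a remainder O(t^{-M}).  Solving this chain of ordinary differential equations in log t
    gives the expansion; each exponent occurs at most once for each of the n generators, whence at
    most n - 1 logarithms.  Uniqueness of expansions makes the coefficients independent of the
    order. *)

Set Implicit Arguments.
Unset Strict Implicit.
Unset Printing Implicit Defensive.

Import Order.TTheory GRing.Theory Num.Theory.
Import numFieldNormedType.Exports.

Local Open Scope classical_set_scope.
Local Open Scope ring_scope.

(** * Differential calculus *)

Section DerivativesAlongLines.
Variables (R : realType) (V : normedModType R).
Implicit Types (h : V -> R) (u v : V).

Lemma is_derive_line h u v (r : R) : derivable h (u + r *: v) v ->
  is_derive r 1 (fun r' : R => h (u + r' *: v)) ('D_v h (u + r *: v)).
Proof.
move=> dh.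
have quotE : (fun k : R => k^-1 *: (((fun r' : R => h (u + r' *: v)) \o shift r) (k *: 1)
    - h (u + r *: v))) = (fun k => k^-1 *: ((h \o shift (u + r *: v)) (k *: v)
      - h (u + r *: v))).
  apply/funext => k /=; rewrite [k%:A]mulr1.
  by do 3 congr (_ _); rewrite scalerDl addrCA.
by split; rewrite /derivable /derive quotE.
Qed.

Lemma is_derive_lineP h u v b :
  is_derive u v h b <-> is_derive (0 : R) 1 (fun r : R => h (u + r *: v)) b.
Proof.
have quotE : (fun k : R => k^-1 *: (((fun r' : R => h (u + r' *: v)) \o shift 0) (k *: 1)
    - h (u + 0 *: v))) = (fun k => k^-1 *: ((h \o shift u) (k *: v) - h u)).
  apply/funext => k /=; rewrite [k%:A]mulr1 scale0r !addr0.
  by do 3 congr (_ _); rewrite addrC.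
by split=> -[]; rewrite /derivable /derive => A <-; split;
  rewrite /derivable /derive ?quotE// -quotE.
Qed.

Lemma MVT_line h u v (r : R) : 0 <= r ->
  (forall r', 0 <= r' <= r -> derivable h (u + r' *: v) v) ->
  exists2 c, 0 <= c <= r & h (u + r *: v) - h u = 'D_v h (u + c *: v) * r.
Proof.
move=> r0 dh.
have [//| |//|] := @MVT_segment R (fun r' => h (u + r' *: v))
  (fun r' => 'D_v h (u + r' *: v)) 0 r.
- move=> x; rewrite in_itv/= => /andP[x0 xr]; apply: is_derive_line.
  by apply: dh; rewrite !ltW.
- apply: derivable_within_continuous => x; rewrite in_itv/= => xr.
  by have [] := is_derive_line (dh x xr).
- move=> c; rewrite in_itv/= => cr E; exists c => //.
  by move: E; rewrite scale0r addr0 subr0.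
Qed.

Lemma MVT_line_signed h u v (r : R) :
  (forall r', `|r'| <= `|r| -> derivable h (u + r' *: v) v) ->
  exists2 c, `|c| <= `|r| & h (u + r *: v) - h u = 'D_v h (u + c *: v) * r.
Proof.
move=> dh; have [r0|r0] := leP 0 r.
  have [r' /andP[a b]|c /andP[a b] E] := MVT_line (h := h) (u := u) (v := v) r0.
    by apply: dh; rewrite !ger0_norm.
  by exists c => //; rewrite !ger0_norm.
have inr x : r <= x <= 0 -> `|x| <= `|r|.
  by move=> /andP[a b]; rewrite !ler0_norm// ?lerN2// ltW.
have [||x] := @MVT_segment R (fun s => h (u + s *: v)) (fun s => 'D_v h (u + s *: v))
  r 0 (ltW r0).
- move=> s; rewrite in_itv/= => /andP[s0 sr]; apply: is_derive_line.
  by apply: dh; apply: inr; rewrite !ltW.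
- apply: derivable_within_continuous => s; rewrite in_itv/= => sr.
  by apply: ex_derive; apply: is_derive_line; apply: dh; apply: inr.
- rewrite in_itv/= => xr; rewrite scale0r addr0 sub0r => E.
  exists x; first exact: inr.
  by rewrite -[LHS]opprB E mulrN opprK.
Qed.

End DerivativesAlongLines.

Section PointwiseDerivationRules.
Variables (R : realType) (V : normedModType R).
Implicit Types (f g h : V -> R) (x v : V).

Lemma is_derive_add f g x v a b : is_derive x v f a -> is_derive x v g b ->
  is_derive x v (fun y => f y + g y) (a + b).
Proof. by move=> fa gb; exact: is_deriveD. Qed.

Lemma is_derive_opp f x v a : is_derive x v f a -> is_derive x v (fun y => - f y) (- a).
Proof. by move=> fa; exact: is_deriveN. Qed.

Lemma is_derive_sub f g x v a b : is_derive x v f a -> is_derive x v g b ->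
  is_derive x v (fun y => f y - g y) (a - b).
Proof. by move=> fa gb; apply: is_derive_add => //; exact: is_derive_opp. Qed.

Lemma is_derive_mul f g x v a b : is_derive x v f a -> is_derive x v g b ->
  is_derive x v (fun y => f y * g y) (a * g x + f x * b).
Proof.
move=> [fa <-] [gb <-]; rewrite -[fun y => _]/(f * g).
split; first exact: (derivableM fa gb).
by rewrite (deriveM fa gb) addrC; congr (_ + _); exact: mulrC.
Qed.

Lemma is_derive_const c x v : is_derive x v (fun=> c : R) 0.
Proof. exact: is_derive_cst. Qed.

Lemma is_derive_scale f x v c a : is_derive x v f a ->
  is_derive x v (fun y => c * f y) (c * a).
Proof.
move=> fa; have D := is_derive_mul (is_derive_const c x v) fa.
by apply: (is_derive_eq D); rewrite mul0r add0r.
Qed.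

Lemma is_derive_inv f x v a : f x != 0 -> is_derive x v f a ->
  is_derive x v (fun y => (f y)^-1) (- a / (f x) ^+ 2).
Proof.
move=> f0 [fa <-]; split; first exact: derivableV.
by rewrite [LHS]deriveV // [_ *: _]mulrC mulrN mulNr.
Qed.

Lemma is_derive_comp (F : R -> R) h x v a b : is_derive (h x) 1 F a ->
  is_derive x v h b -> is_derive x v (fun y => F (h y)) (a * b).
Proof.
move=> Fa /is_derive_lineP hb; apply/is_derive_lineP.
by apply: (is_derive1_comp (f := F) (g := fun r => h (x + r *: v)));
  rewrite ?scale0r ?addr0.
Qed.

Lemma is_derive_bigsum (I : eqType) (s : seq I) (f : I -> V -> R) x v (a : I -> R) :
  (forall i, i \in s -> is_derive x v (f i) (a i)) ->
  is_derive x v (fun y => \sum_(i <- s) f i y) (\sum_(i <- s) a i).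
Proof.
elim: s => [|i s IH] df.
  rewrite big_nil (_ : (fun _ => _) = fun=> 0); first exact: is_derive_const.
  by apply/funext => y; rewrite big_nil.
rewrite big_cons (_ : (fun _ => _) = fun y => f i y + \sum_(j <- s) f j y); last first.
  by apply/funext => y; rewrite big_cons.
apply: is_derive_add; first by apply: df; rewrite mem_head.
by apply: IH => j js; apply: df; rewrite inE js orbT.
Qed.

Lemma derive_eq0 (W : set V) h v u : open W -> W u ->
  (forall x, W x -> h x = 0) -> 'D_v h u = 0.
Proof.
move=> oW Wu hW; rewrite (@near_eq_derive _ _ _ h (cst 0)); first by rewrite derive_cst.
by near=> x; apply: hW; near: x; exact: open_nbhs_nbhs.
Unshelve. all: by end_near. Qed.

End PointwiseDerivationRules.

Section DifferentiableRules.
Variables (R : realType) (V : normedModType R).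
Implicit Types (h k : V -> R) (u v : V).

Lemma differentiable_is_derive h u v : differentiable h u -> is_derive u v h ('D_v h u).
Proof. by move=> dh; apply/derivableP/diff_derivable. Qed.

Lemma derive_add h k u v : differentiable h u -> differentiable k u ->
  'D_v (fun x => h x + k x) u = 'D_v h u + 'D_v k u.
Proof.
by move=> dh dk; apply/derive_val/is_derive_add; exact: differentiable_is_derive.
Qed.

Lemma derive_mul h k u v : differentiable h u -> differentiable k u ->
  'D_v (fun x => h x * k x) u = 'D_v h u * k u + h u * 'D_v k u.
Proof.
by move=> dh dk; apply/derive_val/is_derive_mul; exact: differentiable_is_derive.
Qed.

Lemma derive_scale h c u v : differentiable h u ->
  'D_v (fun x => c * h x) u = c * 'D_v h u.
Proof. by move=> dh; apply/derive_val/is_derive_scale; exact: differentiable_is_derive. Qed.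

Lemma derive_inv h u v : differentiable h u -> h u != 0 ->
  'D_v (fun x => (h x)^-1) u = - 'D_v h u / (h u) ^+ 2.
Proof.
by move=> dh h0; apply/derive_val/is_derive_inv => //; exact: differentiable_is_derive.
Qed.

Lemma differentiable_add h k u : differentiable h u -> differentiable k u ->
  differentiable (fun x => h x + k x) u.
Proof. exact: differentiableD. Qed.

Lemma differentiable_mul h k u : differentiable h u -> differentiable k u ->
  differentiable (fun x => h x * k x) u.
Proof. exact: differentiableM. Qed.

Lemma differentiable_scale h c u : differentiable h u ->
  differentiable (fun x => c * h x) u.
Proof. by move=> dh; apply: differentiable_mul. Qed.

Lemma differentiable_inv h u : differentiable h u -> h u != 0 ->
  differentiable (fun x => (h x)^-1) u.
Proof. exact: differentiableV. Qed.

Lemma differentiable_compR (F : R -> R) h u : derivable F (h u) 1 -> differentiable h u ->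
  differentiable (fun x => F (h x)) u.
Proof. by move=> /derivable1_diffP dF dh; exact: differentiable_comp. Qed.

Lemma near_eq_differentiable h k u : (\near u, h u = k u) -> differentiable h u ->
  differentiable k u.
Proof.
move=> hk dh.
suff expand : k \o shift u = cst (k u) + 'd h u +o_ (0 : V) id.
  apply/diff_locallyP; have E := diff_unique (diff_continuous dh) expand.
  by rewrite E; split=> //; exact: diff_continuous.
have /eqaddoP approx := diff_locally dh; apply/eqaddoP => e e0.
have {}approx := approx e e0; have hk0 := nbhs_singleton hk.
have hk' : \forall x \near (0 : V), h (x + u) = k (x + u).
  by rewrite (near_shift u) /=; near=> x; rewrite /= sub0r subrK; near: x.
near=> x.
have : `|((h \o shift u) \- (cst (h u) + 'd h u)) x| <= e * `|x| by near: x.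
rewrite /= !fctE /= hk0 (_ : h (x + u) = k (x + u))//.
by near: x.
Unshelve. all: by end_near. Qed.

Lemma derive_lincomb (I : finType) h u (c : I -> R) (w : I -> V) : differentiable h u ->
  'D_(\sum_j c j *: w j) h u = \sum_j c j * 'D_(w j) h u.
Proof.
move=> dh; rewrite deriveE// raddf_sum; apply: eq_bigr => j _.
by rewrite [LHS]linearZZ deriveE.
Qed.

End DifferentiableRules.

Section IncrementBounds.
Variable R : realType.
Implicit Types (K L dK dL : R -> R).

Lemma is_derive_expRN (r : R) : is_derive r 1 (fun x => expR (- x)) (- expR (- r)).
Proof. by rewrite -mulrN1; apply: (is_derive_comp (F := expR)). Qed.

Lemma is_derive_mull (c r : R) : is_derive r 1 (fun x : R => c * x) c.
Proof.
by have D := is_derive_scale c (is_derive_id r 1); exact: (is_derive_eq D (mulr1 c)).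
Qed.

Lemma is_derive_expRM (c r : R) :
  is_derive r 1 (fun x => expR (c * x)) (expR (c * r) * c).
Proof. exact: (is_derive_comp (is_derive_expR (c * r)) (is_derive_mull c r)). Qed.

Lemma is_derive_ge0_le K dK (a b : R) : a <= b ->
  (forall r, a <= r <= b -> is_derive r 1 K (dK r)) ->
  (forall r, a <= r <= b -> 0 <= dK r) -> K a <= K b.
Proof.
move=> ab dr dK0.
have [||c] := @MVT_segment R K dK a b ab.
- by move=> x; rewrite in_itv/= => /andP[x0 xr]; apply: dr; rewrite !ltW.
- apply: derivable_within_continuous => x; rewrite in_itv/= => xr.
  by have [] := dr x xr.
- by rewrite in_itv/= => cr E; rewrite -subr_ge0 E mulr_ge0 ?dK0// subr_ge0.
Qed.

Lemma increment_le K dK L dL (a b : R) : a <= b ->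
  (forall r, a <= r <= b -> is_derive r 1 K (dK r)) ->
  (forall r, a <= r <= b -> is_derive r 1 L (dL r)) ->
  (forall r, a <= r <= b -> `|dK r| <= dL r) -> `|K b - K a| <= L b - L a.
Proof.
move=> ab dKP dLP le_d.
have le_sign (e : R) : `|e| <= 1 -> L a - e * K a <= L b - e * K b.
  move=> e1; apply: (is_derive_ge0_le (K := fun r => L r - e * K r)
    (dK := fun r => dL r - e * dK r)) => // r rab.
    by apply: is_derive_sub; [exact: dLP|apply: is_derive_scale; exact: dKP].
  rewrite subr_ge0; apply: le_trans (le_d r rab); apply: le_trans (ler_norm _) _.
  by rewrite normrM ler_piMl.
have := le_sign (-1); have := le_sign 1.
rewrite normrN1 normr1 lexx !mul1r !mulN1r => /(_ isT) up /(_ isT) low.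
by rewrite ler_norml; apply/andP; split; lra.
Qed.

Lemma increment_le_cst K dK (a b C : R) : a <= b ->
  (forall r, a <= r <= b -> is_derive r 1 K (dK r)) ->
  (forall r, a <= r <= b -> `|dK r| <= C) -> `|K b - K a| <= C * (b - a).
Proof.
move=> ab dKP le_C; rewrite mulrBr.
by apply: (increment_le ab dKP) le_C => r _; exact: is_derive_mull.
Qed.

Lemma norm_increment_le K dK (C x y : R) : (forall r : R, is_derive r 1 K (dK r)) ->
  (forall r, `|dK r| <= C) -> `|K x - K y| <= C * `|x - y|.
Proof.
move=> dKP le_C; wlog yx : x y / y <= x => [wlog_le|].
  by have [/wlog_le//|/ltW/wlog_le] := leP y x; rewrite distrC [`|y - x|]distrC.
by rewrite [`|x - y|]ger0_norm ?subr_ge0//; exact: increment_le_cst yx _ _.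
Qed.

Lemma increment_le_expRN K dK (C r : R) : 0 <= r ->
  (forall s, 0 <= s <= r -> is_derive s 1 K (dK s)) ->
  (forall s, 0 <= s <= r -> `|dK s| <= C * expR (- s)) -> `|K r - K 0| <= C.
Proof.
move=> r0 dKP le_C.
have C0 : 0 <= C.
  have := le_C 0; rewrite lexx r0 oppr0 expR0 mulr1 => /(_ isT); exact: le_trans.
apply: (@le_trans _ _ (- C * expR (- r) - - C * expR (- 0))).
  apply: (increment_le (L := fun s => - C * expR (- s)) r0 dKP) le_C => s _.
  by rewrite -[C * _]mulrNN; apply: is_derive_scale; exact: is_derive_expRN.
by rewrite oppr0 expR0 mulr1 opprK mulNr gerDr oppr_le0 mulr_ge0 ?expR_ge0.
Qed.

Lemma quadratic_remainder K dK ddK (v r C : R) :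
  (forall t, 0 <= t <= 1 -> is_derive (v + t * r) 1 K (dK (v + t * r))) ->
  (forall t, 0 <= t <= 1 -> is_derive (v + t * r) 1 dK (ddK (v + t * r))) ->
  (forall t, 0 <= t <= 1 -> `|ddK (v + t * r)| <= C) ->
  `|K (v + r) - K v - r * dK v| <= C * r ^+ 2.
Proof.
move=> dKP ddKP le_C.
have along (G dG : R -> R) (t : R) : is_derive (v + t * r) 1 G (dG (v + t * r)) ->
    is_derive t 1 (fun t => G (v + t * r)) (r * dG (v + t * r)).
  move=> GP; have D := is_derive_add (is_derive_const v t 1)
    (is_derive_mul (is_derive_id t 1) (is_derive_const r t 1)).
  apply: (is_derive_eq (is_derive_comp (F := G) (h := fun t : R => v + t * r) GP D)).
  by rewrite add0r mulr0 addr0 mul1r mulrC.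
have dK_le t : 0 <= t <= 1 -> `|dK (v + t * r) - dK v| <= C * `|r|.
  move=> /andP[t0 t1]; have C0 : 0 <= C by apply: le_trans (le_C 0 _); rewrite ?lexx ?ler01.
  have := @increment_le_cst (fun s => dK (v + s * r)) (fun s => r * ddK (v + s * r))
    0 t (C * `|r|) t0.
  rewrite mul0r addr0 subr0 => bound.
  apply: le_trans (bound _ _) _ => [s /andP[s0 st]|s /andP[s0 st]|].
  - by apply: along; apply: ddKP; rewrite s0 (le_trans st).
  - by rewrite normrM mulrC ler_wpM2r// le_C// s0 (le_trans st).
  - by apply: ler_piMr => //; exact: mulr_ge0.
have := @increment_le_cst (fun t => K (v + t * r) - t * (r * dK v))
  (fun t => r * dK (v + t * r) - 1 * (r * dK v)) 0 1 (`|r| * (C * `|r|)) ler01.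
rewrite !mul0r !mul1r addr0 subr0 subr0 mulr1 addrAC => bound.
rewrite -[r ^+ 2]real_normK ?num_real// expr2 mulrCA; apply: bound => t t01.
  apply: is_derive_sub; first exact/along/dKP.
  have := is_derive_mul (is_derive_id t 1) (is_derive_const (r * dK v) t 1).
  by rewrite mul1r mulr0 addr0.
by rewrite -mulrBr normrM ler_wpM2l// dK_le.
Qed.

Lemma landau_interpolation K dK ddK (p M : R) : 0 <= p ->
  (forall r, 0 <= r <= p -> is_derive r 1 K (dK r)) ->
  (forall r, 0 <= r <= p -> is_derive r 1 dK (ddK r)) ->
  (forall r, 0 <= r <= p -> `|ddK r| <= M) ->
  p * `|dK 0| <= `|K p| + `|K 0| + M * p ^+ 2.
Proof.
move=> p0 dKP ddKP le_M.
have scale t : 0 <= t <= 1 -> 0 <= 0 + t * p <= p.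
  by move=> /andP[t0 t1]; rewrite add0r mulr_ge0//= ler_piMl.
have := @quadratic_remainder K dK ddK 0 p M (fun t t01 => dKP _ (scale t t01))
  (fun t t01 => ddKP _ (scale t t01)) (fun t t01 => le_M _ (scale t t01)).
rewrite add0r -{4}(ger0_norm p0) -normrM; set x := p * _ => rem.
have -> : x = (K p - K 0) - (K p - K 0 - x) by rewrite subKr.
by apply: le_trans (ler_normB _ _) _; rewrite lerD ?ler_normB.
Qed.

Lemma is_derive_quadratic K (v d C : R) :
  (forall r, `|K (v + r) - K v - r * d| <= C * r ^+ 2) -> is_derive v 1 K d.
Proof.
move=> quad.
have cv : (fun h : R => h^-1 *: ((K \o shift v) (h *: 1) - K v)) @ 0^' --> d.
  apply/cvgrPdist_le => e e0; have C1 : 0 < `|C| + 1 by rewrite ltr_wpDl.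
  near=> h.
  have h0 : h != 0 by near: h; exact: nbhs_dnbhs_neq.
  have he : `|h| <= e / (`|C| + 1) by near: h; apply: dnbhs0_le; rewrite divr_gt0.
  rewrite /= [h *: 1]mulr1 [h + v]addrC [_ *: _]mulrC distrC.
  rewrite (_ : _ - d = (K (v + h) - K v - h * d) / h); last by field.
  rewrite normrM normfV ler_pdivrMr ?normr_gt0//.
  apply: le_trans (quad h) _; apply: (@le_trans _ _ ((`|C| + 1) * `|h| * `|h|)).
    rewrite -mulrA -expr2 real_normK ?num_real//; apply: ler_wpM2r; first exact: sqr_ge0.
    by apply: le_trans (ler_norm _) _; rewrite lerDl.
  by apply: ler_wpM2r => //; rewrite mulrC -ler_pdivlMr.
by split; [apply/cvg_ex; exists d|exact: (cvg_lim _ cv)].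
Unshelve. all: by end_near. Qed.

End IncrementBounds.

Section SymmetryOfSecondDerivatives.
Variables (R : realType) (V : normedModType R).
Implicit Types (h : V -> R) (u v w : V).

Lemma mixed_difference h u v w (r : R) : 0 < r ->
  (forall s t, 0 <= s <= r -> 0 <= t <= r ->
     derivable h (u + s *: v + t *: w) v /\ derivable ('D_v h) (u + s *: v + t *: w) w) ->
  exists s t, [/\ 0 <= s <= r, 0 <= t <= r &
    h (u + r *: v + r *: w) - h (u + r *: v) - (h (u + r *: w) - h u) =
      'D_w ('D_v h) (u + s *: v + t *: w) * r ^+ 2].
Proof.
move=> r0 dh.
have rr : 0 <= r <= r by rewrite lexx ltW.
have zr : 0 <= (0 : R) <= r by rewrite lexx ltW.
pose k s := h (u + s *: v + r *: w) - h (u + s *: v).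
have dk s : 0 <= s <= r -> is_derive s 1 k ('D_v h (u + s *: v + r *: w) - 'D_v h (u + s *: v)).
  move=> sr; apply: is_derive_sub; last first.
    by apply: is_derive_line; have [+ _] := dh s 0 sr zr; rewrite scale0r addr0.
  rewrite (_ : (fun y => _) = (fun y => h (u + r *: w + y *: v))); last first.
    by apply/funext => y; rewrite addrAC.
  by rewrite addrAC; apply: is_derive_line; rewrite addrAC; have [+ _] := dh s r sr rr.
have [||s] := @MVT_segment R k
    (fun s => 'D_v h (u + s *: v + r *: w) - 'D_v h (u + s *: v)) 0 r (ltW r0).
- by move=> s; rewrite in_itv/= => /andP[s0 sr]; apply: dk; rewrite !ltW.
- by apply: derivable_within_continuous => s; rewrite in_itv/= => /dk[].
- rewrite in_itv/= => sr E.
  have [t' t'r|t tr E'] := MVT_line (h := 'D_v h) (u := u + s *: v) (v := w) (ltW r0).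
    by have [] := dh s t' sr t'r.
  exists s, t; split=> //; move: E; rewrite /k !scale0r !addr0 subr0 => ->.
  by rewrite E' expr2 mulrA.
Qed.

Lemma near_parallelogram (Q : set V) u v w : nbhs u Q ->
  \forall r \near (0 : R)^'+,
    forall s t, 0 <= s <= r -> 0 <= t <= r -> Q (u + s *: v + t *: w).
Proof.
move=> /nbhs_ballP[d /= d0 ballQ]; pose M := `|v| + `|w| + 1.
have M0 : 0 < M by rewrite ltr_wpDl// addr_ge0.
near=> r => s t /andP[s0 sr] /andP[t0 tr]; apply: ballQ.
have rd : r < d / M by near: r; apply: nbhs_right_lt; exact: divr_gt0.
rewrite -ball_normE/= -addrA opprD addrA subrr sub0r normrN.
apply: le_lt_trans (ler_normD _ _) _; rewrite !normrZ !ger0_norm//.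
apply: (@le_lt_trans _ _ (r * M)); last by rewrite -ltr_pdivlMr.
rewrite /M !mulrDr -addrA; apply: lerD; first exact: ler_wpM2r.
by apply: ler_wpDr; [rewrite mulr1 (le_trans s0)|exact: ler_wpM2r].
Unshelve. all: by end_near. Qed.

Definition mixed_quotient h u v w (r : R) :=
  (h (u + r *: v + r *: w) - h (u + r *: v) - (h (u + r *: w) - h u)) / r ^+ 2.

Lemma mixed_quotientC h u v w : mixed_quotient h u v w = mixed_quotient h u w v.
Proof.
by apply/funext => r; congr (_ / _); rewrite (addrAC u (r *: v)); ring.
Qed.

Lemma mixed_quotient_cvg (O : set V) h u v w : open O -> O u ->
  (forall x, O x -> derivable h x v /\ derivable ('D_v h) x w) ->
  {for u, continuous ('D_w ('D_v h))} ->
  mixed_quotient h u v w r @[r --> (0 : R)^'+] --> 'D_w ('D_v h) u.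
Proof.
move=> oO Ou dh cD; apply/cvgrPdist_le => e e0.
have nearO := near_parallelogram v w (open_nbhs_nbhs (conj oO Ou)).
have /cvgrPdist_le/(_ _ e0)/(near_parallelogram v w) nearD := cD.
near=> r; have r0 : 0 < r by [].
have inO : forall s t, 0 <= s <= r -> 0 <= t <= r -> O (u + s *: v + t *: w) by near: r.
have inD : forall s t, 0 <= s <= r -> 0 <= t <= r ->
  `|'D_w ('D_v h) u - 'D_w ('D_v h) (u + s *: v + t *: w)| <= e by near: r.
have [s t sr tr|s [t [sr tr E]]] := mixed_difference (h := h) (u := u) (v := v) (w := w) r0.
  exact/dh/inO.
by rewrite /mixed_quotient E mulfK ?inD// expf_neq0// gt_eqF.
Unshelve. all: by end_near. Qed.

Lemma derive_comm (O : set V) h v w u : open O -> O u ->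
  (forall x, O x -> [/\ derivable h x v, derivable h x w,
     derivable ('D_v h) x w & derivable ('D_w h) x v]) ->
  {for u, continuous ('D_w ('D_v h))} -> {for u, continuous ('D_v ('D_w h))} ->
  'D_w ('D_v h) u = 'D_v ('D_w h) u.
Proof.
move=> oO Ou dh cwv cvw.
have Lwv := mixed_quotient_cvg oO Ou (fun x Ox =>
  let: And4 dv _ dvw _ := dh x Ox in conj dv dvw) cwv.
have Lvw := mixed_quotient_cvg oO Ou (fun x Ox =>
  let: And4 _ dw _ dwv := dh x Ox in conj dw dwv) cvw.
by rewrite mixed_quotientC in Lvw; exact: cvg_unique Lwv Lvw.
Qed.

End SymmetryOfSecondDerivatives.

Section DotProduct.
Variables (R : realType) (n : nat).
Implicit Types (a b x y : 'rV[R]_n).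

Lemma dotpC a x : dotp a x = dotp x a.
Proof. by apply: eq_bigr => i _; rewrite mulrC. Qed.

Lemma dotp_is_linear a : linear (dotp a : 'rV[R]_n -> R).
Proof.
move=> c x y; rewrite -[X in _ = X + _]/(c * dotp a x) /dotp mulr_sumr -big_split/=.
by apply: eq_bigr => i _; rewrite !mxE mulrDr mulrCA.
Qed.
HB.instance Definition _ a := GRing.isLinear.Build R 'rV[R]_n R *:%R (dotp a)
  (dotp_is_linear a).

Lemma dotpDl a b x : dotp (a + b) x = dotp a x + dotp b x.
Proof. by rewrite dotpC linearD/= !(dotpC x). Qed.

Lemma dotpNl a x : dotp (- a) x = - dotp a x.
Proof. by rewrite dotpC linearN/= dotpC. Qed.

Lemma dotpBl a b x : dotp (a - b) x = dotp a x - dotp b x.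
Proof. by rewrite dotpDl dotpNl. Qed.

Lemma dotpZr a (c : R) x : dotp a (c *: x) = c * dotp a x.
Proof. exact: linearZ. Qed.

Lemma dotpZl (c : R) a x : dotp (c *: a) x = c * dotp a x.
Proof. by rewrite dotpC dotpZr (dotpC x). Qed.

Lemma dotp_evec (j : 'I_n) x : dotp (evec R j) x = x ord0 j.
Proof.
rewrite /dotp (bigD1 j)//= big1 ?addr0; first by rewrite /evec mxE !eqxx mul1r.
by move=> i /negbTE ij; rewrite /evec mxE ij andbF mul0r.
Qed.

Lemma dotp_continuous a : continuous (dotp a).
Proof.
apply: continuous_big => [|i _ x]; first exact: add_continuous.
apply: continuousM; first exact: cst_continuous.
exact: (@coord_continuous R 1 n ord0 i x).
Qed.

Lemma differentiable_dotp a x : differentiable (dotp a) x.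
Proof. by apply: linear_differentiable; exact: dotp_continuous. Qed.

Lemma is_derive_dotp a x v : is_derive x v (dotp a) (dotp a v).
Proof.
have da := differentiable_dotp a x; split; first exact: diff_derivable.
by rewrite deriveE// diff_lin//; exact: dotp_continuous.
Qed.

Lemma open_dotp_lt a (c : R) : open [set x | dotp a x < c].
Proof.
apply: (@open_comp _ _ (dotp a) [set z | z < c]); last exact: open_lt.
by move=> x _; exact: dotp_continuous.
Qed.

Lemma row_sum_evec x : x = \sum_i x ord0 i *: evec R i.
Proof. by rewrite [LHS]row_sum_delta. Qed.

End DotProduct.

Section ContinuousPartialDerivatives.
Variables (R : realType) (n : nat).
Implicit Types (h : 'rV[R]_n -> R) (u w : 'rV[R]_n).

Lemma norm_coord u i : `|u ord0 i| <= `|u|.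
Proof.
rewrite [leRHS]/Num.norm/= mx_normrE.
exact: (le_bigmax_cond _ (j := (ord0, i)) (fun i : 'I_1 * 'I_n => `|u i.1 i.2|) isT).
Qed.

Lemma norm_row_le u (e : R) : 0 <= e -> (forall i, `|u ord0 i| <= e) -> `|u| <= e.
Proof.
move=> e0 le_e; rewrite [leLHS]/Num.norm/= mx_normrE.
by apply: bigmax_le => // -[i j] _; rewrite (ord1 i) le_e.
Qed.

Lemma cvg_row (T : Type) (G : set_system T) (F : T -> 'rV[R]_n) (l : 'rV[R]_n) :
  Filter G -> (forall i, F y ord0 i @[y --> G] --> l ord0 i) -> F y @[y --> G] --> l.
Proof.
move=> FG cF; apply/cvgrPdist_le => e e0.
have : \forall y \near G, forall i, `|l ord0 i - F y ord0 i| <= e.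
  by apply: filter_forall => i; have /cvgrPdist_le/(_ _ e0) := cF i.
by apply: filterS => y le_e; apply: norm_row_le => [|i]; rewrite ?mxE ?le_e// ltW.
Qed.

Definition row_prefix w (k : nat) : 'rV[R]_n := \row_i (if (i < k)%N then w ord0 i else 0).

Lemma row_prefix0 w : row_prefix w 0 = 0.
Proof. by apply/rowP => i; rewrite !mxE. Qed.

Lemma row_prefix_full w : row_prefix w n = w.
Proof. by apply/rowP => i; rewrite !mxE ltn_ord. Qed.

Lemma row_prefixS w (i : 'I_n) : row_prefix w i.+1 = row_prefix w i + w ord0 i *: evec R i.
Proof.
apply/rowP => j; rewrite !mxE eqxx/= ltnS leq_eqVlt.
have [->|ji] := eqVneq j i; first by rewrite eqxx ltnn/= mulr1 add0r.
by rewrite (_ : (j == i :> nat) = false)/= ?mulr0 ?addr0//; apply/negbTE.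
Qed.

Lemma norm_row_prefixD w (i : 'I_n) (r : R) : `|r| <= `|w ord0 i| ->
  `|row_prefix w i + r *: evec R i| <= `|w|.
Proof.
move=> rw; apply: norm_row_le => // j; rewrite !mxE eqxx/=.
have [->|ji] := eqVneq j i.
  by rewrite ltnn add0r mulr1 (le_trans rw)// norm_coord.
by rewrite mulr0 addr0; case: ifP => _; rewrite ?normr0// norm_coord.
Qed.

Lemma partial_increment_bound h u w (d e : R) i :
  (forall x, `|x| < d -> derivable h (u + x) (evec R i) /\
     `|'D_(evec R i) h u - 'D_(evec R i) h (u + x)| <= e) -> `|w| < d ->
  `|h (u + row_prefix w i.+1) - h (u + row_prefix w i) - w ord0 i * 'D_(evec R i) h u|
    <= e * `|w|.
Proof.
move=> le_deriv wd.
have near_u r : `|r| <= `|w ord0 i| -> _ :=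
  fun rw => le_deriv _ (le_lt_trans (norm_row_prefixD rw) wd).
have [r rw|r rw E] := MVT_line_signed (h := h) (u := u + row_prefix w i) (v := evec R i)
    (r := w ord0 i).
  by rewrite -addrA; have [] := near_u r rw.
rewrite (row_prefixS w i) addrA E mulrC -mulrBr normrM mulrC; apply: ler_pM => //.
  by rewrite distrC -addrA; have [] := near_u r rw.
exact: norm_coord.
Qed.

Lemma gradient_increment_bound h u w (d e : R) :
  (forall x, `|x| < d -> forall i, derivable h (u + x) (evec R i) /\
     `|'D_(evec R i) h u - 'D_(evec R i) h (u + x)| <= e) -> `|w| < d ->
  `|h (u + w) - h u - dotp (\row_i 'D_(evec R i) h u) w| <= n%:R * e * `|w|.
Proof.
move=> le_deriv wd.
have -> : h (u + w) - h u = \sum_(i < n) (h (u + row_prefix w i.+1) - h (u + row_prefix w i)).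
  rewrite -(big_mkord xpredT (fun i => h (u + row_prefix w i.+1) - h (u + row_prefix w i))).
  by rewrite telescope_sumr// row_prefix_full row_prefix0 addr0.
rewrite /dotp -sumrB; apply: le_trans (ler_norm_sum _ _ _) _.
apply: (@le_trans _ _ (\sum_(i < n) e * `|w|)); last first.
  by rewrite sumr_const card_ord -(mulr_natl (e * _)) mulrA.
apply: ler_sum => i _; rewrite mxE mulrC.
by apply: partial_increment_bound wd => x xd; exact: le_deriv.
Qed.

Lemma differentiable_C1 (O : set 'rV[R]_n) h u : open O -> O u ->
  (forall x, O x -> forall i, derivable h x (evec R i)) ->
  (forall i, {for u, continuous ('D_(evec R i) h)}) ->
  differentiable h u.
Proof.
move=> oO Ou dh ch.
pose c : 'rV[R]_n := \row_i 'D_(evec R i) h u.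
suff expand : h \o shift u = cst (h u) + dotp c +o_ (0 : 'rV[R]_n) id.
  apply/diff_locallyP; have E := diff_unique (@dotp_continuous R n c) expand.
  by rewrite E; split=> //; exact: dotp_continuous.
apply/eqaddoP => _/posnumP[e].
pose e' : R := e%:num / (n.+1)%:R.
have e'0 : 0 < e' by rewrite divr_gt0// ltr0n.
have : \forall x \near u, O x /\ forall i, `|'D_(evec R i) h u - 'D_(evec R i) h x| <= e'.
  near=> x; split; first by near: x; exact: open_nbhs_nbhs.
  by near: x; apply: filter_forall => i; have /cvgrPdist_le/(_ _ e'0) := ch i.
move=> /nbhs_ballP[d /= d0 near_u]; near=> w => /=.
have wd : `|w| < d.
  by near: w; apply/nbhs_ballP; exists d => //= x; rewrite -ball_normE/= sub0r normrN.
rewrite !fctE/= opprD addrA [w + u]addrC.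
apply: le_trans (gradient_increment_bound (d := d) (e := e') _ wd) _ => [x xd i|].
  have [|Ox Dx] := near_u (u + x); last by split; [exact: dh|exact: Dx].
  by rewrite -ball_normE/= opprD addrA subrr sub0r normrN.
rewrite ler_wpM2r// /e' mulrCA ler_piMr//.
by rewrite ler_pdivrMr ?ltr0n// mul1r ler_nat.
Unshelve. all: by end_near. Qed.

End ContinuousPartialDerivatives.

Section ChainRule.
Variables (R : realType) (n : nat) (V : normedModType R).
Implicit Types (F : V -> 'rV[R]_n) (g : 'rV[R]_n -> R) (u v : V).

Lemma differentiable_row F u :
  (forall i, differentiable (fun x => F x ord0 i) u) -> differentiable F u.
Proof.
move=> dF; rewrite (_ : F = \sum_(i < n) (fun x => F x ord0 i *: evec R i)).
  by apply: differentiable_sum => i; exact: differentiableZl.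
by apply/funext => x; rewrite fct_sumE -row_sum_evec.
Qed.

Lemma derive_comp_row F g u v : (forall i, differentiable (fun x => F x ord0 i) u) ->
  differentiable g (F u) ->
  'D_v (fun x => g (F x)) u = \sum_i 'D_v (fun x => F x ord0 i) u * pd i g (F u).
Proof.
move=> dFi dg; have dF := differentiable_row dFi.
rewrite deriveE; last exact: (differentiable_comp dF dg).
rewrite (diff_comp dF dg)/= -(deriveE _ dF) -(deriveE _ dg) derive_mx; last exact: diff_derivable.
rewrite [X in 'D_X g _]row_sum_evec derive_lincomb//.
by apply: eq_bigr => i _; rewrite mxE.
Qed.

End ChainRule.

(** * Weighted symbol classes *)

Section SymbolClass.
Variables (R : realType) (n : nat).
Variables (Omega region : set 'rV[R]_n).
Variables (d : 'I_n -> 'rV[R]_n) (s : 'I_n -> 'rV[R]_n -> R) (gain : int).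
Hypothesis open_Omega : open Omega.
Hypothesis regionS : region `<=` Omega.
Implicit Types (h : 'rV[R]_n -> R) (u v : 'rV[R]_n) (mu nu : 'I_n -> int).

Definition weight nu u : R := expR (- \sum_k (nu k)%:~R * s k u).
Definition weight_bounded nu h :=
  exists C, forall u, region u -> `|h u| <= C * weight nu u.
Definition raise (g : int) nu (j : 'I_n) : 'I_n -> int := fun i => nu i + g *+ (i == j).
Definition weight_derive nu (j : 'I_n) h u : R := 'D_(d j) h u + (nu j)%:~R * h u.

Fixpoint symbol (N : nat) nu h : Prop :=
  [/\ (forall u, Omega u -> {for u, continuous h}), weight_bounded nu h
    & (if N is N'.+1 then (forall u, Omega u -> differentiable h u) /\
          forall j, symbol N' (raise gain nu j) (weight_derive nu j h)
       else True)].

Lemma weightD mu nu u : weight (fun k => mu k + nu k) u = weight mu u * weight nu u.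
Proof.
rewrite /weight -expRD -opprD -big_split/=; congr (expR (- _)).
by apply: eq_bigr => k _; rewrite rmorphD mulrDl.
Qed.

Lemma weightN nu u : weight (fun k => - nu k) u = (weight nu u)^-1.
Proof.
rewrite /weight -expRN; congr (expR (- _)); rewrite -sumrN.
by apply: eq_bigr => k _; rewrite rmorphN mulNr.
Qed.

Lemma weight0 u : weight (fun=> 0) u = 1.
Proof. by rewrite /weight big1 ?oppr0 ?expR0// => k _; rewrite mul0r. Qed.

Lemma weight_gt0 nu u : 0 < weight nu u.
Proof. exact: expR_gt0. Qed.

Lemma weight_raise g nu j u : weight (raise g nu j) u = weight nu u * expR (- (g%:~R * s j u)).
Proof.
rewrite /weight -expRD -opprD; congr (expR (- _)).
rewrite (eq_bigr (fun k : 'I_n => (nu k)%:~R * s k u + (g *+ (k == j))%:~R * s k u)); last first.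
  by move=> k _; rewrite rmorphD mulrDl.
rewrite big_split/=; congr (_ + _); rewrite (bigD1 j)//= eqxx mulr1n big1 ?addr0//.
by move=> k /negbTE ->; rewrite mulr0n mul0r.
Qed.

Lemma weight_boundedD nu h k : weight_bounded nu h -> weight_bounded nu k ->
  weight_bounded nu (fun u => h u + k u).
Proof.
move=> [C bh] [C' bk]; exists (C + C') => u Ru.
by apply: le_trans (ler_normD _ _) _; rewrite mulrDl lerD ?bh ?bk.
Qed.

Lemma weight_boundedM mu nu h k : weight_bounded mu h -> weight_bounded nu k ->
  weight_bounded (fun i => mu i + nu i) (fun u => h u * k u).
Proof.
move=> [C bh] [C' bk]; exists (C * C') => u Ru.
by rewrite normrM weightD mulrACA ler_pM ?bh ?bk.
Qed.

Lemma symbol_continuous N nu h u : symbol N nu h -> Omega u -> {for u, continuous h}.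
Proof. by case: N => [|N] [] ch _ _ /ch. Qed.

Lemma symbol_bounded N nu h : symbol N nu h -> weight_bounded nu h.
Proof. by case: N => [|N] []. Qed.

Lemma symbol_bounded_ge0 N nu h : symbol N nu h ->
  exists C, 0 <= C /\ forall u, region u -> `|h u| <= C * weight nu u.
Proof.
move=> /symbol_bounded[C bh]; exists `|C|; split=> // u /bh /le_trans; apply.
by rewrite ler_wpM2r ?ler_norm// ltW// weight_gt0.
Qed.

Lemma symbol_differentiable N nu h u : symbol N.+1 nu h -> Omega u -> differentiable h u.
Proof. by move=> [_ _ [dh _]] /dh. Qed.

Lemma symbol_raise N nu h j : symbol N.+1 nu h ->
  symbol N (raise gain nu j) (weight_derive nu j h).
Proof. by move=> [_ _ [_ st]]; exact: st. Qed.

Lemma symbolS N nu h : (forall u, Omega u -> differentiable h u) -> weight_bounded nu h ->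
  (forall j, symbol N (raise gain nu j) (weight_derive nu j h)) -> symbol N.+1 nu h.
Proof. by move=> dh bh st; split=> // u Ou; exact/differentiable_continuous/dh. Qed.

Lemma symbolW N nu h : symbol N.+1 nu h -> symbol N nu h.
Proof.
elim: N nu h => [|N IH] nu h [ch bh [dh st]]; first by split.
by apply: symbolS => // j; apply: IH.
Qed.

Lemma eq_symbol N nu h k : (forall u, Omega u -> h u = k u) -> symbol N nu h -> symbol N nu k.
Proof.
have nearE (h' k' : 'rV[R]_n -> R) u : (forall u, Omega u -> h' u = k' u) -> Omega u ->
    \near u, h' u = k' u.
  by move=> hk Ou; near=> x; apply: hk; near: x; exact: open_nbhs_nbhs.
have bndE nu' h' k' : (forall u, Omega u -> h' u = k' u) ->
    weight_bounded nu' h' -> weight_bounded nu' k'.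
  by move=> hk [C bh]; exists C => u Ru; rewrite -hk; [exact: bh|exact: regionS].
elim: N nu h k => [|N IH] nu h k hk [ch bh st].
  split=> //; [|exact: bndE bh] => u Ou A; rewrite /= -(hk u Ou) => /(ch u Ou) nA.
  by apply: filterS2 (nearE _ _ _ hk Ou) nA => x /= ->.
case: st => dh st; apply: symbolS => [u Ou||j]; last 2 first.
- exact: bndE bh.
- apply: IH (st j) => u Ou; rewrite /weight_derive hk//; congr (_ + _).
  by apply: near_eq_derive; apply: nearE.
by apply: near_eq_differentiable (dh u Ou); apply: nearE.
Unshelve. all: by end_near. Qed.

Lemma eq_symbol_weight N mu nu h : (forall k, mu k = nu k) -> symbol N mu h -> symbol N nu h.
Proof. by move=> /funext ->. Qed.

Lemma symbol0 N nu : symbol N nu (fun=> 0).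
Proof.
have b0 nu' : weight_bounded nu' (fun=> 0) by exists 0 => u _; rewrite normr0 mul0r.
elim: N nu => [|N IH] nu; first by split=> // u _; exact: cst_continuous.
apply: symbolS => // j; apply: eq_symbol (IH _) => u _.
by rewrite /weight_derive derive_cst mulr0 addr0.
Qed.

Lemma symbolD N nu h k : symbol N nu h -> symbol N nu k -> symbol N nu (fun u => h u + k u).
Proof.
elim: N nu h k => [|N IH] nu h k [ch bh sth] [ck bk stk].
  split=> //; last exact: weight_boundedD.
  by move=> u Ou; apply: continuousD; [exact: ch|exact: ck].
case: sth => dh sth; case: stk => dk stk; apply: symbolS => [u Ou||j].
- by apply: differentiable_add; [exact: dh|exact: dk].
- exact: weight_boundedD.
apply: eq_symbol (IH _ _ _ (sth j) (stk j)) => u Ou.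
by rewrite /weight_derive (derive_add _ (dh u Ou) (dk u Ou)); ring.
Qed.

Lemma symbolZ N nu h a : symbol N nu h -> symbol N nu (fun u => a * h u).
Proof.
have bZ nu' h' : weight_bounded nu' h' -> weight_bounded nu' (fun u => a * h' u).
  move=> [C bh]; exists (`|a| * C) => u Ru; rewrite normrM -mulrA ler_wpM2l//; exact: bh.
elim: N nu h => [|N IH] nu h [ch bh st].
  split=> //; last exact: bZ.
  by move=> u Ou; apply: continuousM; [exact: cst_continuous|exact: ch].
case: st => dh st; apply: symbolS => [u Ou||j]; last 2 first.
- exact: bZ.
- apply: eq_symbol (IH _ _ (st j)) => u Ou.
  by rewrite /weight_derive (derive_scale _ _ (dh u Ou)); ring.
by apply: differentiable_scale; exact: dh.
Qed.

Lemma symbolN N nu h : symbol N nu h -> symbol N nu (fun u => - h u).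
Proof. by move=> /(symbolZ (-1)); apply: eq_symbol => u _; rewrite mulN1r. Qed.

Lemma symbolB N nu h k : symbol N nu h -> symbol N nu k -> symbol N nu (fun u => h u - k u).
Proof. by move=> ch /symbolN; apply: symbolD. Qed.

Lemma symbol_sum (I : eqType) (r : seq I) N nu (h : I -> 'rV[R]_n -> R) :
  (forall i, i \in r -> symbol N nu (h i)) -> symbol N nu (fun u => \sum_(i <- r) h i u).
Proof.
elim: r => [|i r IH] sh.
  by apply: eq_symbol (symbol0 _ _) => u _; rewrite big_nil.
apply: (@eq_symbol _ _ (fun u => h i u + \sum_(j <- r) h j u)).
  by move=> u _; rewrite big_cons.
apply: symbolD; first by apply: sh; rewrite mem_head.
by apply: IH => j jr; apply: sh; rewrite inE jr orbT.
Qed.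

Lemma raiseDl g mu nu j : raise g (fun k => mu k + nu k) j = (fun k => raise g mu j k + nu k).
Proof. by apply/funext => k; rewrite /raise addrAC. Qed.

Lemma raiseDr g mu nu j : raise g (fun k => mu k + nu k) j = (fun k => mu k + raise g nu j k).
Proof. by apply/funext => k; rewrite /raise addrA. Qed.

Lemma symbolM N mu nu h k : symbol N mu h -> symbol N nu k ->
  symbol N (fun i => mu i + nu i) (fun u => h u * k u).
Proof.
elim: N mu nu h k => [|N IH] mu nu h k sh sk; have [ch bh sth] := sh; have [ck bk stk] := sk.
  split=> //; last exact: weight_boundedM.
  by move=> u Ou; apply: continuousM; [exact: ch|exact: ck].
case: sth => dh sth; case: stk => dk stk; apply: symbolS => [u Ou||j]; last 2 first.
- exact: weight_boundedM.
- have Dh_k := IH _ _ _ _ (sth j) (symbolW sk); rewrite -raiseDl in Dh_k.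
  have h_Dk := IH _ _ _ _ (symbolW sh) (stk j); rewrite -raiseDr in h_Dk.
  apply: eq_symbol (symbolD Dh_k h_Dk) => u Ou.
  by rewrite /weight_derive (derive_mul _ (dh u Ou) (dk u Ou)) rmorphD; ring.
by apply: differentiable_mul; [exact: dh|exact: dk].
Qed.

Lemma symbolV N nu h c : 0 < c -> (forall u, region u -> c * weight nu u <= `|h u|) ->
  (forall u, Omega u -> h u != 0) -> symbol N nu h ->
  symbol N (fun i => - nu i) (fun u => (h u)^-1).
Proof.
move=> c0 lb h0.
have bV : weight_bounded (fun i => - nu i) (fun u => (h u)^-1).
  exists c^-1 => u Ru; rewrite normfV weightN -invfM lef_pV2 ?lb// posrE.
    by rewrite normr_gt0 h0//; exact: regionS.
  by rewrite mulr_gt0// weight_gt0.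
elim: N => [|N IH] sh; have [ch bh st] := sh.
  by split=> // u Ou; apply: continuousV; [exact: h0|exact: ch].
have sV := IH (symbolW sh); case: st => dh st; apply: symbolS => [u Ou||j] //.
  by apply: differentiable_inv; [exact: dh|exact: h0].
have -> : raise gain (fun i => - nu i) j = (fun k => raise gain nu j k - nu k - nu k).
  by apply/funext => k; rewrite /raise; ring.
apply: eq_symbol (symbolN (symbolM (symbolM (st j) sV) sV)) => u Ou; have hu := h0 u Ou.
by rewrite /weight_derive (derive_inv _ (dh u Ou) hu) rmorphN /=; field.
Qed.

Lemma symbol_homogeneous N nu h : (forall u, Omega u -> differentiable h u) ->
  weight_bounded nu h ->
  (forall u j, Omega u -> 'D_(d j) h u = - ((nu j)%:~R * h u)) -> symbol N nu h.
Proof.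
move=> dh bh D; case: N => [|N].
  by split=> // u Ou; apply: differentiable_continuous; exact: dh.
apply: symbolS => // j; apply: eq_symbol (symbol0 _ _) => u Ou.
by rewrite /weight_derive D// addNr.
Qed.

Lemma symbol_cst N c : symbol N (fun=> 0) (fun=> c).
Proof.
apply: symbol_homogeneous.
- by move=> u _; exact: differentiable_cst.
- by exists `|c| => u _; rewrite weight0 mulr1.
- by move=> u j _; rewrite derive_val mul0r oppr0.
Qed.

Section NonnegativeCoordinates.
Hypothesis gain01 : 0 <= gain <= 1.
Hypothesis coord_ge0 : forall u k, region u -> 0 <= s k u.

Lemma le_weight mu nu u : (forall k, nu k <= mu k) -> region u -> weight mu u <= weight nu u.
Proof.
move=> le Ru; rewrite /weight ler_expR lerN2; apply: ler_sum => k _.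
by rewrite ler_wpM2r ?coord_ge0// ler_int.
Qed.

Lemma le_weight_bounded mu nu h : (forall k, nu k <= mu k) ->
  weight_bounded mu h -> weight_bounded nu h.
Proof.
move=> le [C bh]; exists `|C| => u Ru; apply: le_trans (bh u Ru) _.
apply: le_trans (ler_norm _) _; rewrite normrM ler_wpM2l//.
by rewrite ger0_norm ?le_weight// ltW// weight_gt0.
Qed.

Lemma le_symbol N mu nu h : (forall k, nu k <= mu k) -> symbol N mu h -> symbol N nu h.
Proof.
elim: N mu nu h => [|N IH] mu nu h le sh; have [ch bh st] := sh.
  by split=> //; exact: le_weight_bounded bh.
case: st => dh st; apply: symbolS => [//||j]; first exact: le_weight_bounded bh.
have Dh : symbol N (raise gain nu j) (weight_derive mu j h).
  by apply: IH (st j) => k; rewrite /raise lerD2r.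
have [e|ne] := eqVneq (mu j) (nu j); first by rewrite /weight_derive -e.
have hj : symbol N (raise gain nu j) h.
  apply: IH (symbolW sh) => k; rewrite /raise.
  have [->|kj] := eqVneq k j; last by rewrite mulr0n addr0.
  by have := le j; rewrite mulr1n; case/andP: gain01 => _; move/eqP: ne; lia.
apply: eq_symbol (symbolD Dh (symbolZ ((nu j)%:~R - (mu j)%:~R) hj)) => u Ou.
by rewrite /weight_derive; ring.
Qed.

Lemma symbol_derive N nu h j : symbol N.+1 nu h -> symbol N nu (fun u => 'D_(d j) h u).
Proof.
move=> sh; have Dh : symbol N nu (weight_derive nu j h).
  apply: le_symbol (symbol_raise j sh) => k; rewrite /raise lerDl mulrn_wge0//.
  by case/andP: gain01.
apply: eq_symbol (symbolD Dh (symbolZ (- (nu j)%:~R) (symbolW sh))) => u Ou.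
by rewrite /weight_derive; ring.
Qed.

Lemma symbol_derive_span N nu h (c : 'I_n -> R) v : v = \sum_j c j *: d j ->
  symbol N.+1 nu h -> symbol N nu (fun u => 'D_v h u).
Proof.
move=> vE sh.
have Dh : symbol N nu (fun u => \sum_(j <- index_enum 'I_n) c j * 'D_(d j) h u).
  by apply: symbol_sum => j _; apply: symbolZ; apply: symbol_derive.
apply: eq_symbol Dh => u Ou.
by rewrite vE derive_lincomb//; exact: symbol_differentiable sh Ou.
Qed.

Lemma symbol_derive_comm nu h i j u : symbol 3 nu h -> Omega u ->
  'D_(d i) ('D_(d j) h) u = 'D_(d j) ('D_(d i) h) u.
Proof.
move=> sh Ou.
have sD i' : symbol 2 nu (fun u => 'D_(d i') h u) by exact: symbol_derive.
have sDD i' j' : symbol 1 nu (fun u => 'D_(d i') ('D_(d j') h) u).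
  exact: (symbol_derive i' (sD j')).
apply: (derive_comm open_Omega Ou); last 2 first.
- exact: symbol_continuous (sDD _ _) Ou.
- exact: symbol_continuous (sDD _ _) Ou.
move=> x Ox; split; apply: diff_derivable.
- exact: symbol_differentiable sh Ox.
- exact: symbol_differentiable sh Ox.
- exact: symbol_differentiable (sD _) Ox.
- exact: symbol_differentiable (sD _) Ox.
Qed.

Lemma weight_derive_comm kappa mu nu h i j u : symbol 3 kappa h -> Omega u ->
  weight_derive mu i (weight_derive nu j h) u = weight_derive nu j (weight_derive mu i h) u.
Proof.
move=> sh Ou; have dh := symbol_differentiable sh Ou.
have dD i' : differentiable (fun u => 'D_(d i') h u) u.
  exact: (symbol_differentiable (symbol_derive i' sh) Ou).
rewrite /weight_derive !(derive_add _ (dD _) (differentiable_scale _ dh)).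
by rewrite !(derive_scale _ _ dh) (symbol_derive_comm i j sh Ou); ring.
Qed.

End NonnegativeCoordinates.

End SymbolClass.

Section RaisingWeights.
Variables (R : realType) (n : nat).
Variables (Omega : set 'rV[R]_n) (d : 'I_n -> 'rV[R]_n) (s : 'I_n -> 'rV[R]_n -> R).
Hypothesis open_Omega : open Omega.
Hypothesis Omega_shift : forall u (r : R) j, Omega u -> 0 <= r -> Omega (u + r *: d j).
Hypothesis coord_shift : forall u (r : R) j k, s j (u + r *: d k) = s j u + r *+ (j == k).
Implicit Types (u v : 'rV[R]_n) (mu nu : 'I_n -> int) (G : 'rV[R]_n -> R).

Definition chart_region : set 'rV[R]_n := [set u | Omega u /\ forall j, 0 <= s j u].
Notation symbol := (symbol Omega chart_region d s 1).

Let regionS : chart_region `<=` Omega. Proof. by move=> u []. Qed.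
Let gain01 : 0 <= (1 : int) <= 1. Proof. by []. Qed.
Let coord_ge0 u k : chart_region u -> 0 <= s k u. Proof. by case. Qed.

Lemma chart_region_shift u (r : R) j :
  chart_region u -> 0 <= r -> chart_region (u + r *: d j).
Proof.
move=> [Ou su] r0; split; first exact: Omega_shift.
by move=> k; rewrite coord_shift addr_ge0// mulrn_wge0.
Qed.

Lemma weight_shift nu u (r : R) j :
  weight s nu (u + r *: d j) = weight s nu u * expR (- ((nu j)%:~R * r)).
Proof.
rewrite /weight -expRD -opprD; congr (expR (- _)).
rewrite (eq_bigr (fun k => (nu k)%:~R * s k u + (nu k)%:~R * (r *+ (k == j)))); last first.
  by move=> k _; rewrite coord_shift mulrDr.
rewrite big_split/=; congr (_ + _).
rewrite (bigD1 j)//= eqxx mulr1n big1 ?addr0// => k /negbTE ->.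
by rewrite mulr0n mulr0.
Qed.

Lemma expR_weight_shift nu u (r : R) j :
  expR ((nu j)%:~R * r) * weight s nu (u + r *: d j) = weight s nu u.
Proof. by rewrite weight_shift mulrCA expRxMexpNx_1 mulr1. Qed.

Lemma weight_raise_shift (g : int) nu u (r : R) j : expR ((nu j)%:~R * r) *
  weight s (raise g nu j) (u + r *: d j) = weight s (raise g nu j) u * expR (- (g%:~R * r)).
Proof.
rewrite weight_shift mulrCA; congr (_ * _); rewrite -expRD /raise eqxx mulr1n rmorphD/=.
by congr expR; ring.
Qed.

Lemma is_derive_exp_line mu j G u (r : R) : Omega u -> 0 <= r -> symbol 1 mu G ->
  is_derive r 1 (fun r => expR ((mu j)%:~R * r) * G (u + r *: d j))
    (expR ((mu j)%:~R * r) * weight_derive d mu j G (u + r *: d j)).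
Proof.
move=> Ou r0 sG.
have dG : is_derive r 1 (fun r => G (u + r *: d j)) ('D_(d j) G (u + r *: d j)).
  apply/is_derive_line/diff_derivable.
  by apply: symbol_differentiable sG _; exact: Omega_shift.
apply: (is_derive_eq (is_derive_mul (is_derive_expRM (mu j)%:~R r) dG)).
by rewrite /weight_derive mulrDr addrC mulrA.
Qed.

Definition flat_along mu (j : 'I_n) G := forall u, chart_region u ->
  expR ((mu j)%:~R * r) * G (u + r *: d j) @[r --> +oo] --> (0 : R).

Lemma flat_alongD mu j G H : flat_along mu j G -> flat_along mu j H ->
  flat_along mu j (fun u => G u + H u).
Proof.
move=> fG fH u Ru; under eq_fun do rewrite mulrDr.
by rewrite -[0]addr0; apply: cvgD; [exact: fG|exact: fH].
Qed.

Lemma flat_alongZ mu j G (c : R) : flat_along mu j G -> flat_along mu j (fun u => c * G u).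
Proof.
move=> fG u Ru; under eq_fun do rewrite mulrCA.
by rewrite -[0](mulr0 c); apply: cvgM; [exact: cvg_cst|exact: fG].
Qed.

Lemma weight_bounded_flat mu j k G : (0 < k)%N ->
  weight_bounded chart_region s (raise k mu j) G -> flat_along mu j G.
Proof.
move=> k0 [C bG] u Ru; apply/cvgr0Pnorm_le => e e0.
have decay : C * weight s (raise k mu j) u * expR (- r) @[r --> +oo] --> (0 : R).
  rewrite -[0](mulr0 (C * weight s (raise k mu j) u)).
  by apply: cvgM; [exact: cvg_cst|exact: cvgr_expR].
near=> r; have r0 : 0 <= r by near: r; exact: nbhs_pinfty_ge.
apply: (@le_trans _ _ (`|C * weight s (raise k mu j) u * expR (- r)|)); last first.
  by near: r; exact: cvgr0_norm_le decay _ e0.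
rewrite normrM ger0_norm ?expR_ge0//.
apply: le_trans (ler_wpM2l (expR_ge0 _) (bG _ (chart_region_shift j Ru r0))) _.
rewrite mulrCA weight_raise_shift mulrA; apply: le_trans (ler_norm _) _.
rewrite !normrM; apply: ler_wpM2l => //.
by rewrite !ger0_norm ?expR_ge0// ler_expR lerN2 ler_peMl// ler1n.
Unshelve. all: by end_near. Qed.

Lemma flat_weight_bounded mu j k G : (0 < k)%N -> symbol 1 mu G -> flat_along mu j G ->
  weight_bounded chart_region s (raise k mu j) (weight_derive d mu j G) ->
  weight_bounded chart_region s (raise k mu j) G.
Proof.
move=> k0 sG fG [C bD]; exists C => u Ru; have [Ou _] := Ru.
set W := C * _; pose K r := expR ((mu j)%:~R * r) * G (u + r *: d j).
have W0 : 0 <= W by apply: le_trans (bD u Ru).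
have K0 : K 0 = G u by rewrite /K mulr0 expR0 mul1r scale0r addr0.
have dist r : 0 <= r -> `|K r - K 0| <= W.
  move=> r0; apply: (increment_le_expRN r0) => t /andP[t0 _].
    exact: is_derive_exp_line.
  rewrite normrM ger0_norm ?expR_ge0//.
  apply: le_trans (ler_wpM2l (expR_ge0 _) (bD _ (chart_region_shift j Ru t0))) _.
  rewrite mulrCA weight_raise_shift mulrA ler_wpM2l// ler_expR lerN2.
  by rewrite ler_peMl// ler1n.
apply/ler_addgt0Pr => e e0; have /cvgr0Pnorm_le/(_ e e0) smallK := fG u Ru.
have [r [r0 Kr]] := filter_ex (filterI (nbhs_pinfty_ge (num_real 0)) smallK).
rewrite -K0 -[K 0](subKr (K r)); apply: le_trans (ler_normB _ _) _.
by rewrite addrC lerD// dist.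
Qed.

Lemma flat_along_derive mu i j G : i != j -> symbol 3 mu G -> flat_along mu j G ->
  flat_along mu j (fun u => 'D_(d i) G u).
Proof.
move=> ij sG fG u Ru; apply/cvgr0Pnorm_le => e e0.
have sD : symbol 2 mu (fun u => 'D_(d i) G u) by exact: symbol_derive.
have sDD : symbol 1 mu (fun u => 'D_(d i) ('D_(d i) G) u) by exact: (symbol_derive _ _ _ _ i sD).
have [C [C0 bDD]] := symbol_bounded_ge0 sDD.
pose M := C * (weight s mu u * expR `|(mu i)%:~R|).
have M0 : 0 <= M by rewrite !mulr_ge0 ?expR_ge0// ltW// weight_gt0.
have M1 : 0 < M + 1 by rewrite ltr_wpDl.
pose p := Num.min 1 (e / 2 / (M + 1)).
have p0 : 0 < p by rewrite lt_min ltr01 !divr_gt0.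
have p1 : p <= 1 by rewrite ge_min lexx.
have Mp : M * p <= e / 2.
  apply: (@le_trans _ _ ((M + 1) * p)); first by rewrite ler_wpM2r ?lerDl// ltW.
  by rewrite mulrC -ler_pdivlMr// ge_min lexx orbT.
have q0 : 0 < p * e / 4 by rewrite !divr_gt0// mulr_gt0.
have /cvgr0Pnorm_le/(_ _ q0) small_u := fG u Ru.
have /cvgr0Pnorm_le/(_ _ q0) small_up := fG _ (chart_region_shift i Ru (ltW p0)).
near=> r; have r0 : 0 <= r by near: r; exact: nbhs_pinfty_ge.
pose v := u + r *: d j; have Rv : chart_region v by exact: chart_region_shift.
have [Ov _] := Rv; pose K t := expR ((mu j)%:~R * r) * G (v + t *: d i).
have := @landau_interpolation R K
  (fun t => expR ((mu j)%:~R * r) * 'D_(d i) G (v + t *: d i))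
  (fun t => expR ((mu j)%:~R * r) * 'D_(d i) ('D_(d i) G) (v + t *: d i)) p M (ltW p0).
have Kp : `|K p| <= p * e / 4 by rewrite /K /v addrAC; near: r.
have K0 : `|K 0| <= p * e / 4 by rewrite /K /v scale0r addr0; near: r.
rewrite scale0r addr0 => interp; rewrite -(ler_pM2l p0); apply: le_trans (interp _ _ _) _.
- move=> t /andP[t0 _]; apply/is_derive_scale/is_derive_line/diff_derivable.
  by apply: symbol_differentiable sG _; exact: Omega_shift.
- move=> t /andP[t0 _]; apply/is_derive_scale/is_derive_line/diff_derivable.
  by apply: symbol_differentiable sD _; exact: Omega_shift.
- move=> t /andP[t0 tp]; rewrite normrM ger0_norm ?expR_ge0//.
  apply: le_trans (ler_wpM2l (expR_ge0 _) (bDD _ (chart_region_shift i Rv t0))) _.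
  rewrite mulrCA weight_shift [expR _ * (_ * _)]mulrA expR_weight_shift; apply: ler_wpM2l => //.
  apply: ler_wpM2l; first by rewrite ltW// weight_gt0.
  rewrite ler_expR -mulNr; apply: le_trans (ler_norm _) _.
  by rewrite normrM normrN ler_piMr// ger0_norm// (le_trans tp).
rewrite (_ : p * e = p * e / 4 + p * e / 4 + p * (e / 2)); last by field.
by rewrite expr2 mulrA [_ * p]mulrC !lerD// ler_wpM2l// ltW.
Unshelve. all: by end_near. Qed.

Lemma raise_raise (k : nat) mu j : raise 1 (raise k mu j) j = raise k.+1 mu j.
Proof.
apply/funext => i; rewrite /raise -addrA; congr (_ + _).
by case: (i == j); rewrite ?mulr1n ?mulr0n ?addr0// -addn1 PoszD.
Qed.

Lemma raise_comm (g k : int) mu i j : raise g (raise k mu j) i = raise k (raise g mu i) j.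
Proof. by apply/funext => l; rewrite /raise addrAC. Qed.

Lemma raise_same (k : nat) mu j G : weight_derive d (raise k mu j) j G =
  (fun u => weight_derive d mu j G u + k%:R * G u).
Proof.
by apply/funext => u; rewrite /weight_derive /raise eqxx mulr1n rmorphD/= mulrDl addrA.
Qed.

Lemma raise_other (k : int) mu i j : i != j -> raise k mu j i = mu i.
Proof. by move=> /negbTE ij; rewrite /raise ij mulr0n addr0. Qed.

(* Flatness along [d j] rules out the homogeneous solution of [(D_j + mu j) G = H], so [G]
   inherits the weight of [H]; the derivatives of [G] satisfy equations of the same form. *)
Lemma symbol_raise_flat j N k mu G : (0 < k)%N -> (forall N, symbol N mu G) ->
  flat_along mu j G -> (forall N, symbol N (raise k mu j) (weight_derive d mu j G)) ->
  symbol N (raise k mu j) G.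
Proof.
elim: N k mu G => [|N IH] k mu G k0 sG fG sD;
    have bG := flat_weight_bounded k0 (sG 1%N) fG (symbol_bounded (sD 0%N)).
  by split=> // u Ou; apply: symbol_continuous (sG 0%N) Ou.
apply: symbolS => // [u Ou|i]; first exact: symbol_differentiable (sG 1%N) Ou.
have comm i' nu' u Ou := weight_derive_comm open_Omega regionS gain01 coord_ge0
  mu nu' j i' (sG 3%N) (u := u) Ou.
have [->{i}|ij] := eqVneq i j.
  rewrite raise_raise; apply: IH => //.
  - move=> N'; rewrite raise_same; apply: symbolD => //; last exact: symbolZ.
    apply: (le_symbol open_Omega regionS gain01 coord_ge0 _ (sD N')) => i.
    by rewrite /raise lerDl mulrn_wge0.
  - rewrite raise_same; apply: flat_alongD; last exact: flat_alongZ.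
    exact: weight_bounded_flat k0 (symbol_bounded (sD 0%N)).
  - move=> N'; rewrite -raise_raise.
    apply: (eq_symbol open_Omega regionS _ (symbol_raise j (sD N'.+1))) => u Ou.
    by rewrite comm.
have muj : raise 1 mu i j = mu j by rewrite raise_other// eq_sym.
have -> : weight_derive d (raise k mu j) i G = weight_derive d mu i G.
  by apply/funext => u; rewrite /weight_derive raise_other.
rewrite raise_comm; apply: IH => //.
- by move=> N'; exact: symbol_raise.
- have : flat_along mu j (weight_derive d mu i G).
    by apply: flat_alongD (flat_alongZ _ fG); exact: flat_along_derive ij (sG 3%N) fG.
  by rewrite /flat_along muj.
- move=> N'; rewrite -raise_comm.
  apply: (eq_symbol open_Omega regionS _ (symbol_raise i (sD N'.+1))) => u Ou.
  by rewrite -comm// /weight_derive muj raise_other.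
Qed.

End RaisingWeights.

(** * Expansions of solutions of linear differential equations *)

Section ExponentialDecay.
Variable R : realType.
Implicit Types (F G : R -> R) (p : {poly R}) (M N : R).

Definition exp_decay N F :=
  exists K : R, \forall x \near +oo, `|F x| <= K * expR (- (N * x)).

Lemma near_eq_exp_decay N F G : (\forall x \near +oo, F x = G x) ->
  exp_decay N F -> exp_decay N G.
Proof. by move=> FG [K bF]; exists K; apply: filterS2 FG bF => x ->. Qed.

Lemma eq_exp_decay N F G : F =1 G -> exp_decay N F -> exp_decay N G.
Proof. by move=> FG; apply: near_eq_exp_decay; apply: nearW. Qed.

Lemma le_exp_decay M N F : M <= N -> exp_decay N F -> exp_decay M F.
Proof.
move=> MN [K bF]; exists `|K|; near=> x.
have x0 : 0 <= x by near: x; exact: nbhs_pinfty_ge.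
apply: (@le_trans _ _ (K * expR (- (N * x)))); first by near: x.
apply: le_trans (ler_norm _) _; rewrite normrM [`|expR _|]ger0_norm ?expR_ge0//.
by apply: ler_wpM2l => //; rewrite ler_expR lerN2 ler_wpM2r.
Unshelve. all: by end_near. Qed.

Lemma exp_decayD N F G : exp_decay N F -> exp_decay N G -> exp_decay N (fun x => F x + G x).
Proof.
move=> [K bF] [L bG]; exists (K + L); apply: filterS2 bF bG => x Fx Gx.
by apply: le_trans (ler_normD _ _) _; rewrite mulrDl lerD.
Qed.

Lemma exp_decayB N F G : exp_decay N F -> exp_decay N G -> exp_decay N (fun x => F x - G x).
Proof.
move=> [K bF] [L bG]; exists (K + L); apply: filterS2 bF bG => x Fx Gx.
by apply: le_trans (ler_normB _ _) _; rewrite mulrDl lerD.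
Qed.

Lemma exp_decay0 N : exp_decay N (fun=> 0).
Proof. by exists 0; near=> x; rewrite normr0 mul0r. Unshelve. all: by end_near. Qed.

Lemma exp_decay_sum (I : eqType) (s : seq I) N (F : I -> R -> R) :
  (forall i, i \in s -> exp_decay N (F i)) -> exp_decay N (fun x => \sum_(i <- s) F i x).
Proof.
elim: s => [|i s IH] decF.
  by apply: eq_exp_decay (exp_decay0 N) => x; rewrite big_nil.
apply: (@eq_exp_decay _ (fun x => F i x + \sum_(j <- s) F j x)).
  by move=> x; rewrite big_cons.
apply: exp_decayD; first by apply: decF; rewrite mem_head.
by apply: IH => j js; apply: decF; rewrite inE js orbT.
Qed.

Lemma exp_decay_cvg0 M N F : M < N -> exp_decay N F ->
  expR (M * x) * F x @[x --> +oo] --> (0 : R).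
Proof.
move=> MN [K bF]; apply/cvgr0Pnorm_le => e e0.
have NM0 : 0 < N - M by rewrite subr_gt0.
near=> x; rewrite normrM ger0_norm ?expR_ge0//.
have bFx : `|F x| <= K * expR (- (N * x)) by near: x.
apply: le_trans (ler_wpM2l (expR_ge0 _) bFx) _.
rewrite (_ : expR _ * _ = K / expR ((N - M) * x)); last first.
  by rewrite mulrCA -expRD -expRN; congr (_ * expR _); ring.
rewrite ler_pdivrMr ?expR_gt0//.
have Ke : `|K| / e / (N - M) <= x by near: x; apply: nbhs_pinfty_ge; exact: num_real.
apply: le_trans (ler_norm _) _; rewrite mulrC -ler_pdivrMr//.
by apply: le_trans (expR_ge1Dx _); rewrite ler_wpDl// [leRHS]mulrC -ler_pdivrMr.
Unshelve. all: by end_near. Qed.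

Lemma horner_le_expR p (a : R) : 0 < a ->
  exists C, forall x, 0 <= x -> `|p.[x]| <= C * expR (a * x).
Proof.
elim/poly_ind: p a => [|p c IH] a a0.
  by exists 0 => x _; rewrite horner0 normr0 mul0r.
have a2 : 0 < a / 2 by rewrite divr_gt0.
have [C bp] := IH _ a2; exists (C / (a / 2) + `|c|) => x x0.
have ax0 : 0 <= a / 2 * x by rewrite mulr_ge0// ltW.
have expR_half : expR (a * x) = expR (a / 2 * x) * expR (a / 2 * x).
  by rewrite -expRD -mulrDl -splitr.
rewrite hornerMXaddC mulrDl; apply: le_trans (ler_normD _ _) _; apply: lerD; last first.
  by rewrite ler_peMr// -[leLHS]expR0 ler_expR mulr_ge0// ltW.
rewrite normrM (ger0_norm x0) expR_half.
rewrite (_ : C / _ * _ = C * expR (a / 2 * x) * (expR (a / 2 * x) / (a / 2))); last by ring.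
apply: ler_pM => //; first exact: bp.
by rewrite ler_pdivlMr// mulrC; apply: le_trans (expR_ge1Dx _); rewrite lerDr.
Qed.

Lemma exp_decay_poly p (b : R) N : N < b -> exp_decay N (fun x => p.[x] * expR (- (b * x))).
Proof.
rewrite -subr_gt0 => bN; have [C bp] := horner_le_expR p bN; exists C; near=> x.
have x0 : 0 <= x by near: x; exact: nbhs_pinfty_ge.
rewrite normrM [`|expR _|]ger0_norm ?expR_ge0//.
apply: le_trans (ler_wpM2r (expR_ge0 _) (bp x x0)) _.
by rewrite -mulrA -expRD mulrBl addrAC subrr add0r.
Unshelve. all: by end_near. Qed.

Lemma poly_cvg0_eq0 p : horner p x @[x --> +oo] --> (0 : R) -> p = 0.
Proof.
elim/poly_ind: p => [//|q c IH] /cvgr0Pnorm_le small.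
have q0 : q = 0.
  apply: IH; apply/cvgr0Pnorm_le => e e0; near=> x.
  have x0 : 0 < x by near: x; exact: nbhs_pinfty_gt.
  have px : `|(q * 'X + c%:P).[x]| <= 1 by near: x; exact: small.
  have xe : (1 + `|c|) / e <= x by near: x; apply: nbhs_pinfty_ge; exact: num_real.
  rewrite -(ler_pM2r x0) (_ : `|_| * x = `|(q * 'X + c%:P).[x] - c|); last first.
    by rewrite hornerMXaddC addrK normrM (gtr0_norm x0).
  apply: le_trans (ler_normB _ _) _; apply: le_trans (lerD px (lexx _)) _.
  by rewrite mulrC -ler_pdivrMr.
rewrite q0 mul0r add0r in small *; congr polyC.
apply/eqP; rewrite -normr_le0; apply/ler_addgt0Pr => e e0; rewrite add0r.
by have [x] := filter_ex (small e e0); rewrite hornerC.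
Unshelve. all: by end_near. Qed.

End ExponentialDecay.

Section ExponentialPolynomials.
Variable R : realType.
Implicit Types (p q : R -> {poly R}) (P Q L G dG : R -> R) (E s : seq R).

Definition expsum E p (x : R) := \sum_(b <- E) (p b).[x] * expR (- (b * x)).

Lemma eq_expsum E p q x : {in E, p =1 q} -> expsum E p x = expsum E q x.
Proof. by move=> pq; apply: eq_big_seq => b /pq ->. Qed.

Lemma expsumD E p q x : expsum E (fun b => p b + q b) x = expsum E p x + expsum E q x.
Proof. by rewrite /expsum -big_split; apply: eq_bigr => b _; rewrite hornerD mulrDl. Qed.

Lemma expsumB E p q x : expsum E (fun b => p b - q b) x = expsum E p x - expsum E q x.
Proof.
by rewrite /expsum -sumrB; apply: eq_bigr => b _; rewrite hornerD hornerN mulrBl.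
Qed.

Lemma expsum_widen E F p x : uniq E -> uniq F -> {subset E <= F} ->
  {in F, forall b, b \notin E -> p b = 0} -> expsum F p x = expsum E p x.
Proof.
move=> uE uF EF p0; rewrite /expsum (bigID (mem E))/= [X in _ + X]big1_seq ?addr0; last first.
  by move=> b /andP[bE bF]; rewrite p0// horner0 mul0r.
rewrite -big_filter; apply: perm_big; apply: uniq_perm; rewrite ?filter_uniq//.
by move=> b; rewrite mem_filter; case bE : (b \in E) => //=; rewrite (EF b bE).
Qed.

Lemma subset_undup_cat E F :
  {subset E <= undup (E ++ F)} /\ {subset F <= undup (E ++ F)}.
Proof. by split=> b bs; rewrite mem_undup mem_cat bs ?orbT. Qed.

Lemma seq_argmin (X : eqType) (s : seq X) (F : X -> R) : s != [::] ->
  exists2 b, b \in s & forall c, c \in s -> F b <= F c.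
Proof.
elim: s => [//|a s IH] _; have [->|s0] := eqVneq s [::].
  by exists a; rewrite ?mem_head// => c; rewrite inE => /eqP ->.
have [b bs bmin] := IH s0; have [ab|ba] := leP (F a) (F b).
  exists a; rewrite ?mem_head// => c; rewrite inE => /predU1P[->//|/bmin].
  exact: le_trans.
exists b; first by rewrite inE bs orbT.
by move=> c; rewrite inE => /predU1P[->|/bmin//]; exact: ltW.
Qed.

(* Multiplying by [exp (b0 x)], where [b0] is the smallest exponent with [p b0 != 0], makes every
   other term tend to [0]. *)
Lemma exp_decay_expsum_eq0 E p (N : R) : uniq E -> exp_decay N (expsum E p) ->
  forall b, b \in E -> b < N -> p b = 0.
Proof.
move=> uE dec; pose s := [seq b <- E | (b < N) && (p b != 0)].
have [s0 b bE bN|/(seq_argmin id)[b0]] := eqVneq s [::].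
  apply/eqP/negP => /negP pb.
  have : b \in s by rewrite mem_filter bN pb bE.
  by rewrite s0.
rewrite mem_filter => /andP[/andP[b0N pb0] b0E] bmin; case/eqP: pb0; apply: poly_cvg0_eq0.
pose r := rem b0 E; pose term b x := expR (b0 * x) * ((p b).[x] * expR (- (b * x))).
have isolate x : expR (b0 * x) * expsum E p x - \sum_(b <- r) term b x = (p b0).[x].
  rewrite /expsum (perm_big _ (perm_to_rem b0E)) big_cons/= mulrDr mulr_sumr addrK.
  by rewrite mulrCA expRxMexpNx_1 mulr1.
have cvg_rest : \sum_(b <- r | b \in r) term b x @[x --> +oo] --> \sum_(b <- r | b \in r) (0 : R).
  apply: cvg_big => [|b]; first exact: add_continuous.
  rewrite mem_rem_uniq// inE => /andP[/= bb0 bE].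
  have [pb|pb] := eqVneq (p b) 0.
    by under eq_fun do rewrite /term pb horner0 mul0r mulr0; exact: cvg_cst.
  have b0b : b0 < b.
    rewrite lt_neqAle eq_sym bb0/=; have [bN|Nb] := ltP b N.
      by apply: bmin; rewrite mem_filter bN pb bE.
    by apply: ltW; apply: lt_le_trans Nb.
  have [b0m mb] := midf_lt b0b.
  by apply: (exp_decay_cvg0 b0m); exact: exp_decay_poly.
rewrite big1// in cvg_rest; have lim := cvgB (exp_decay_cvg0 b0N dec) cvg_rest.
by under eq_fun do rewrite -isolate big_seq; rewrite subr0 in lim; exact: lim.
Qed.

Lemma poly_first_order_ode (a : R) (p : {poly R}) :
  exists q : {poly R}, q^`()%R + a *: q = p /\ (size q <= size p + (a == 0)%R)%N.
Proof.
have [->|a0] := eqVneq a 0.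
  exists (\poly_(i < (size p).+1) (p`_i.-1 / i%:R)); split; last first.
    by rewrite addn1 size_poly.
  rewrite scale0r addr0; apply/polyP => i; rewrite coef_deriv coef_poly/= ltnS.
  rewrite -[LHS]mulr_natr; case: ltnP => h; last by rewrite mul0r nth_default.
  by rewrite divfK// pnatr_eq0.
rewrite addn0; move: {2}(size p) (leqnn (size p)) => m.
elim: m p => [|m IH] p sp.
  exists 0; rewrite deriv0 scaler0 addr0; split; last by rewrite size_poly0.
  by apply/esym/eqP; rewrite -size_poly_leq0.
have [->|p0] := eqVneq p 0.
  by exists 0; rewrite deriv0 scaler0 addr0 size_poly0.
have ltp := lt_size_deriv p0.
have [q [qE sq]] := IH p^`()%R (leq_trans ltp sp).
exists (a^-1 *: (p - q)); split.
  rewrite derivZ derivB scalerA divff// scale1r.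
  by rewrite -qE addrAC subrr add0r scalerA mulVf// scale1r addrC subrK.
apply: leq_trans (size_scale_leq _ _) _; apply: leq_trans (size_polyD _ _) _.
by rewrite size_polyN geq_max leqnn/= (leq_trans sq (ltnW ltp)).
Qed.

Lemma is_derive_expsum E p q (a x : R) :
  (forall b, (q b)^`()%R + (a - b) *: q b = p b) ->
  is_derive x 1 (expsum E q) (expsum E p x - a * expsum E q x).
Proof.
move=> qE; rewrite /expsum mulr_sumr -sumrB.
apply: is_derive_bigsum => b _.
have D := is_derive_mul (is_derive_poly (q b) x) (is_derive_expRM (- b) x).
rewrite (_ : (fun y => _) = (fun y => (q b).[y] * expR (- b * y))); last first.
  by apply/funext => y; rewrite mulNr.
by apply: (is_derive_eq D); rewrite -qE hornerD hornerZ -!mulNr; ring.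
Qed.

Lemma increment_le_expRM G dG (b K T x y : R) : b != 0 ->
  (forall z : R, T <= z -> is_derive z 1 G (dG z)) ->
  (forall z, T <= z -> `|dG z| <= K * expR (b * z)) ->
  T <= x -> x <= y -> `|G y - G x| <= K / b * expR (b * y) - K / b * expR (b * x).
Proof.
move=> b0 dGP dG_le Tx xy.
apply: (increment_le (dK := dG) (L := fun z => K / b * expR (b * z))
  (dL := fun z => K * expR (b * z)) xy) => z /andP[xz _].
- exact/dGP/(le_trans Tx).
- have D := is_derive_scale (K / b) (is_derive_expRM b z); apply: (is_derive_eq D).
  by field.
- exact/dG_le/(le_trans Tx).
Qed.

Lemma cvg_of_decaying_derive G dG (b K T : R) : b < 0 ->
  (forall z : R, T <= z -> is_derive z 1 G (dG z)) ->
  (forall z, T <= z -> `|dG z| <= K * expR (b * z)) ->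
  exists c, forall x, T <= x -> `|G x - c| <= K / - b * expR (b * x).
Proof.
move=> b0 dGP dG_le.
have K0 : 0 <= K.
  by have := le_trans (normr_ge0 _) (dG_le T (lexx _)); rewrite pmulr_lge0// expR_gt0.
pose A x := K / - b * expR (b * x).
have A0 x : 0 <= A x by rewrite mulr_ge0 ?expR_ge0// divr_ge0// oppr_ge0 ltW.
have GA x y : T <= x -> x <= y -> G x - A x <= G y - A y /\ G y + A y <= G x + A x.
  move=> Tx xy; have b0' : b != 0 by rewrite lt_eqF.
  have := increment_le_expRM b0' dGP dG_le Tx xy.
  by rewrite /A invrN mulrN !mulNr ler_norml => /andP[? ?]; split; lra.
have below x y : T <= x -> T <= y -> G y - A y <= G x + A x.
  move=> Tx Ty; have := A0 x; have := A0 y; have [xy|/ltW yx] := leP x y.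
    by have [_] := GA x y Tx xy; lra.
  by have [+ _] := GA y x Ty yx; lra.
pose S := [set G x - A x | x in [set x | T <= x]].
have supS : has_sup S.
  split; first by exists (G T - A T), T => //=.
  by exists (G T + A T) => _ [x /= Tx <-]; exact: below.
exists (sup S) => x Tx; rewrite ler_distlC; apply/andP; split.
  by apply: ub_le_sup; [exact: supS.2|exists x].
by apply: ge_sup; [exact: supS.1|move=> _ [y /= Ty <-]; exact: below].
Qed.

(* If [(exp (a x) D)'] decays then [exp (a x) D] converges; otherwise it grows at most at the rate
   of its derivative. *)
Lemma ode_remainder (D r : R -> R) (a N N' : R) : N' < N ->
  (forall x : R, 0 <= x -> is_derive x 1 D (r x - a * D x)) -> exp_decay N r ->
  exists c, exp_decay N' (fun x => D x - c * expR (- (a * x))).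
Proof.
move=> NN dD [K [T0 [_ rK]]]; pose T := Num.max 0 (T0 + 1).
have T_ge0 : 0 <= T by rewrite le_max lexx.
pose G x := expR (a * x) * D x.
have dG x : T <= x -> is_derive x 1 G (expR (a * x) * r x).
  move=> Tx; have D' := is_derive_mul (is_derive_expRM a x) (dD x (le_trans T_ge0 Tx)).
  by apply: (is_derive_eq D'); ring.
have DG c x : D x - c * expR (- (a * x)) = expR (- (a * x)) * (G x - c).
  by rewrite /G mulrBr mulrA [expR (- _) * _]mulrC expRxMexpNx_1 mul1r [_ * c]mulrC.
have dG_le M x : M <= N -> T <= x -> `|expR (a * x) * r x| <= `|K| * expR ((a - M) * x).
  move=> MN Tx; have x0 := le_trans T_ge0 Tx; rewrite normrM ger0_norm ?expR_ge0//.
  have T0x : T0 < x by apply: lt_le_trans Tx; rewrite lt_max ltrDl ltr01 orbT.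
  apply: le_trans (ler_wpM2l (expR_ge0 _) (rK x T0x)) _.
  rewrite mulrCA -expRD; apply: le_trans (ler_norm _) _; rewrite normrM ler_wpM2l//.
  by rewrite ger0_norm ?expR_ge0// ler_expR -mulrBl ler_wpM2r// lerD2l lerN2.
have expE M x : expR (- (a * x)) * expR ((a - M) * x) = expR (- (M * x)).
  by rewrite -expRD mulrBl addrA addNr add0r.
have nearT (Q : R -> Prop) : (forall x, T <= x -> Q x) -> \forall x \near +oo, Q x.
  move=> bounded_after; near=> x; apply: bounded_after.
  by near: x; apply: nbhs_pinfty_ge; exact: num_real.
have [aN|Na] := ltP a N.
  have aN0 : a - N < 0 by rewrite subr_lt0.
  have [c Gc] := cvg_of_decaying_derive aN0 dG (fun x => dG_le N x (lexx N)).
  exists c; apply: (le_exp_decay (ltW NN)); exists (`|K| / - (a - N)); apply: nearT => x Tx.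
  rewrite DG normrM ger0_norm ?expR_ge0// -(expE N) mulrCA ler_wpM2l ?expR_ge0//.
  exact: Gc.
have b0 : 0 < a - N' by rewrite subr_gt0 (lt_le_trans NN).
exists 0, (`|K| / (a - N') + `|G T|); apply: nearT => x Tx.
rewrite DG subr0 normrM ger0_norm ?expR_ge0// -(expE N') mulrCA ler_wpM2l ?expR_ge0//.
have x0 := le_trans T_ge0 Tx.
have := increment_le_expRM (lt0r_neq0 b0) dG (fun x => dG_le N' x (ltW NN)) (lexx T) Tx.
move=> incr; rewrite -[G x](subrK (G T)); apply: le_trans (ler_normD _ _) _.
rewrite mulrDl lerD//; last first.
  by rewrite ler_peMr// -[leLHS]expR0 ler_expR mulr_ge0// ltW.
by apply: le_trans incr _; rewrite gerBl mulr_ge0 ?expR_ge0// divr_ge0// ltW.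
Unshelve. all: by end_near. Qed.

Definition has_expansion E (m : R -> nat) P (N : R) := exists p,
  (forall b, size (p b) <= m b)%N /\ exp_decay N (fun x => P x - expsum E p x).

Lemma expansion_step E (m : R -> nat) P Q (a N N' : R) : uniq E -> a \in E -> N' < N ->
  (forall x : R, is_derive x 1 P (Q x - a * P x)) ->
  has_expansion E m Q N -> has_expansion E (fun b => m b + (b == a))%N P N'.
Proof.
move=> uE aE NN dP [p [sp decQ]].
pose q b := projT1 (cid (poly_first_order_ode (a - b) (p b))).
have qE b : (q b)^`()%R + (a - b) *: q b = p b by rewrite /q; case: cid => /= ? [].
have sq b : (size (q b) <= size (p b) + (b == a))%N.
  by rewrite /q; case: cid => /= ? [_]; rewrite subr_eq0 eq_sym.
have dD (x : R) : 0 <= x -> is_derive x 1 (fun x => P x - expsum E q x)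
    ((Q x - expsum E p x) - a * (P x - expsum E q x)).
  move=> _; apply: (is_derive_eq (is_derive_sub (dP x) (is_derive_expsum E x qE))); ring.
have [c decP] := ode_remainder NN dD decQ.
exists (fun b => q b + (c *+ (b == a))%:P); split.
  move=> b; apply: leq_trans (size_polyD _ _) _; rewrite geq_max; apply/andP; split.
    by apply: leq_trans (sq b) _; rewrite leq_add2r.
  case: (b == a); last by rewrite mulr0n size_poly0.
  by apply: leq_trans (size_polyC_leq1 _) _; rewrite addn1.
apply: eq_exp_decay decP => x; rewrite expsumD opprD addrA; congr (_ - _).
rewrite /expsum (bigD1_seq a)//= eqxx mulr1n hornerC big1 ?addr0// => b /negbTE ->.
by rewrite mulr0n horner0 mul0r.
Qed.

Fixpoint ode_chain s P L : Prop := if s is a :: s' then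
  exists Q, (forall x : R, is_derive x 1 P (Q x - a * P x)) /\ ode_chain s' Q L else P = L.

Lemma ode_chain_expansion E s P L (M N : R) : uniq E -> {subset s <= E} -> N < M ->
  exp_decay M L -> ode_chain s P L -> has_expansion E (fun b => count_mem b s) P N.
Proof.
move=> uE + + decL; elim: s P N => [|a s IH] P N sE NM.
  move=> ->; exists (fun=> 0); split; first by move=> b; rewrite size_poly0.
  apply: eq_exp_decay (le_exp_decay (ltW NM) decL) => x.
  by rewrite /expsum big1 ?subr0// => b _; rewrite horner0 mul0r.
move=> [Q [dP ch]]; have [Nm mM] := midf_lt NM.
have sE' : {subset s <= E} by move=> b bs; apply: sE; rewrite inE bs orbT.
have := expansion_step uE (sE a (mem_head _ _)) Nm dP (IH Q _ sE' mM ch).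
rewrite (_ : (fun b => _) = (fun b => count_mem b (a :: s)))//.
by apply/funext => b /=; rewrite addnC eq_sym.
Qed.

End ExponentialPolynomials.

Section Expandable.
Variables (R : realType) (A : set R) (m : nat).
Implicit Types (p q : R -> {poly R}) (P Q : R -> R) (E L : seq R) (M N : R).

Definition expansion P N E p := [/\ uniq E, forall b, b \in E -> A b,
  forall b, (size (p b) <= m)%N, forall b, b \notin E -> p b = 0 &
  exp_decay N (fun x => P x - expsum E p x)].

Definition expandable P := forall N : nat, exists E p, expansion P N%:R E p.

Lemma expansion_restrict P N E p : uniq E -> (forall b, b \in E -> A b) ->
  (forall b, (size (p b) <= m)%N) -> exp_decay N (fun x => P x - expsum E p x) ->
  expansion P N E (fun b => if b \in E then p b else 0).
Proof.
move=> uE EA sp dec; split=> //.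
- by move=> b; case: ifP => // _; rewrite size_poly0.
- by move=> b /negbTE ->.
- by apply: eq_exp_decay dec => x; congr (_ - _); apply: eq_expsum => b ->.
Qed.

Lemma expandableD P Q : expandable P -> expandable Q -> expandable (fun x => P x + Q x).
Proof.
move=> eP eQ N; have [E [p [uE EA sp pE decP]]] := eP N.
have [F [q [uF FA sq qF decQ]]] := eQ N.
exists (undup (E ++ F)), (fun b => p b + q b); split; first exact: undup_uniq.
- by move=> b; rewrite mem_undup mem_cat => /orP[/EA|/FA].
- by move=> b; rewrite (leq_trans (size_polyD _ _))// geq_max sp sq.
- by move=> b; rewrite mem_undup mem_cat negb_or => /andP[/pE -> /qF ->]; rewrite addr0.
have [EG FG] := subset_undup_cat E F.
apply: eq_exp_decay (exp_decayD decP decQ) => x; rewrite expsumD addrACA -opprD.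
rewrite (expsum_widen x uE (undup_uniq _) EG (fun b _ => pE b)).
by rewrite (expsum_widen x uF (undup_uniq _) FG (fun b _ => qF b)).
Qed.

Lemma expandable_sum (I : eqType) (r : seq I) (Q : I -> R -> R) :
  (forall i, i \in r -> expandable (Q i)) -> expandable (fun x => \sum_(i <- r) Q i x).
Proof.
elim: r => [|i r IH] expQ.
  move=> N; exists [::], (fun=> 0); split=> // [b|]; first by rewrite size_poly0.
  by apply: eq_exp_decay (exp_decay0 _) => x; rewrite /expsum !big_nil subr0.
have -> : (fun x => \sum_(k <- i :: r) Q k x) = (fun x => Q i x + \sum_(k <- r) Q k x).
  by apply/funext => x; rewrite big_cons.
apply: expandableD; first by apply: expQ; rewrite mem_head.
by apply: IH => k kr; apply: expQ; rewrite inE kr orbT.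
Qed.

Lemma expansion_unique P N N' E E' p p' b : expansion P N E p -> expansion P N' E' p' ->
  b < N -> b < N' -> p b = p' b.
Proof.
move=> [uE _ _ pE dec] [uE' _ _ pE' dec'] bN bN'.
have [EF EF'] := subset_undup_cat E E'; have uF := undup_uniq (E ++ E').
have [bF|] := boolP (b \in undup (E ++ E')); last first.
  by rewrite mem_undup mem_cat negb_or => /andP[/pE -> /pE' ->].
apply/eqP; rewrite -subr_eq0; apply/eqP.
apply: (exp_decay_expsum_eq0 (p := fun b => p b - p' b) (N := Num.min N N') uF _ bF); last first.
  by rewrite lt_min bN.
have leN : Num.min N N' <= N by rewrite ge_min lexx.
have leN' : Num.min N N' <= N' by rewrite ge_min lexx orbT.
have {}dec := le_exp_decay leN dec; have {}dec' := le_exp_decay leN' dec'.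
apply: eq_exp_decay (exp_decayB dec' dec) => x.
rewrite expsumB (expsum_widen x uE uF EF (fun c _ => pE c)).
by rewrite (expsum_widen x uE' uF EF' (fun c _ => pE' c)); ring.
Qed.

Lemma expansion_truncate P M N E p L : expansion P N E p -> M < N -> uniq L ->
  (forall b, b \in L <-> A b /\ b <= M) -> exp_decay M (fun x => P x - expsum L p x).
Proof.
move=> [uE EA _ pE dec] MN uL LP.
have tail : exp_decay M (fun x => \sum_(b <- [seq b <- E | M < b]) (p b).[x] * expR (- (b * x))).
  by apply: exp_decay_sum => b; rewrite mem_filter => /andP[Mb _]; exact: exp_decay_poly.
apply: eq_exp_decay (exp_decayD (le_exp_decay (ltW MN) dec) tail) => x.
have -> : expsum L p x = expsum [seq b <- E | b <= M] p x.
  apply: expsum_widen => [||b|b /LP[_ bM]]; rewrite ?filter_uniq// mem_filter.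
    by move=> /andP[bM /EA Ab]; apply/LP.
  by rewrite bM => /pE.
rewrite -addrA; congr (_ + _); rewrite /expsum (bigID (fun b => b <= M))/= !big_filter opprD.
by under [X in _ - X + _]eq_bigl do rewrite -ltNge; rewrite subrK.
Qed.

Lemma expandable_uniform P : expandable P ->
  exists p, (forall b, (size (p b) <= m)%N) /\
    forall (N : nat) L, uniq L -> (forall b, b \in L <-> A b /\ b <= N%:R) ->
      exp_decay N%:R (fun x => P x - expsum L p x).
Proof.
move=> eP; pose E (N : nat) := projT1 (cid (eP N)).
pose q (N : nat) := projT1 (cid (projT2 (cid (eP N)))).
have expansion_q (N : nat) : expansion P N%:R (E N) (q N) := projT2 (cid (projT2 (cid (eP N)))).
pose M (b : R) := Num.bound `|b|.
have bM b : b < (M b)%:R by apply: le_lt_trans (ler_norm _) _; exact: archi_boundP.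
exists (fun b => q (M b) b); split; first by move=> b; have [_ _ +] := expansion_q (M b); exact.
move=> N L uL LP; have lt_succ : N%:R < N.+1%:R :> R by rewrite ltr_nat.
apply: eq_exp_decay (expansion_truncate (expansion_q N.+1) lt_succ uL LP) => x; congr (_ - _).
apply: eq_expsum => b /LP[_ bN]; apply: expansion_unique (expansion_q _) (expansion_q _) _ (bM b).
exact: le_lt_trans bN lt_succ.
Qed.

End Expandable.

(** * Integrals over orthants in logarithmic coordinates *)

Section HalfLine.
Variable R : realType.
Implicit Types (G H k : R -> R) (b : bool).
Local Notation lebesgue := (@lebesgue_measure R).

Lemma bounded_support_integrable k (M p q : R) : measurable_fun setT k ->
  (forall s, `|k s| <= M * \1_`[p, q] s) -> lebesgue.-integrable setT (EFin \o k).
Proof.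
move=> mk bk.
apply: (@le_integrable _ _ _ lebesgue setT measurableT _
  (fun s => M%:E * (\1_`[p, q] s)%:E)%E).
- exact/measurable_EFinP.
- by move=> s _ /=; rewrite lee_fin; apply: le_trans (bk s) (ler_norm _).
- by apply: integrableZl => //; exact: integrable_indic_itv.
Qed.

Lemma bounded_support_Rintegral k (M p q : R) : p <= q -> measurable_fun setT k ->
  (forall s, `|k s| <= M * \1_`[p, q] s) -> `|Rintegral lebesgue setT k| <= M * (q - p).
Proof.
move=> pq mk bk.
have ik := bounded_support_integrable mk bk.
apply: le_trans (le_normr_Rintegral measurableT ik) _.
have int_indic : lebesgue.-integrable setT (EFin \o \1_`[p, q]).
  exact: integrable_indic_itv.
apply: (@le_trans _ _ (Rintegral lebesgue setT (fun s => M * \1_`[p, q] s))).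
  apply: le_Rintegral => //; first exact: (integrable_norm ik).
  apply: (@eq_integrable _ _ _ lebesgue setT measurableT
    (fun s => M%:E * (\1_`[p, q] s)%:E)%E) => //.
  exact: integrableZl.
rewrite RintegralZl// /Rintegral integral_indic//= setIT lebesgue_measure_itv/= lte_fin.
case: ifPn => [//|]; rewrite -leNgt => qp.
have -> : q = p by apply/le_anti/andP.
by rewrite subrr /= mulr0.
Qed.

Lemma Rintegral_segment_FTC (F f : R -> R) (p q : R) : p < q ->
  (forall x, p <= x <= q -> is_derive x 1 F (f x)) ->
  (forall x, p <= x <= q -> {for x, continuous f}) ->
  Rintegral lebesgue `[p, q]%classic f = F q - F p.
Proof.
move=> pq dF cf.
rewrite /Rintegral (@continuous_FTC2 R f F p q pq)//.
- apply: continuous_in_subspaceT => x; rewrite inE /= in_itv/=; exact: cf.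
- have cF x : p <= x <= q -> {for x, continuous F}.
    move=> xpq; apply/differentiable_continuous/derivable1_diffP.
    by apply: ex_derive; exact: dF.
  split.
  + by move=> x; rewrite in_itv/= => /andP[a b]; apply: ex_derive; apply: dF; rewrite !ltW.
  + by apply: cvg_at_right_filter; apply: cF; rewrite lexx ltW.
  + by apply: cvg_at_left_filter; apply: cF; rewrite lexx ltW.
- move=> x; rewrite in_itv/= => /andP[a b]; rewrite derive1E.
  by apply: derive_val; apply: dF; rewrite !ltW.
Qed.

Definition bsign b : R := if b then 1 else -1.

Lemma norm_bsign b : `|bsign b| = 1.
Proof. by case: b; rewrite ?normrN1 ?normr1. Qed.

Lemma bsign_neq0 b : bsign b != 0.
Proof. by rewrite -normr_eq0 norm_bsign oner_eq0. Qed.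

Lemma norm_bsignM b s : 0 < bsign b * s -> `|s| = bsign b * s.
Proof. by move=> s0; rewrite -(gtr0_norm s0) normrM norm_bsign mul1r. Qed.

Lemma bsignM_neq0 b s : 0 < bsign b * s -> s != 0.
Proof. by apply: contraTneq => ->; rewrite mulr0 ltxx. Qed.

Definition bside b (p q : R) : R * R := if b then (p, q) else (- q, - p).
Definition bsegment b (p q : R) : set R := `[(bside b p q).1, (bside b p q).2]%classic.

Lemma bsegmentP b p q s : bsegment b p q s <-> p <= bsign b * s <= q.
Proof.
rewrite /bsegment/= in_itv/= /bsign; case: b => /=; rewrite ?mul1r// mulN1r.
by rewrite lerNl lerNr andbC.
Qed.

Lemma bside_le b p q : p <= q -> (bside b p q).1 <= (bside b p q).2.
Proof. by case: b => //=; rewrite lerN2. Qed.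

Lemma bside_length b p q : (bside b p q).2 - (bside b p q).1 = q - p.
Proof. by case: b => //=; rewrite opprK addrC. Qed.

Definition halfline_fun b H (s : R) := if 0 < bsign b * s then H (- ln `|s|) else 0.
Definition halfline_int b H := Rintegral lebesgue setT (halfline_fun b H).

Definition bounded_supp (c M : R) H :=
  [/\ continuous H, forall v, `|H v| <= M & forall v, v < c -> H v = 0].

Lemma bounded_suppZ (c M z : R) H : bounded_supp c M H ->
  bounded_supp c (`|z| * M) (fun v => z * H v).
Proof.
move=> [cH bH sH]; split.
- by move=> v; apply: continuousM; [exact: cst_continuous|exact: cH].
- by move=> v; rewrite normrM ler_wpM2l.
- by move=> v vc; rewrite sH// mulr0.
Qed.

Lemma bounded_suppB (c M M' : R) G H : bounded_supp c M G -> bounded_supp c M' H ->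
  bounded_supp c (M + M') (fun v => G v - H v).
Proof.
move=> [cG bG sG] [cH bH sH]; split.
- by move=> v; apply: continuousB; [exact: cG|exact: cH].
- by move=> v; apply: le_trans (ler_normB _ _) _; apply: lerD.
- by move=> v vc; rewrite sG// sH// subr0.
Qed.

Lemma bounded_supp_ge0 (c M : R) H : bounded_supp c M H -> 0 <= M.
Proof. by move=> [_ bH _]; apply: le_trans (bH 0). Qed.

Lemma measurable_halfline_fun b H : continuous H -> measurable_fun setT (halfline_fun b H).
Proof.
move=> cH; apply: measurable_fun_ifT.
- by apply: measurable_fun_ltr => //; apply: measurable_funM.
- apply: (@measurableT_comp _ _ _ _ _ _ H); first exact: continuous_measurable_fun.
  by apply: measurableT_comp => //; apply: measurableT_comp.
- exact: measurable_cst.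
Qed.

Lemma bsegment_indic_ge0 (M : R) b p q s : 0 <= M -> 0 <= M * \1_(bsegment b p q) s.
Proof. by move=> M0; rewrite mulr_ge0// indicE ler0n. Qed.

Lemma halfline_fun_bound b (c M : R) H s : bounded_supp c M H ->
  `|halfline_fun b H s| <= M * \1_(bsegment b 0 (expR (- c))) s.
Proof.
move=> bsH; have M0 := bounded_supp_ge0 bsH; have [_ bH sH] := bsH; rewrite /halfline_fun.
case: ifP => s0; last by rewrite normr0 bsegment_indic_ge0.
have [sc|sc] := leP `|s| (expR (- c)).
  rewrite indicE mem_set ?mulr1//; apply/bsegmentP.
  by rewrite -(norm_bsignM s0) normr_ge0.
rewrite sH ?normr0 ?bsegment_indic_ge0//.
by rewrite ltrNl -ltr_expR lnK// posrE normr_gt0 (bsignM_neq0 s0).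
Qed.

Lemma halfline_fun_integrable b (c M : R) H : bounded_supp c M H ->
  lebesgue.-integrable setT (EFin \o halfline_fun b H).
Proof.
move=> bsH; apply: bounded_support_integrable (fun s => halfline_fun_bound b s bsH).
by apply: measurable_halfline_fun; case: bsH.
Qed.

Lemma halfline_int_bound b (c M : R) H : bounded_supp c M H ->
  `|halfline_int b H| <= M * expR (- c).
Proof.
move=> bsH; have e0 := expR_ge0 (- c).
have := @bounded_support_Rintegral _ _ _ _ (bside_le b e0) _
  (fun s => halfline_fun_bound b s bsH).
by rewrite bside_length subr0; apply; apply: measurable_halfline_fun; case: bsH.
Qed.

Lemma halfline_int_linear b (c M M' : R) G H (x y : R) :
  bounded_supp c M G -> bounded_supp c M' H ->
  halfline_int b (fun v => x * G v + y * H v) = x * halfline_int b G + y * halfline_int b H.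
Proof.
move=> bsG bsH.
have funZ z K : (fun s => z * halfline_fun b K s) = halfline_fun b (fun v => z * K v).
  by apply/funext => s; rewrite /halfline_fun; case: ifP => // _; rewrite mulr0.
have funD : halfline_fun b (fun v => x * G v + y * H v) =
    (fun s => x * halfline_fun b G s + y * halfline_fun b H s).
  by apply/funext => s; rewrite /halfline_fun; case: ifP => // _; rewrite !mulr0 addr0.
rewrite /halfline_int funD RintegralD//.
- rewrite RintegralZl ?RintegralZl//; first exact: halfline_fun_integrable bsH.
  exact: halfline_fun_integrable bsG.
- by rewrite funZ; exact: halfline_fun_integrable (bounded_suppZ x bsG).
- by rewrite funZ; exact: halfline_fun_integrable (bounded_suppZ y bsH).
Qed.

Lemma is_derive_ln_bsign b s : 0 < bsign b * s ->
  is_derive s 1 (fun s => - ln (bsign b * s)) (- s^-1).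
Proof.
move=> s0; apply: is_derive_opp.
have D := is_derive_comp (is_derive1_ln s0) (is_derive_mull (bsign b) s).
by apply: (is_derive_eq D); field; rewrite bsign_neq0 (bsignM_neq0 s0).
Qed.

Lemma is_derive_log_primitive b G dG s : (forall v : R, is_derive v 1 G (dG v)) ->
  0 < bsign b * s -> is_derive s 1 (fun s => s * G (- ln (bsign b * s)))
    (G (- ln (bsign b * s)) - dG (- ln (bsign b * s))).
Proof.
move=> dGP s0; have sn := bsignM_neq0 s0.
have D := is_derive_mul (is_derive_id s 1) (is_derive_comp
  (h := fun s => - ln (bsign b * s)) (dGP (- ln (bsign b * s))) (is_derive_ln_bsign s0)).
by apply: (is_derive_eq D); field.
Qed.

Lemma Rintegral_log_derivative b (c M M' eta B : R) G dG :
  bounded_supp c M G -> bounded_supp c M' dG ->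
  (forall v : R, is_derive v 1 G (dG v)) -> 0 < eta < B -> expR (- c) < B ->
  `|Rintegral lebesgue (bsegment b eta B) (halfline_fun b (fun v => G v - dG v))| <= M * eta.
Proof.
move=> bsG bsdG dGP /andP[eta0 etaB] cB; have [_ bG sG] := bsG.
have inside s : bsegment b eta B s -> 0 < bsign b * s.
  by move=> /bsegmentP/andP[h _]; exact: lt_le_trans h.
pose F s := s * G (- ln (bsign b * s)).
rewrite (_ : Rintegral _ _ _ = F (bside b eta B).2 - F (bside b eta B).1); last first.
  transitivity (Rintegral lebesgue (bsegment b eta B)
      (fun s => G (- ln (bsign b * s)) - dG (- ln (bsign b * s)))).
    apply: eq_Rintegral => s; rewrite inE => /inside s0.
    by rewrite /halfline_fun s0 (norm_bsignM s0).
  apply: Rintegral_segment_FTC => [|s sA|s sA].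
  - by case: (b) => //=; rewrite ltrN2.
  - by apply: is_derive_log_primitive => //; apply: inside; rewrite /bsegment/= in_itv.
  - have s0 : 0 < bsign b * s by apply: inside; rewrite /bsegment/= in_itv.
    apply: (@continuous_comp _ _ _ (fun s => - ln (bsign b * s)) (fun v => G v - dG v)).
      apply/differentiable_continuous/derivable1_diffP; apply: ex_derive.
      exact: is_derive_ln_bsign.
    by have [cH _ _] := bounded_suppB bsG bsdG; exact: cH.
have far s : bsign b * s = B -> F s = 0.
  by move=> sB; rewrite /F sB sG ?mulr0// ltrNl -ltr_expR lnK// posrE (lt_trans eta0).
have near s : bsign b * s = eta -> `|F s| <= M * eta.
  move=> se; rewrite /F se normrM mulrC; apply: ler_pM => //.
  by rewrite (@norm_bsignM b) ?se.
case: (b) far near => /= far near.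
  by rewrite far ?mul1r// sub0r normrN; apply: near; rewrite mul1r.
by rewrite [F (- B)]far ?mulN1r ?opprK// subr0; apply: near; rewrite mulN1r opprK.
Qed.

Lemma Rintegral_near_zero b (c M eta B : R) H : bounded_supp c M H -> 0 < eta ->
  expR (- c) < B ->
  `|Rintegral lebesgue (~` bsegment b eta B) (halfline_fun b H)| <= M * eta.
Proof.
move=> bsH eta0 cB; have M0 := bounded_supp_ge0 bsH; have [cH bH sH] := bsH.
have mA : measurable (bsegment b eta B) by exact: measurable_itv.
rewrite Rintegral_mkcond.
have := @bounded_support_Rintegral (halfline_fun b H \_ (~` bsegment b eta B)) M
  (bside b 0 eta).1 (bside b 0 eta).2.
rewrite bside_length subr0; apply; first by apply: bside_le; exact: ltW.
  apply/(measurable_restrictT _ (measurableC mA)).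
  by apply: measurable_funTS; exact: measurable_halfline_fun.
move=> s; have ind0 := @bsegment_indic_ge0 M b 0 eta s M0.
rewrite /patch; case: ifPn => [|_]; last by rewrite normr0.
rewrite inE => nA; rewrite /halfline_fun; case: ifP => s0; last by rewrite normr0.
have [se|se] := leP `|s| eta.
  rewrite indicE mem_set ?mulr1//; apply/bsegmentP.
  by rewrite -(norm_bsignM s0) normr_ge0.
have [sB|sB] := leP `|s| B.
  by exfalso; apply: nA; apply/bsegmentP; rewrite -(norm_bsignM s0) sB ltW.
rewrite sH ?normr0// ltrNl -ltr_expR lnK; first exact: lt_trans sB.
by rewrite posrE normr_gt0 (bsignM_neq0 s0).
Qed.

(* [s G (- ln s)] is a primitive of [(G - G') (- ln s)] that vanishes at both ends. *)
Lemma halfline_int_derive b (c M M' : R) G dG : bounded_supp c M G -> bounded_supp c M' dG ->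
  (forall v : R, is_derive v 1 G (dG v)) -> halfline_int b dG = halfline_int b G.
Proof.
move=> bsG bsdG dGP; have bsH := bounded_suppB bsG bsdG.
suff int0 : halfline_int b (fun v => G v - dG v) = 0.
  have := halfline_int_linear b 1 (-1) bsG bsdG.
  under [X in halfline_int b X]eq_fun do rewrite mul1r mulN1r.
  by rewrite int0 mul1r mulN1r => /eqP; rewrite eq_sym subr_eq0 => /eqP.
pose B := expR (- c) + 1; have cB : expR (- c) < B by rewrite ltrDl.
have B0 : 0 < B by rewrite (lt_trans _ cB)// expR_gt0.
have M0 := bounded_supp_ge0 bsG; have M'0 := bounded_supp_ge0 bsdG.
pose K := M + (M + M') + 1; have K0 : 0 < K by rewrite ltr_wpDl// !addr_ge0.
apply/eqP; rewrite -normr_le0; apply/ler_addgt0Pr => e e0; rewrite add0r.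
pose eta := Num.min (B / 2) (e / K).
have eta0 : 0 < eta by rewrite lt_min !divr_gt0.
have etaB : 0 < eta < B by rewrite eta0 gt_min ltr_pdivrMr// ltr_pMr// ltr1n.
have mA : measurable (bsegment b eta B) by exact: measurable_itv.
rewrite /halfline_int -(setUv (bsegment b eta B)) Rintegral_setU//; last 3 first.
- exact: measurableC.
- by rewrite setUv; exact: halfline_fun_integrable bsH.
- exact/disj_setPCl.
apply: le_trans (ler_normD _ _) _.
apply: le_trans (lerD (Rintegral_log_derivative b bsG bsdG dGP etaB cB)
  (Rintegral_near_zero b bsH eta0 cB)) _.
rewrite -mulrDl; apply: (@le_trans _ _ (K * eta)).
  by apply: ler_wpM2r; [exact: ltW|rewrite lerDl].
by rewrite mulrC -ler_pdivlMr// ge_min lexx orbT.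
Qed.

End HalfLine.

Section IteratedIntegral.
Variable R : realType.

Definition cons_row (n : nat) (v : R) (y : 'rV[R]_n) : 'rV[R]_n.+1 :=
  \row_(i < n.+1) match unlift ord0 i with Some j => y ord0 j | None => v end.

Lemma cons_row_head n v (y : 'rV[R]_n) : cons_row v y ord0 ord0 = v.
Proof. by rewrite mxE unlift_none. Qed.

Lemma cons_row_tail n v (y : 'rV[R]_n) j : cons_row v y ord0 (lift ord0 j) = y ord0 j.
Proof. by rewrite mxE liftK. Qed.

Lemma cons_rowD_head n v r (y : 'rV[R]_n) :
  cons_row (v + r) y = cons_row v y + r *: evec R ord0.
Proof.
apply/rowP => i; rewrite !mxE eqxx/=; case: unliftP => [j|] -> /=.
  by rewrite mulr0 addr0.
by rewrite mulr1.
Qed.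

Lemma cons_rowD_tail n v r (y : 'rV[R]_n) j :
  cons_row v (y + r *: evec R j) = cons_row v y + r *: evec R (lift ord0 j).
Proof.
apply/rowP => i; rewrite !mxE eqxx/=; case: unliftP => [k|] -> /=.
  by rewrite !mxE eqxx/= (inj_eq lift_inj).
by rewrite mulr0 addr0.
Qed.

Lemma cons_row_continuous n v : continuous (fun y : 'rV[R]_n => cons_row v y).
Proof.
move=> y; apply: (cvg_row (nbhs_filter y)) => i; case: (unliftP ord0 i) => [j ->|->].
  by rewrite cons_row_tail; under eq_fun do rewrite cons_row_tail; exact: coord_continuous.
by rewrite cons_row_head; under eq_fun do rewrite cons_row_head; exact: cvg_cst.
Qed.

Fixpoint bounded_Cn (N n : nat) (h : 'rV[R]_n -> R) : Prop :=
  [/\ continuous h, exists C, forall u, `|h u| <= C &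
    if N is N'.+1 then (forall u i, derivable h u (evec R i)) /\
       forall i, bounded_Cn N' (fun u => 'D_(evec R i) h u)
    else True].

Lemma bounded_Cn_bound N n (h : 'rV[R]_n -> R) : bounded_Cn N h -> exists C, forall u, `|h u| <= C.
Proof. by case: N => [|N] []. Qed.

Lemma bounded_Cn_is_derive N n (h : 'rV[R]_n -> R) u i : bounded_Cn N.+1 h ->
  is_derive u (evec R i) h ('D_(evec R i) h u).
Proof. by move=> [_ _ [d _]]; apply/derivableP. Qed.

Lemma bounded_Cn_derive N n (h : 'rV[R]_n -> R) i :
  bounded_Cn N.+1 h -> bounded_Cn N (fun u => 'D_(evec R i) h u).
Proof. by move=> [_ _ [_ d]]; exact: d. Qed.

Lemma bounded_CnW N n (h : 'rV[R]_n -> R) : bounded_Cn N.+1 h -> bounded_Cn N h.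
Proof.
elim: N h => [|N IH] h [c b [d st]]; first by split.
by split=> //; split=> // i; apply: IH.
Qed.

Definition supp_ge n (c : R) (h : 'rV[R]_n -> R) :=
  forall (u : 'rV[R]_n) i, u ord0 i < c -> h u = 0.

Lemma near_coord_lt n (c : R) (u : 'rV[R]_n) i : u ord0 i < c ->
  \forall x \near u, (x : 'rV[R]_n) ord0 i < c.
Proof.
move=> ui; have := @coord_continuous R 1 n ord0 i u => /(_ [set z | z < c]); apply.
by apply: open_nbhs_nbhs; split=> //; exact: open_lt.
Qed.

Lemma supp_ge_near0 n (c : R) (h : 'rV[R]_n -> R) (u : 'rV[R]_n) i : supp_ge c h -> u ord0 i < c ->
  \forall x \near u, h x = 0.
Proof. by move=> sh /near_coord_lt; apply: filterS => x; exact: sh. Qed.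

Lemma supp_ge_derive n c (h : 'rV[R]_n -> R) v : supp_ge c h -> supp_ge c (fun u => 'D_v h u).
Proof.
move=> sh u i ui; rewrite (@near_eq_derive _ _ _ h (cst 0)); first by rewrite derive_cst.
exact: supp_ge_near0 sh ui.
Qed.

Lemma supp_ge_linear n c (h k : 'rV[R]_n -> R) (x y : R) : supp_ge c h -> supp_ge c k ->
  supp_ge c (fun u => x * h u + y * k u).
Proof. by move=> sh sk u i ui; rewrite (sh u i)// (sk u i)// !mulr0 addr0. Qed.

Lemma supp_ge_slice n c (h : 'rV[R]_n.+1 -> R) v :
  supp_ge c h -> supp_ge c (fun y => h (cons_row v y)).
Proof. by move=> sh u i ui; apply: (sh _ (lift ord0 i)); rewrite cons_row_tail. Qed.

Lemma is_derive_slice n (h : 'rV[R]_n.+1 -> R) v y j d :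
  is_derive (cons_row v y) (evec R (lift ord0 j)) h d ->
  is_derive y (evec R j) (fun y => h (cons_row v y)) d.
Proof.
move=> /is_derive_lineP dh; apply/is_derive_lineP.
rewrite (_ : (fun r : R => h (cons_row v (y + r *: evec R j)))
   = (fun r => h (cons_row v y + r *: evec R (lift ord0 j))))//.
by apply/funext => r; rewrite cons_rowD_tail.
Qed.

Lemma is_derive_head n (h : 'rV[R]_n.+1 -> R) v y d :
  is_derive (cons_row v y) (evec R ord0) h d ->
  is_derive v 1 (fun v => h (cons_row v y)) d.
Proof.
move=> /is_derive_lineP dh; apply/is_derive_lineP.
rewrite (_ : (fun r : R => h (cons_row (v + r *: 1) y))
   = (fun r => h (cons_row v y + r *: evec R ord0)))//.
by apply/funext => r; rewrite -cons_rowD_head [r *: 1]mulr1.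
Qed.

Lemma derive_slice N n (h : 'rV[R]_n.+1 -> R) v j : bounded_Cn N.+1 h ->
  (fun y => 'D_(evec R j) (fun y => h (cons_row v y)) y) =
  (fun y => 'D_(evec R (lift ord0 j)) h (cons_row v y)).
Proof.
move=> bh; apply/funext => y; apply: derive_val; apply: is_derive_slice.
exact: bounded_Cn_is_derive bh.
Qed.

Lemma bounded_Cn_slice N n (h : 'rV[R]_n.+1 -> R) v :
  bounded_Cn N h -> bounded_Cn N (fun y => h (cons_row v y)).
Proof.
have cont (k : 'rV[R]_n.+1 -> R) : continuous k -> continuous (fun y => k (cons_row v y)).
  move=> ck y; apply: (@continuous_comp _ _ _ (fun y => cons_row v y) k); last exact: ck.
  exact: cons_row_continuous.
elim: N h => [|N IH] h bh; have [ch [C bC] st] := bh.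
  by split=> //; [exact: cont|exists C => u; exact: bC].
split; [exact: cont|by exists C => u; exact: bC|split=> [y j|j]].
  by apply: ex_derive; apply: is_derive_slice; exact: bounded_Cn_is_derive bh.
rewrite (derive_slice _ _ bh); apply: (IH (fun u => 'D_(evec R (lift ord0 j)) h u)).
exact: bounded_Cn_derive bh.
Qed.

Lemma bounded_Cn_linear N n (h k : 'rV[R]_n -> R) (x y : R) :
  bounded_Cn N h -> bounded_Cn N k ->
  bounded_Cn N (fun u => x * h u + y * k u).
Proof.
have cont (h' k' : 'rV[R]_n -> R) : continuous h' -> continuous k' ->
    continuous (fun u => x * h' u + y * k' u).
  move=> ch ck u; apply: (@continuousD _ _ _ (fun u => x * h' u) (fun u => y * k' u) u);
    by apply: continuousM; [exact: cst_continuous|first [exact: ch|exact: ck]].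
have bounded (h' k' : 'rV[R]_n -> R) : (exists C, forall u, `|h' u| <= C) ->
    (exists C, forall u, `|k' u| <= C) -> exists C, forall u, `|x * h' u + y * k' u| <= C.
  move=> [C bh] [C' bk]; exists (`|x| * C + `|y| * C') => u.
  by apply: le_trans (ler_normD _ _) _; rewrite !normrM; apply: lerD; apply: ler_wpM2l.
elim: N h k => [|N IH] h k bh bk; have [ch Bh _] := bh; have [ck Bk _] := bk.
  by split=> //; [exact: cont|exact: bounded].
split; [exact: cont|exact: bounded|].
have D u i : is_derive u (evec R i) (fun u => x * h u + y * k u)
    (x * 'D_(evec R i) h u + y * 'D_(evec R i) k u).
  by apply: is_derive_add; apply: is_derive_scale;
    [exact: bounded_Cn_is_derive bh|exact: bounded_Cn_is_derive bk].
split=> [u i|i]; first by have [] := D u i.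
rewrite (_ : (fun u => _) = (fun u => x * 'D_(evec R i) h u + y * 'D_(evec R i) k u)).
  by apply: IH; [exact: bounded_Cn_derive bh|exact: bounded_Cn_derive bk].
by apply/funext => u; apply: derive_val.
Qed.

Lemma bounded_Cn0 N n : bounded_Cn N (fun _ : 'rV[R]_n => 0).
Proof.
have bound0 : exists C, forall u : 'rV[R]_n, `|0 : R| <= C by exists 0 => u; rewrite normr0.
elim: N => [|N IH]; split=> //; [exact: cst_continuous|exact: cst_continuous|].
split=> [u i|i]; first exact: derivable_cst.
by under eq_fun do rewrite derive_cst.
Qed.

Definition integrand (N n : nat) (c : R) (h : 'rV[R]_n -> R) := bounded_Cn N h /\ supp_ge c h.

Lemma integrandW N n c (h : 'rV[R]_n -> R) : integrand N.+1 c h -> integrand N c h.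
Proof. by move=> [bh sh]; split=> //; exact: bounded_CnW. Qed.

Lemma integrand_derive N n c (h : 'rV[R]_n -> R) i :
  integrand N.+1 c h -> integrand N c (fun u => 'D_(evec R i) h u).
Proof. by move=> [bh sh]; split; [exact: bounded_Cn_derive|exact: supp_ge_derive]. Qed.

Lemma integrand_slice N n c (h : 'rV[R]_n.+1 -> R) v :
  integrand N c h -> integrand N c (fun y => h (cons_row v y)).
Proof. by move=> [bh sh]; split; [exact: bounded_Cn_slice|exact: supp_ge_slice]. Qed.

Lemma integrand_linear N n c (h k : 'rV[R]_n -> R) (x y : R) :
  integrand N c h -> integrand N c k -> integrand N c (fun u => x * h u + y * k u).
Proof.
by move=> [bh sh] [bk sk]; split; [exact: bounded_Cn_linear|exact: supp_ge_linear].
Qed.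

Lemma integrandD N n c (h k : 'rV[R]_n -> R) :
  integrand N c h -> integrand N c k -> integrand N c (fun u => h u + k u).
Proof.
move=> ih ik; have := integrand_linear 1 1 ih ik; congr integrand.
by apply/funext => u; rewrite !mul1r.
Qed.

Lemma integrand_sum N n c (I : eqType) (r : seq I) (h : I -> 'rV[R]_n -> R) :
  (forall i, i \in r -> integrand N c (h i)) -> integrand N c (fun u => \sum_(i <- r) h i u).
Proof.
elim: r => [|i r IH] ih; first by under eq_fun do rewrite big_nil; split=> //; exact: bounded_Cn0.
have ir := IH (fun j jr => ih j (mem_behead (s := i :: r) jr)).
by under eq_fun do rewrite big_cons; exact: integrandD (ih i (mem_head _ _)) ir.
Qed.

Definition bounded_functional n (c B : R) (I : ('rV[R]_n -> R) -> R) :=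
  (forall (h k : 'rV[R]_n -> R) x y, integrand 1 c h -> integrand 1 c k ->
     I (fun u => x * h u + y * k u) = x * I h + y * I k) /\
  (forall (h : 'rV[R]_n -> R) M, integrand 1 c h -> (forall u, `|h u| <= M) ->
     `|I h| <= M * B).

Lemma bounded_functional_slice n (c B : R) (I : ('rV[R]_n -> R) -> R) (h : 'rV[R]_n.+1 -> R) M :
  bounded_functional c B I -> 0 <= B -> integrand 1 c h -> (forall u, `|h u| <= M) ->
  bounded_supp c (M * B) (fun v => I (fun y => h (cons_row v y))).
Proof.
move=> [lin bd] B0 ih bM; have slice v := integrand_slice v ih.
have [C bC] := bounded_Cn_bound (bounded_Cn_derive ord0 ih.1).
have C0 : 0 <= C by apply: le_trans (bC 0).
split=> [v|v|v vc].
- apply/cvgrPdist_le => eps e0.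
  have K0 : 0 < C * B + 1 by rewrite ltr_wpDl// mulr_ge0.
  near=> w.
  have -> : I (fun y => h (cons_row v y)) - I (fun y => h (cons_row w y))
     = I (fun y => 1 * h (cons_row v y) + (-1) * h (cons_row w y)).
    by rewrite (lin _ _ _ _ (slice v) (slice w)) mul1r mulN1r.
  apply: (@le_trans _ _ (C * `|v - w| * B)).
    apply: bd; first exact: integrand_linear.
    move=> y; rewrite mul1r mulN1r.
    apply: (norm_increment_le (K := fun v => h (cons_row v y))
      (dK := fun v => 'D_(evec R ord0) h (cons_row v y))) => z; last exact: bC.
    by apply: is_derive_head; exact: bounded_Cn_is_derive ih.1.
  have vw : `|v - w| <= eps / (C * B + 1).
    by near: w; apply: cvgr_dist_le; [exact: cvg_id|exact: divr_gt0].
  apply: (@le_trans _ _ ((C * B + 1) * `|v - w|)).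
    by rewrite mulrAC; apply: ler_wpM2r => //; rewrite lerDl.
  by rewrite mulrC -ler_pdivlMr.
- by apply: bd => // y; exact: bM.
- apply/eqP; rewrite -normr_le0; have := bd (fun y => h (cons_row v y)) 0 (slice v).
  rewrite mul0r; apply=> y.
  by rewrite (ih.2 _ ord0) ?normr0// cons_row_head.
Unshelve. all: by end_near. Qed.

Fixpoint orthant_int (n : nat) (e : seq bool) : ('rV[R]_n -> R) -> R :=
  match n return ('rV[R]_n -> R) -> R with
  | 0 => fun h => h 0
  | n'.+1 => fun h => halfline_int (head false e)
      (fun v => orthant_int (behead e) (fun y => h (cons_row v y)))
  end.

Lemma orthant_int_functional n (e : seq bool) (c : R) :
  bounded_functional c (expR (- c) ^+ n) (@orthant_int n e).
Proof.
elim: n e => [|n IH] e; first by split=> //= h M _ b; rewrite expr0 mulr1.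
have slice h M := bounded_functional_slice (h := h) (M := M) (IH (behead e))
  (exprn_ge0 n (expR_ge0 (- c))).
split=> [h k x y ih ik|h M ih bM]; last first.
  by rewrite exprSr mulrA; apply: halfline_int_bound; exact: slice.
have [C bC] := bounded_Cn_bound ih.1; have [C' bC'] := bounded_Cn_bound ik.1.
rewrite -(halfline_int_linear _ _ _ (slice h _ ih bC) (slice k _ ik bC')) /=.
congr halfline_int; apply/funext => v.
by have [lin _] := IH (behead e); apply: lin; exact: integrand_slice.
Qed.

Lemma orthant_int_linear n (e : seq bool) (c : R) (h k : 'rV[R]_n -> R) x y :
  integrand 1 c h -> integrand 1 c k ->
  orthant_int e (fun u => x * h u + y * k u) = x * orthant_int e h + y * orthant_int e k.
Proof. by have [lin _] := orthant_int_functional n e c; exact: lin. Qed.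

Lemma orthant_intZ n (e : seq bool) (c x : R) (h : 'rV[R]_n -> R) : integrand 1 c h ->
  orthant_int e (fun u => x * h u) = x * orthant_int e h.
Proof.
move=> ih; have := orthant_int_linear e x 0 ih ih; rewrite mul0r addr0 => <-.
by congr orthant_int; apply/funext => u; rewrite mul0r addr0.
Qed.

Lemma orthant_intD n (e : seq bool) (c : R) (h k : 'rV[R]_n -> R) :
  integrand 1 c h -> integrand 1 c k ->
  orthant_int e (fun u => h u + k u) = orthant_int e h + orthant_int e k.
Proof.
move=> ih ik; have := orthant_int_linear e 1 1 ih ik; rewrite !mul1r => <-.
by congr orthant_int; apply/funext => u; rewrite !mul1r.
Qed.

Lemma orthant_intB n (e : seq bool) (c : R) (h k : 'rV[R]_n -> R) :
  integrand 1 c h -> integrand 1 c k ->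
  orthant_int e (fun u => h u - k u) = orthant_int e h - orthant_int e k.
Proof.
move=> ih ik; have := orthant_int_linear e 1 (-1) ih ik; rewrite mul1r mulN1r => <-.
by congr orthant_int; apply/funext => u; rewrite mul1r mulN1r.
Qed.

Lemma orthant_int_sum n (e : seq bool) (c : R) (I : eqType) (r : seq I)
    (h : I -> 'rV[R]_n -> R) : (forall i, i \in r -> integrand 1 c (h i)) ->
  orthant_int e (fun u => \sum_(i <- r) h i u) = \sum_(i <- r) orthant_int e (h i).
Proof.
elim: r => [|i r IH] ih.
  have i0 : integrand 1 c (fun _ : 'rV[R]_n => 0 : R) by split=> //; exact: bounded_Cn0.
  rewrite big_nil -[RHS](mul0r (orthant_int e (fun _ : 'rV[R]_n => 0))).
  rewrite -(orthant_intZ e 0 i0).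
  by congr orthant_int; apply/funext => u; rewrite big_nil mul0r.
have {}IH := IH (fun j jr => ih j (mem_behead (s := i :: r) jr)).
have ir := integrand_sum (fun j jr => ih j (mem_behead (s := i :: r) jr)).
rewrite big_cons -IH -(orthant_intD e (ih i (mem_head _ _)) ir).
by congr orthant_int; apply/funext => u; rewrite big_cons.
Qed.

Lemma orthant_int_bound n (e : seq bool) (c : R) (h : 'rV[R]_n -> R) M : integrand 1 c h ->
  (forall u, `|h u| <= M) -> `|orthant_int e h| <= M * expR (- c) ^+ n.
Proof. by have [_ bd] := orthant_int_functional n e c; exact: bd. Qed.

Lemma orthant_int_slice n (e : seq bool) (c : R) (h : 'rV[R]_n.+1 -> R) : integrand 1 c h ->
  exists M, bounded_supp c M (fun v => orthant_int e (fun y => h (cons_row v y))).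
Proof.
move=> ih; have [M bM] := bounded_Cn_bound ih.1; exists (M * expR (- c) ^+ n).
apply: bounded_functional_slice ih bM; first exact: orthant_int_functional.
by rewrite exprn_ge0// expR_ge0.
Qed.

Lemma is_derive_orthant_int n (e : seq bool) (c : R) (h : 'rV[R]_n.+1 -> R) (v : R) :
  integrand 2 c h ->
  is_derive v 1 (fun v => orthant_int e (fun y => h (cons_row v y)))
    (orthant_int e (fun y => 'D_(evec R ord0) h (cons_row v y))).
Proof.
move=> ih; have dh := integrand_derive ord0 ih.
have [C bC] := bounded_Cn_bound (bounded_Cn_derive ord0 dh.1).
have slice v' := integrand_slice v' (integrandW ih).
have slice_d := integrand_slice v dh.
apply: (@is_derive_quadratic _ _ _ _ (C * expR (- c) ^+ n)) => r.
have diff := integrand_linear 1 (-1) (slice (v + r)) (slice v).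
have -> : orthant_int e (fun y => h (cons_row (v + r) y)) -
    orthant_int e (fun y => h (cons_row v y)) -
    r * orthant_int e (fun y => 'D_(evec R ord0) h (cons_row v y)) =
  orthant_int e (fun y => 1 * (1 * h (cons_row (v + r) y) + (-1) * h (cons_row v y)) +
     (- r) * 'D_(evec R ord0) h (cons_row v y)).
  rewrite (orthant_int_linear _ _ _ diff slice_d).
  by rewrite (orthant_int_linear _ _ _ (slice _) (slice _)) !mul1r mulN1r mulNr.
rewrite mulrAC; apply: (@orthant_int_bound n e c); first exact: integrand_linear.
move=> y; rewrite !mul1r mulN1r mulNr.
apply: (@quadratic_remainder R (fun v => h (cons_row v y))
  (fun v => 'D_(evec R ord0) h (cons_row v y))
  (fun v => 'D_(evec R ord0) ('D_(evec R ord0) h) (cons_row v y))) => t _; last exact: bC.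
- by apply: is_derive_head; exact: bounded_Cn_is_derive ih.1.
- apply: (@is_derive_head n (fun u => 'D_(evec R ord0) h u)).
  exact: bounded_Cn_is_derive dh.1.
Qed.

Lemma orthant_int_derive n (e : seq bool) (c : R) (h : 'rV[R]_n -> R) i : integrand 3 c h ->
  orthant_int e (fun u => 'D_(evec R i) h u) = orthant_int e h.
Proof.
elim: n e h i => [e h []//|n IH] e h i ih.
have [j ->|->] := unliftP ord0 i => /=.
  congr halfline_int; apply/funext => v; rewrite -(derive_slice v j ih.1); apply: IH.
  exact: integrand_slice.
have [M bsh] := orthant_int_slice (behead e) (integrandW (integrandW ih)).
have [M' bsdh] := orthant_int_slice (behead e) (integrandW (integrand_derive ord0 ih)).
by apply: halfline_int_derive bsh bsdh _ => v; exact: is_derive_orthant_int (integrandW ih).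
Qed.

Fixpoint allsigns (n : nat) : seq (seq bool) :=
  if n is n'.+1 then [seq true :: e | e <- allsigns n'] ++ [seq false :: e | e <- allsigns n']
  else [:: [::]].

Lemma cons_allsigns n b e : e \in allsigns n -> b :: e \in allsigns n.+1.
Proof. by move=> en; rewrite /= mem_cat; case: b; rewrite map_f ?orbT. Qed.

Definition signs (n : nat) (x : 'rV[R]_n) : seq bool := [seq 0 < x ord0 i | i <- enum 'I_n].
Definition log_coord (n : nat) (x : 'rV[R]_n) : 'rV[R]_n := \row_i - ln `|x ord0 i|.

Lemma signs_cons n s (y : 'rV[R]_n) : signs (cons_row s y) = (0 < s) :: signs y.
Proof.
rewrite /signs enum_ordSl /= cons_row_head; congr cons; rewrite -map_comp.
by apply: eq_map => j /=; rewrite cons_row_tail.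
Qed.

Lemma log_coord_cons n s (y : 'rV[R]_n) :
  log_coord (cons_row s y) = cons_row (- ln `|s|) (log_coord y).
Proof.
by apply/rowP => i; rewrite !mxE; case: unliftP => [j|] _ //; rewrite mxE.
Qed.

Lemma Rintegral_sum (I : eqType) (r : seq I) (F : I -> R -> R) :
  (forall i, i \in r -> lebesgue_measure.-integrable setT (EFin \o F i)) ->
  lebesgue_measure.-integrable setT (EFin \o (fun s : R => \sum_(i <- r) F i s)) /\
  Rintegral lebesgue_measure setT (fun s => \sum_(i <- r) F i s) =
    \sum_(i <- r) Rintegral lebesgue_measure setT (F i).
Proof.
elim: r => [|i r IH] int_F.
  rewrite big_nil (_ : (fun x => _) = (fun=> 0)); last by apply/funext => x; rewrite big_nil.
  by split; [exact: integrable0|rewrite Rintegral_cst// mul0r].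
have [|int_r sum_r] := IH; first by move=> j jr; apply: int_F; rewrite inE jr orbT.
have int_i := int_F i (mem_head _ _).
rewrite big_cons (_ : (fun s => _) = (fun s => F i s + \sum_(j <- r) F j s)); last first.
  by apply/funext => s; rewrite big_cons.
by split; [exact: (integrableD measurableT int_i int_r)|rewrite RintegralD// sum_r].
Qed.

Lemma eq_Rintegral_neq0 (F G : R -> R) : measurable_fun setT G ->
  (forall s, s != 0 -> F s = G s) ->
  Rintegral lebesgue_measure setT F = Rintegral lebesgue_measure setT G.
Proof.
move=> mG FG; have mD : measurable ([set: R] `\ (0 : R)) by exact: measurableD.
have mGD : measurable_fun ([set: R] `\ (0 : R)) (EFin \o G).
  exact/measurable_funTS/measurable_EFinP.
have eqD s : s \in [set: R] `\ (0 : R) -> F s = G s by rewrite inE => -[_ /eqP]; exact: FG.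
rewrite /Rintegral -(integral_setD1 mD); last first.
  by apply: eq_measurable_fun mGD => s sD /=; rewrite eqD.
rewrite -[in RHS](integral_setD1 mD)//; congr fine.
by apply: eq_integral => s sD; rewrite eqD.
Qed.

Lemma intn_orthants n (g : 'rV[R]_n -> R) (h : seq bool -> 'rV[R]_n -> R) (c : R) :
  (forall e, e \in allsigns n -> integrand 1 c (h e)) ->
  (forall x : 'rV[R]_n, (forall i, x ord0 i != 0) -> g x = h (signs x) (log_coord x)) ->
  intn g = \sum_(e <- allsigns n) orthant_int e (h e).
Proof.
elim: n g h => [|n IH] g h ih gh.
  rewrite /= big_seq1 gh /=; last by case.
  congr (h _ _); last by apply/rowP => -[].
  by rewrite /signs enum_ord0.
rewrite [LHS]/= -[X in Rintegral _ _ X]/(fun s => intn (fun y => g (cons_row s y))).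
pose F b e := halfline_fun b (fun v => orthant_int e (fun y => h (b :: e) (cons_row v y))).
have intF b e : e \in allsigns n -> lebesgue_measure.-integrable setT (EFin \o F b e).
  move=> en; have [M bs] := orthant_int_slice e (ih _ (cons_allsigns b en)).
  exact: halfline_fun_integrable bs.
have [int_t sum_t] := Rintegral_sum (intF true).
have [int_f sum_f] := Rintegral_sum (intF false).
rewrite (eq_Rintegral_neq0 (G := fun s => \sum_(e <- allsigns n) F true e s +
    \sum_(e <- allsigns n) F false e s)).
- by rewrite RintegralD// sum_t sum_f /= big_cat !big_map.
- apply: measurable_funD; apply/measurable_EFinP.
    by have /integrableP[] := int_t.
  by have /integrableP[] := int_f.
move=> s s0; rewrite (IH _ (fun e y => h ((0 < s) :: e) (cons_row (- ln `|s|) y))).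
- rewrite /F /halfline_fun /bsign mul1r mulN1r oppr_gt0.
  case: (ltgtP 0 s) s0 => // [sp|sn] _.
    by rewrite [X in _ + X]big1 ?addr0.
  by rewrite [X in X + _]big1 ?add0r.
- by move=> e en; exact/integrand_slice/ih/cons_allsigns.
- move=> y y0; rewrite gh ?signs_cons ?log_coord_cons// => i.
  by rewrite mxE; case: unliftP.
Qed.

End IteratedIntegral.

(** * Logarithmic coordinates *)

Section SmoothOn.
Variables (R : realType) (n : nat).
Implicit Types (U : set 'rV[R]_n) (g : 'rV[R]_n -> R) (x : 'rV[R]_n).

Lemma smooth_on_pd U g j : smooth_on U g -> smooth_on U (pd j g).
Proof.
move=> sg js x Ux; have := sg (js ++ [:: j]) x Ux.
by rewrite /iterpd foldr_cat.
Qed.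

Lemma smooth_on_continuous U g x : smooth_on U g -> U x -> {for x, continuous g}.
Proof. by move=> sg Ux; have [] := sg [::] x Ux. Qed.

Lemma smooth_on_differentiable U g x : open U -> smooth_on U g -> U x -> differentiable g x.
Proof.
move=> oU sg Ux; apply: (differentiable_C1 oU Ux).
  by move=> y Uy i; have [_] := sg [::] y Uy; exact.
by move=> i; have [+ _] := sg [:: i] x Ux.
Qed.

Definition cube (r : R) : set 'rV[R]_n := [set x | forall i, `|x ord0 i| <= r].

Lemma cube_compact r : compact (cube r).
Proof.
have -> : cube r = [set x : 'rV[R]_n | forall i, `[- r, r]%classic (x ord0 i)].
  by apply/seteqP; split=> x le_r i; have := le_r i; rewrite /= in_itv/= ler_norml.
by apply: (@rV_compact R n (fun=> `[- r, r]%classic)) => i; exact: segment_compact.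
Qed.

Lemma smooth_on_cube_bounded U g r : 0 <= r -> cube r `<=` U -> smooth_on U g ->
  exists C, forall x, cube r x -> `|g x| <= C.
Proof.
move=> r0 rU sg.
have [|||c _ cmax] := @compact_EVT_max _ R (fun x => `|g x|) (cube r).
- by exists 0 => i; rewrite mxE normr0.
- exact: cube_compact.
- apply: continuous_in_subspaceT => x; rewrite inE => xr.
  apply: (@continuous_comp _ _ _ g Num.norm); last exact: norm_continuous.
  by apply: smooth_on_continuous sg _; exact: rU.
by exists `|g c| => x xr; apply: cmax; rewrite inE.
Qed.

End SmoothOn.

Section ExponentialCoordinates.
Variables (R : realType) (n : nat).
Implicit Types (g : 'rV[R]_n -> R) (x u v : 'rV[R]_n) (e : seq bool).

Definition exp_coord e u : 'rV[R]_n := \row_i (bsign R (nth false e i) * expR (- u ord0 i)).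

Lemma norm_exp_coord e u i : `|exp_coord e u ord0 i| = expR (- u ord0 i).
Proof. by rewrite mxE normrM norm_bsign mul1r ger0_norm ?expR_ge0. Qed.

Lemma exp_coord_neq0 e u i : exp_coord e u ord0 i != 0.
Proof. by rewrite -normr_gt0 norm_exp_coord expR_gt0. Qed.

Lemma exp_coordK x : (forall i, x ord0 i != 0) -> exp_coord (signs x) (log_coord x) = x.
Proof.
move=> x0; apply/rowP => i; rewrite !mxE opprK lnK ?posrE ?normr_gt0//.
rewrite /signs (nth_map i) ?size_enum_ord// nth_ord_enum /bsign.
case: ltgtP (x0 i) => // [xp _|xn _].
  by rewrite mul1r gtr0_norm.
by rewrite mulN1r ltr0_norm// opprK.
Qed.

Definition nat_row (a : 'I_n -> nat) : 'rV[R]_n := \row_i (a i)%:R.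

Lemma exp_coord_shift e u (a : 'I_n -> nat) (r : R) i :
  exp_coord e (u + r *: nat_row a) ord0 i = exp_coord e u ord0 i * expR (- r) ^+ a i.
Proof. by rewrite !mxE opprD expRD mulrA -mulNr expRM_natr. Qed.

Lemma is_derive_exp_coord e u v i :
  is_derive u v (fun u => exp_coord e u ord0 i) (- (v ord0 i * exp_coord e u ord0 i)).
Proof.
have coordE : (fun u => exp_coord e u ord0 i) =
    (fun u => bsign R (nth false e i) * expR (dotp (- evec R i) u)).
  by apply/funext => w; rewrite mxE dotpNl dotp_evec.
have D := is_derive_scale (bsign R (nth false e i))
  (is_derive_comp (is_derive_expR _) (is_derive_dotp (- evec R i) u v)).
rewrite coordE; apply: (is_derive_eq D).
by rewrite mxE !dotpNl !dotp_evec mulrN mulrN mulrA mulrC.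
Qed.

Lemma differentiable_exp_coord e u i : differentiable (fun u => exp_coord e u ord0 i) u.
Proof.
under eq_fun do rewrite mxE; apply: differentiable_scale.
apply: (differentiable_compR (F := expR)); first exact: derivable_expR.
under eq_fun do rewrite -(dotp_evec i) -dotpNl; exact: differentiable_dotp.
Qed.

Definition pullback e g u := g (exp_coord e u).

Lemma differentiable_pullback e g u : differentiable g (exp_coord e u) ->
  differentiable (pullback e g) u.
Proof.
move=> dg; apply: differentiable_comp dg; apply: differentiable_row => i.
exact: differentiable_exp_coord.
Qed.

Lemma derive_pullback e g u v : differentiable g (exp_coord e u) ->
  'D_v (pullback e g) u =
    \sum_i v ord0 i * - (exp_coord e u ord0 i * pd i g (exp_coord e u)).
Proof.
move=> dg; have de i := @differentiable_exp_coord e u i.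
rewrite [LHS](derive_comp_row v de dg); apply: eq_bigr => i _.
by rewrite (derive_val (is_derive := is_derive_exp_coord e u v i)) mulrN mulrA mulNr.
Qed.

Definition upper_box (c : R) : set 'rV[R]_n := [set u | forall i, c < u ord0 i].

Lemma open_upper_box c : open (upper_box c).
Proof.
rewrite openE => u cu; rewrite /interior /=.
have : \forall v \near nbhs (u : 'rV[R]_n), forall i, c < (v : 'rV[R]_n) ord0 i.
  apply: filter_forall => i; apply: (@coord_continuous R 1 n ord0 i u [set z | c < z]).
  by apply: open_nbhs_nbhs; split; [exact: open_gt|exact: cu].
by [].
Qed.

Lemma exp_coord_upper_box e c u : upper_box c u -> cube (expR (- c)) (exp_coord e u).
Proof. by move=> cu i; rewrite norm_exp_coord ler_expR lerN2 ltW. Qed.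

End ExponentialCoordinates.

Section Chart.
Variables (R : realType) (n : nat) (A : 'I_n -> 'I_n -> nat).
Local Notation B := (\matrix_(j, i) (A j i)%:R : 'M[R]_n).
Hypothesis uB : B \in unitmx.
Variable c1 : R.
Implicit Types (U : set 'rV[R]_n) (g : 'rV[R]_n -> R) (u : 'rV[R]_n) (e : seq bool).
Implicit Types (mu : 'I_n -> int).

Definition chart_dir (j : 'I_n) : 'rV[R]_n := nat_row R (A j).
Definition chart_coord (j : 'I_n) (u : 'rV[R]_n) : R := (u *m invmx B) ord0 j.

Lemma chart_coord0 j : chart_coord j 0 = 0.
Proof. by rewrite /chart_coord mul0mx mxE. Qed.

Lemma chart_coord_shift u (r : R) j k :
  chart_coord j (u + r *: chart_dir k) = chart_coord j u + r *+ (j == k).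
Proof.
have -> : chart_dir k = row k B by apply/rowP => i; rewrite !mxE.
rewrite /chart_coord mulmxDl -scalemxAl -row_mul mulmxV// !mxE eq_sym.
by rewrite mulr_natr.
Qed.

Lemma chart_coordE u i : u ord0 i = \sum_j chart_coord j u * (A j i)%:R.
Proof.
rewrite -{1}[u](mulmxKV uB) mxE; apply: eq_bigr => j _.
by rewrite /chart_coord !mxE.
Qed.

Lemma chart_dir_sum u : u = \sum_j chart_coord j u *: chart_dir j.
Proof.
by apply/rowP => i; rewrite chart_coordE summxE; apply: eq_bigr => j _; rewrite !mxE.
Qed.

Local Notation Omega := (@upper_box R n c1).

Lemma upper_box_shift u (r : R) j : Omega u -> 0 <= r -> Omega (u + r *: chart_dir j).
Proof. by move=> Ou r0 i; rewrite !mxE; apply: lt_le_trans (Ou i) _; rewrite lerDl mulr_ge0. Qed.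

Definition cone_region := chart_region Omega chart_coord.
Notation cone_symbol := (symbol Omega cone_region chart_dir chart_coord 1).

Lemma cone_region_sub : cone_region `<=` Omega. Proof. by move=> u []. Qed.

Let open_Omega : open Omega. Proof. exact: open_upper_box. Qed.
Let gain01 : 0 <= (1 : int) <= 1. Proof. by []. Qed.
Let coord_ge0 u k : cone_region u -> 0 <= chart_coord k u. Proof. by case. Qed.

Lemma exp_coord_symbol e N i :
  cone_symbol N (fun j => (A j i)%:Z) (fun u => exp_coord e u ord0 i).
Proof.
apply: (symbol_homogeneous _ open_Omega cone_region_sub) => [u _||u j _].
- exact: differentiable_exp_coord.
- exists 1 => u _; rewrite norm_exp_coord mul1r /weight ler_expR lerN2 (chart_coordE u i).
  by apply: ler_sum => j _; rewrite mulrC.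
- by rewrite (derive_val (is_derive := is_derive_exp_coord e u (chart_dir j) i)) mxE.
Qed.

Lemma pullback_symbol e N g U : open U -> cube (expR (- c1)) `<=` U -> smooth_on U g ->
  cone_symbol N (fun=> 0) (pullback e g).
Proof.
move=> oU cU.
have OU u : Omega u -> U (exp_coord e u) by move=> /exp_coord_upper_box/cU.
have bounded g' : smooth_on U g' ->
    weight_bounded cone_region chart_coord (fun=> 0) (pullback e g').
  move=> sg; have [C b] := smooth_on_cube_bounded (expR_ge0 _) cU sg.
  by exists C => u [Ou _]; rewrite weight0 mulr1; apply: b; exact: exp_coord_upper_box.
have dp g' u : smooth_on U g' -> Omega u -> differentiable g' (exp_coord e u).
  by move=> sg Ou; apply: smooth_on_differentiable sg _ => //; exact: OU.
elim: N g => [|N IH] g sg.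
  split=> [u Ou||//]; last exact: bounded.
  exact/differentiable_continuous/differentiable_pullback/dp.
apply: symbolS => [u Ou||j]; last 2 first.
- exact: bounded.
- have Dg : cone_symbol N (raise 1 (fun=> 0) j) (fun u => \sum_(i <- index_enum 'I_n)
      (- (A j i)%:R) * (exp_coord e u ord0 i * pullback e (pd i g) u)).
    apply: (symbol_sum open_Omega cone_region_sub) => i _.
    have [->|Aji] := eqVneq (A j i) 0%N.
      have zero := symbol0 chart_dir chart_coord 1 open_Omega cone_region_sub N.
      by apply: (eq_symbol open_Omega cone_region_sub _ (zero _)) => u _; rewrite oppr0 mul0r.
    apply: (symbolZ open_Omega cone_region_sub).
    have dg := IH _ (smooth_on_pd i sg).
    have xdg := symbolM open_Omega cone_region_sub (exp_coord_symbol e N i) dg.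
    apply: (le_symbol open_Omega cone_region_sub gain01 coord_ge0 _ xdg) => k.
    rewrite /raise addr0 add0r; have [->|kj] := eqVneq k j; last by rewrite mulr0n.
    by rewrite mulr1n lez_nat lt0n.
  apply: (eq_symbol open_Omega cone_region_sub _ Dg) => u Ou.
  rewrite /weight_derive derive_pullback ?mul0r ?addr0; last exact: dp.
  by apply: eq_bigr => i _; rewrite [chart_dir j ord0 i]mxE mulNr mulrN.
exact/differentiable_pullback/dp.
Qed.

Lemma symbol_raise_decay j (k N : nat) mu (G : 'rV[R]_n -> R) :
  (forall N, cone_symbol N mu G) ->
  (forall u, cone_region u ->
     exp_decay ((mu j)%:~R + k%:R) (fun r : R => G (u + r *: chart_dir j))) ->
  cone_symbol N (raise k mu j) G.
Proof.
elim: k mu N => [|k IH] mu N sG decay.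
  rewrite (_ : raise _ _ _ = mu)//; apply/funext => i; rewrite /raise.
  by rewrite mul0rn addr0.
have sG' N' : cone_symbol N' (raise 1 mu j) G.
  apply: (symbol_raise_flat open_Omega upper_box_shift chart_coord_shift) => //.
    move=> u Ru; apply: exp_decay_cvg0 (decay u Ru).
    by rewrite ltrDl ltr0n.
  by move=> N''; exact: symbol_raise.
have -> : raise k.+1 mu j = raise k (raise 1 mu j) j.
  by rewrite -raise_raise raise_comm.
apply: IH sG' _ => u Ru; rewrite (_ : _ + _ = (mu j)%:~R + k.+1%:R); first exact: decay.
by rewrite /raise eqxx mulr1n rmorphD/= -addrA nat1r.
Qed.

Lemma symbol_of_decay (G : 'rV[R]_n -> R) (L : 'I_n -> nat) :
  (forall N, cone_symbol N (fun=> 0) G) ->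
  (forall u j, cone_region u ->
     exp_decay (L j)%:R (fun r : R => G (u + r *: chart_dir j))) ->
  forall N, cone_symbol N (fun j => (L j)%:Z) G.
Proof.
move=> sG decay.
pose part (s : seq 'I_n) : 'I_n -> int := fun j => (L j)%:Z *+ (j \in s).
suff sym (s : seq 'I_n) N : uniq s -> cone_symbol N (part s) G.
  move=> N; have := sym (index_enum 'I_n) N (index_enum_uniq _).
  by apply: eq_symbol_weight => j; rewrite /part mem_index_enum.
elim: s N => [|i s IH] N /=; first by move=> _; apply: eq_symbol_weight (sG N).
move=> /andP[iNs us]; rewrite (_ : part (i :: s) = raise (L i) (part s) i).
  apply: symbol_raise_decay => [N'|u Ru]; first exact: IH.
  by rewrite /part (negbTE iNs) mulr0n add0r; exact: decay.
apply/funext => j; rewrite /raise /part inE; have [->|ji] := eqVneq j i.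
  by rewrite (negbTE iNs) mulr0n add0r.
by rewrite mulr0n addr0.
Qed.

End Chart.

(** * Taylor expansions *)

Section Taylor.
Variables (R : realType) (n : nat).
Implicit Types (U : set 'rV[R]_n) (f g h : 'rV[R]_n -> R) (x u : 'rV[R]_n) (e : seq bool).
Implicit Types (al be : 'rV[nat]_n) (js : seq 'I_n).

Lemma pd_eq_on U g h j x : open U -> (forall y, U y -> g y = h y) -> U x ->
  pd j g x = pd j h x.
Proof.
move=> oU gh Ux; apply: near_eq_derive; near=> y; apply: gh; near: y.
exact: open_nbhs_nbhs.
Unshelve. all: by end_near. Qed.

Lemma iterpd_eq_on U g h js x : open U -> (forall y, U y -> g y = h y) -> U x ->
  iterpd js g x = iterpd js h x.
Proof.
move=> oU gh; elim: js x => [|j js IH] x Ux; first exact: gh.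
by apply: (pd_eq_on _ oU) Ux => y Uy; exact: IH.
Qed.

Lemma pd_comm U g i j x : open U -> smooth_on U g -> U x ->
  pd i (pd j g) x = pd j (pd i g) x.
Proof.
move=> oU sg Ux; apply: (derive_comm oU Ux).
- move=> y Uy; have [_ dg] := sg [::] y Uy; have [_ dj] := sg [:: j] y Uy.
  by have [_ di] := sg [:: i] y Uy; split; [exact: dg|exact: dg|exact: dj|exact: di].
- by have [] := sg [:: i; j] x Ux.
- by have [] := sg [:: j; i] x Ux.
Qed.

Lemma smooth_on_iterpd U g js : smooth_on U g -> smooth_on U (iterpd js g).
Proof. by move=> sg; elim: js => [|j js IH]; [exact: sg|exact: smooth_on_pd IH]. Qed.

Lemma iterpd_cons U g j js x : open U -> smooth_on U g -> U x ->
  iterpd (j :: js) g x = iterpd js (pd j g) x.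
Proof.
move=> oU sg; elim: js x => [//|k js IH] x Ux.
have -> : iterpd (j :: k :: js) g x = pd k (iterpd (j :: js) g) x.
  by apply: (pd_comm _ _ oU _ Ux); exact: smooth_on_iterpd.
by apply: (pd_eq_on _ oU) Ux => y Uy; exact: IH.
Qed.

Lemma iterpd_perm U g js js' x : open U -> smooth_on U g -> perm_eq js js' -> U x ->
  iterpd js g x = iterpd js' g x.
Proof.
move=> oU; elim: js js' g x => [|j js IH] js' g x sg pe Ux.
  by have := perm_size pe; case: js' {pe}.
have jin : j \in js' by rewrite -(perm_mem pe) mem_head.
rewrite (iterpd_cons _ _ oU sg Ux).
case/splitPr: jin pe => p1 p2 pe.
have {}pe : perm_eq js (p1 ++ p2).
  by rewrite -(perm_cons j); apply: perm_trans pe _; rewrite -cat1s perm_catCA.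
rewrite (IH _ _ _ (smooth_on_pd j sg) pe Ux) /iterpd !foldr_cat -/(iterpd p1 _) -/(iterpd p1 _).
by apply: (iterpd_eq_on _ oU) Ux => y Uy; rewrite -/(iterpd p2 _) -(iterpd_cons _ _ oU sg Uy).
Qed.

Lemma iterpd_sub U f g js x : open U -> smooth_on U f -> smooth_on U g -> U x ->
  iterpd js (fun y => f y - g y) x = iterpd js f x - iterpd js g x.
Proof.
move=> oU sf sg; elim: js x => [//|j js IH] x Ux.
rewrite [LHS](pd_eq_on j oU IH Ux); apply: derive_val; apply: is_derive_sub.
  by apply/derivableP; have [_] := sf js x Ux; exact.
by apply/derivableP; have [_] := sg js x Ux; exact.
Qed.

Lemma smooth_on_sub U f g : open U -> smooth_on U f -> smooth_on U g ->
  smooth_on U (fun y => f y - g y).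
Proof.
move=> oU sf sg js x Ux; have [cf df] := sf js x Ux; have [cg dg] := sg js x Ux.
have near_sub : \near x, iterpd js f x - iterpd js g x = iterpd js (fun y => f y - g y) x.
  by near=> y; rewrite (iterpd_sub _ oU sf sg)//; near: y; exact: open_nbhs_nbhs.
split=> [|j].
  have cB : {for x, continuous (fun y => iterpd js f y - iterpd js g y)}.
    by apply: continuousB; [exact: cf|exact: cg].
  move=> Q; rewrite /= -(nbhs_singleton near_sub) => /cB nQ.
  by apply: filterS2 near_sub nQ => y /= ->.
apply: (near_eq_derivable near_sub); apply: ex_derive; apply: is_derive_sub.
  by apply/derivableP; exact: df.
by apply/derivableP; exact: dg.
Unshelve. all: by end_near. Qed.

Definition multi_count js : 'rV[nat]_n := \row_i count_mem i js.
Definition multi_seq al : seq 'I_n := flatten [seq nseq (al ord0 i) i | i <- enum 'I_n].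

Lemma count_multi_seq al (P : pred 'I_n) : count P (multi_seq al) = (\sum_i al ord0 i * P i)%N.
Proof.
rewrite count_flatten -map_comp sumnE big_map big_enum.
by apply: eq_bigr => i _; rewrite /= count_nseq mulnC.
Qed.

Lemma multi_seqK : cancel multi_seq multi_count.
Proof.
move=> al; apply/rowP => k; rewrite mxE count_multi_seq (bigD1 k)//= eqxx muln1.
by rewrite big1 ?addn0// => i /negbTE ->; rewrite muln0.
Qed.

Lemma count_sum_count_mem js (P : pred 'I_n) : count P js = (\sum_i count_mem i js * P i)%N.
Proof.
elim: js => [|j js IH] /=; first by rewrite big1.
under [RHS]eq_bigr do rewrite mulnDl; rewrite big_split/= -IH; congr addn.
by rewrite (bigD1 j)//= eqxx mul1n big1 ?addn0// => i /negbTE; rewrite eq_sym => ->.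
Qed.

Lemma iterpd_dmulti U g js x : open U -> smooth_on U g -> U x ->
  iterpd js g x = dmulti (multi_count js) g x.
Proof.
move=> oU sg Ux; apply: (iterpd_perm oU sg _ Ux); apply/permP => P.
rewrite count_sum_count_mem -/(multi_seq _) count_multi_seq.
by apply: eq_bigr => i _; rewrite mxE.
Qed.

Lemma mfact_neq0 al : (mfact al)%:R != 0 :> R.
Proof.
rewrite pnatr_eq0 -lt0n /mfact -[X in (0 < X)%N]/(\prod_(i < n) (al ord0 i)`!)%N.
by apply: prodn_gt0 => i; exact: fact_gt0.
Qed.

Definition monom_sum (S : seq ('rV[nat]_n)) (c : 'rV[nat]_n -> R) x :=
  \sum_(be <- S) c be * monom be x.
Definition multi_ffact al js : nat := (\prod_i (al ord0 i) ^_ (count_mem i js))%N.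
Definition multi_sub al js : 'rV[nat]_n := \row_i (al ord0 i - count_mem i js)%N.

Lemma is_derive_monom al x j : is_derive x (evec R j) (monom al)
  ((al ord0 j)%:R * monom (\row_i (al ord0 i - (i == j))%N) x).
Proof.
apply/is_derive_lineP.
pose c := \prod_(i | i != j) x ord0 i ^+ al ord0 i.
rewrite (_ : (fun r => _) = (fun r : R => c * (x ord0 j + r) ^+ al ord0 j)); last first.
  apply/funext => r; rewrite /monom (bigD1 j)//= mulrC; congr (_ * _).
    by apply: eq_bigr => i ij; rewrite !mxE eqxx (negbTE ij)/= mulr0 addr0.
  by rewrite !mxE !eqxx mulr1.
have powD : is_derive (x ord0 j + 0) 1 (fun z : R => z ^+ al ord0 j)
    ((al ord0 j)%:R * (x ord0 j + 0) ^+ (al ord0 j).-1).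
  apply: DeriveDef; first exact: exprn_derivable.
  by rewrite exp_derive -mulr_natl [_ *: _]mulr1.
have D := is_derive_comp (F := fun z : R => z ^+ al ord0 j) (h := fun r => x ord0 j + r) powD
  (is_derive_add (is_derive_const (x ord0 j) (0 : R) 1) (is_derive_id (0 : R) 1)).
apply: (is_derive_eq (is_derive_scale c D)); rewrite addr0 add0r mulr1 mulrCA; congr (_ * _).
rewrite /monom (bigD1 j)//= mxE eqxx subn1 mulrC; congr (_ * _).
by apply: eq_bigr => i ij; rewrite mxE (negbTE ij) subn0.
Qed.

Lemma monom_continuous al : continuous (@monom R n al).
Proof.
apply: continuous_big => [|i _ x]; first exact: mul_continuous.
apply: (@continuous_comp _ _ _ (fun x : 'rV[R]_n => x ord0 i) (fun z : R => z ^+ al ord0 i)).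
  exact: coord_continuous.
exact: exprn_continuous.
Qed.

Lemma iterpd_monom_sum S c js : iterpd js (monom_sum S c) =
  (fun x => \sum_(be <- S) c be * (multi_ffact be js)%:R * monom (multi_sub be js) x).
Proof.
elim: js => [|j js IH].
  apply/funext => x; apply: eq_bigr => be _; rewrite /multi_ffact big1 ?mulr1//=.
  by congr (_ * monom _ x); apply/rowP => i; rewrite mxE subn0.
apply/funext => x; rewrite /= IH; apply: derive_val; apply: is_derive_bigsum => be _.
apply: (is_derive_eq (is_derive_scale _ (is_derive_monom _ _ _))).
rewrite -!mulrA; congr (_ * _); rewrite mulrA -natrM; congr (_%:R * monom _ x); last first.
  by apply/rowP => i; rewrite !mxE /= subnDA [(j == i)]eq_sym subnAC.
rewrite /multi_ffact mxE (bigD1 j)//= [RHS](bigD1 j)//= eqxx add1n ffactnSr mulnAC.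
by congr muln; apply: eq_bigr => i /negbTE; rewrite eq_sym => ->.
Qed.

Lemma smooth_on_monom_sum U S c : smooth_on U (monom_sum S c).
Proof.
move=> js x _; rewrite iterpd_monom_sum; split.
  apply: continuous_big => [|be _ y]; first exact: add_continuous.
  suff : {for y, continuous (fun x => c be * (multi_ffact be js)%:R * monom (multi_sub be js) x)}.
    by [].
  by apply: continuousM; [exact: cst_continuous|exact: monom_continuous].
move=> j; apply: ex_derive; apply: is_derive_bigsum => be _.
exact: is_derive_scale (is_derive_monom (multi_sub be js) x j).
Qed.

Lemma monom0 al : monom al (0 : 'rV[R]_n) = (al == 0)%:R.
Proof.
rewrite /monom; have [->|] := eqVneq al 0; first by rewrite big1// => i _; rewrite !mxE expr0.
move=> /rV0Pn[i ali]; rewrite (bigD1 i)//= mxE expr0n.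
by move: ali; rewrite -lt0n => /prednK <-; rewrite mul0r.
Qed.

Lemma multi_ffact_eq_count js : multi_ffact (multi_count js) js = mfact (multi_count js).
Proof. by apply: eq_bigr => i _; rewrite mxE ffactnn. Qed.

Lemma multi_ffact_neq_count al js : al != multi_count js -> multi_sub al js = 0 ->
  multi_ffact al js = 0%N.
Proof.
move=> ne E; have [i ali] : exists i, (al ord0 i < count_mem i js)%N.
  apply: contrapT => no; move/eqP: ne; apply; apply/rowP => i; rewrite mxE.
  move/rowP: E => /(_ i); rewrite !mxE => /eqP; rewrite subn_eq0 => le_c.
  apply/eqP; rewrite eqn_leq le_c /= leqNgt; apply/negP => gt_c; apply: no.
  by exists i.
by rewrite /multi_ffact (bigD1 i)//= ffact_small.
Qed.

Lemma iterpd_monom_sum0 S c js : uniq S -> iterpd js (monom_sum S c) 0 =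
  if multi_count js \in S then c (multi_count js) * (mfact (multi_count js))%:R else 0.
Proof.
move=> uS; rewrite iterpd_monom_sum.
have term be : c be * (multi_ffact be js)%:R * monom (multi_sub be js) 0 =
    if be == multi_count js then c (multi_count js) * (mfact (multi_count js))%:R else 0.
  rewrite monom0; have [->|ne] := eqVneq be (multi_count js).
    rewrite (_ : multi_sub _ _ = 0); last by apply/rowP => i; rewrite !mxE subnn.
    by rewrite eqxx mulr1 multi_ffact_eq_count.
  have [E|] := eqVneq (multi_sub be js) 0; last by rewrite mulr0.
  by rewrite (multi_ffact_neq_count ne E) mulr0 mul0r.
rewrite (eq_bigr _ (fun be _ => term be)); case: ifPn => [inS|nin].
  by rewrite (bigD1_seq (multi_count js))//= eqxx big1 ?addr0// => be /negbTE ->.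
by rewrite big1_seq// => be /andP[_ beS]; case: eqP nin => // <-; rewrite beS.
Qed.

Lemma taylor_coef_monom_sum S c al : uniq S ->
  taylor_coef (monom_sum S c) al = if al \in S then c al else 0.
Proof.
move=> uS; rewrite /taylor_coef /dmulti iterpd_monom_sum0// -/(multi_seq _) multi_seqK.
by case: ifP => _; [rewrite mulfK ?mfact_neq0|rewrite mul0r].
Qed.

Lemma taylor_remainder U g (r : R) L : 0 <= r -> open U -> cube r `<=` U -> smooth_on U g ->
  (forall w, (size w < L)%N -> iterpd w g 0 = 0) ->
  exists C, 0 <= C /\ forall rho x, 0 <= rho <= r -> cube rho x -> `|g x| <= C * rho ^+ L.
Proof.
move=> r0 oU rU; elim: L g => [|L IH] g sg vanish.
  have [C b] := smooth_on_cube_bounded r0 rU sg; exists `|C|; split=> // rho x /andP[_ rr] cx.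
  rewrite expr0 mulr1; apply: le_trans (b x _) (ler_norm _) => i.
  exact: le_trans (cx i) rr.
have bound_pd i : exists C, 0 <= C /\ forall rho x, 0 <= rho <= r -> cube rho x ->
    `|pd i g x| <= C * rho ^+ L.
  apply: IH; first exact: smooth_on_pd.
  move=> w wL; have := vanish (rcons w i); rewrite size_rcons => /(_ wL).
  by rewrite /iterpd foldr_rcons.
pose C i := projT1 (cid (bound_pd i)).
have CP i := projT2 (cid (bound_pd i)); rewrite -/(C _) in CP.
exists (\sum_i C i); split; first by apply: sumr_ge0 => i _; have [] := CP i.
move=> rho x /andP[rho0 rhor] cx.
have g0 : g 0 = 0 by exact: (vanish [::]).
have inU (t : R) : 0 <= t <= 1 -> cube rho (t *: x).
  move=> /andP[t0 t1] i; rewrite mxE normrM ger0_norm//.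
  by apply: le_trans (cx i); apply: ler_piMl.
have cr y : cube rho y -> U y by move=> cy; apply: rU => i; exact: le_trans (cy i) rhor.
have dU y : U y -> differentiable g y by exact: smooth_on_differentiable.
have [|t tr] := @MVT_line R _ g 0 x 1 ler01.
  by move=> t tr; rewrite add0r; apply: diff_derivable; apply: dU; apply: cr; exact: inU.
rewrite !add0r scale1r g0 subr0 mulr1 => ->.
have dt : differentiable g (t *: x) by apply: dU; apply: cr; exact: inU.
rewrite {2}(row_sum_evec x) derive_lincomb// mulr_suml.
apply: le_trans (ler_norm_sum _ _ _) _; apply: ler_sum => i _.
have [C0 b] := CP i; rewrite normrM exprS mulrCA; apply: ler_pM => //.
by apply: b; [rewrite rho0|exact: inU].
Qed.

Definition wdeg (a : 'I_n -> nat) be : nat := (\sum_i a i * be ord0 i)%N.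

Lemma monom_exp_coord_shift e u (a : 'I_n -> nat) (r : R) be :
  monom be (exp_coord e (u + r *: nat_row R a)) =
    monom be (exp_coord e u) * expR (- r) ^+ wdeg a be.
Proof.
rewrite /monom /wdeg -prodrXr -big_split; apply: eq_bigr => i _ /=.
by rewrite exp_coord_shift exprMn -exprM.
Qed.

Lemma monom_scaling_cvg e u (a : 'I_n -> nat) l be : (l <= wdeg a be)%N ->
  expR (l%:R * r) * monom be (exp_coord e (u + r *: nat_row R a)) @[r --> +oo]
    --> monom be (exp_coord e u) *+ (wdeg a be == l).
Proof.
set m := monom be (exp_coord e u).
have E r : monom be (exp_coord e (u + r *: nat_row R a)) = m * expR (- ((wdeg a be)%:R * r)).
  by rewrite monom_exp_coord_shift -expRM_natl mulrN.
under eq_fun do rewrite E; rewrite leq_eqVlt eq_sym; case: eqP => [->|_]/=.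
  move=> _; under eq_fun do rewrite mulrCA expRxMexpNx_1 mulr1.
  exact: cvg_cst.
move=> lt_l; apply: (exp_decay_cvg0 (N := (wdeg a be)%:R)); first by rewrite ltr_nat.
by exists `|m|; apply: nearW => r; rewrite normrM [X in _ * X]ger0_norm ?expR_ge0.
Qed.

Definition box_multi (l : nat) : seq ('rV[nat]_n) :=
  [seq \row_i ((w : {ffun 'I_n -> 'I_l.+1}) i : nat) | w <- enum {ffun 'I_n -> 'I_l.+1}].

Lemma box_multi_uniq l : uniq (box_multi l).
Proof.
rewrite map_inj_uniq ?enum_uniq// => w w' /rowP E; apply/ffunP => i; apply: val_inj.
by have := E i; rewrite !mxE.
Qed.

Lemma mem_box_multi l be : (be \in box_multi l) = [forall i, be ord0 i <= l]%N.
Proof.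
apply/mapP/forallP => [[w _ ->] i|le_l]; first by rewrite mxE -ltnS.
exists [ffun i => inord (be ord0 i)]; first by rewrite mem_enum.
by apply/rowP => i; rewrite mxE ffunE inordK// ltnS.
Qed.

Lemma taylor_box_remainder U f (r0 : R) l : 0 <= r0 -> open U -> cube r0 `<=` U ->
  smooth_on U f -> exists C, 0 <= C /\ forall rho x, 0 <= rho <= r0 -> cube rho x ->
    `|f x - monom_sum (box_multi l) (taylor_coef f) x| <= C * rho ^+ l.+1.
Proof.
move=> r00 oU rU sf; have U0 : U 0 by apply: rU => i; rewrite mxE normr0.
have sT := @smooth_on_monom_sum U (box_multi l) (taylor_coef f).
apply: (taylor_remainder r00 oU rU (smooth_on_sub oU sf sT)) => w wl.
rewrite (iterpd_sub _ oU sf sT U0) iterpd_monom_sum0 ?box_multi_uniq//.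
rewrite mem_box_multi (_ : [forall i, _]); last first.
  by apply/forallP => i; rewrite mxE (leq_trans (count_size _ _)).
by rewrite (iterpd_dmulti _ oU sf U0) /taylor_coef divfK ?subrr// mfact_neq0.
Qed.

Lemma exp_coord_shift_cube e u (a : 'I_n -> nat) : (forall i, 0 < a i)%N ->
  exists2 M, 0 < M & forall r : R, 0 <= r ->
    cube (M * expR (- r)) (exp_coord e (u + r *: nat_row R a)).
Proof.
move=> a0; exists (1 + \sum_i `|exp_coord e u ord0 i|); first by rewrite ltr_wpDr// sumr_ge0.
move=> r r0 i; rewrite exp_coord_shift normrM [`|_ ^+ _|]ger0_norm ?exprn_ge0 ?expR_ge0//.
apply: ler_pM; rewrite ?exprn_ge0 ?expR_ge0//.
  by rewrite (bigD1 i)//= addrCA lerDl addr_ge0// sumr_ge0.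
by rewrite -[leRHS]expr1 ler_wiXn2l ?expR_ge0 ?a0// expR_le1 oppr_le0.
Qed.

Lemma exp_decay_vanishing g e u (a : 'I_n -> nat) (r0 C : R) L :
  (forall i, 0 < a i)%N -> 0 < r0 ->
  (forall rho x, 0 <= rho <= r0 -> cube rho x -> `|g x| <= C * rho ^+ L) ->
  exp_decay L%:R (fun r => g (exp_coord e (u + r *: nat_row R a))).
Proof.
move=> a0 r00 bg; have [M M0 inM] := exp_coord_shift_cube e u a0.
have small : \forall r \near +oo, `|expR (- r)| <= r0 / M.
  by apply: cvgr0_norm_le; [exact: cvgr_expR|exact: divr_gt0].
exists (C * M ^+ L); near=> r; have r_ge0 : 0 <= r by near: r; exact: nbhs_pinfty_ge.
rewrite -mulrN expRM_natl -mulrA -exprMn; apply: bg (inM r r_ge0).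
rewrite mulr_ge0 ?expR_ge0 ?(ltW M0)//= mulrC -ler_pdivlMr//.
by apply: le_trans (ler_norm _) _; near: r.
Unshelve. all: by end_near. Qed.

Definition wdeg_multi (a : 'I_n -> nat) l := [seq be <- box_multi l | wdeg a be == l].

Lemma wdeg_multi_uniq a l : uniq (wdeg_multi a l).
Proof. by rewrite filter_uniq// box_multi_uniq. Qed.

Lemma mem_wdeg_multi a l be : (forall i, 0 < a i)%N ->
  (be \in wdeg_multi a l) = (wdeg a be == l).
Proof.
move=> a0; rewrite mem_filter andb_idr// => /eqP <-; rewrite mem_box_multi; apply/forallP => i.
by rewrite /wdeg (bigD1 i)//= (leq_trans _ (leq_addr _ _))// leq_pmull.
Qed.

Definition wdeg_part g (a : 'I_n -> nat) l := monom_sum (wdeg_multi a l) (taylor_coef g).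

Lemma taylor_scaling_cvg U f (r0 : R) (a : 'I_n -> nat) l e u :
  0 < r0 -> open U -> cube r0 `<=` U -> smooth_on U f -> (forall i, 0 < a i)%N ->
  (forall be, taylor_coef f be != 0 -> (l <= wdeg a be)%N) ->
  expR (l%:R * r) * f (exp_coord e (u + r *: nat_row R a)) @[r --> +oo]
    --> wdeg_part f a l (exp_coord e u).
Proof.
move=> r00 oU rU sf a0 le_wdeg; pose x r := exp_coord e (u + r *: nat_row R a).
pose g y := f y - monom_sum (box_multi l) (taylor_coef f) y.
have [C [_ bg]] := taylor_box_remainder l (ltW r00) oU rU sf.
have cvg_g : expR (l%:R * r) * g (x r) @[r --> +oo] --> (0 : R).
  apply: exp_decay_cvg0 (exp_decay_vanishing e u a0 r00 bg).
  by rewrite ltr_nat.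
have cvg_sum : \sum_(be <- box_multi l) taylor_coef f be * (expR (l%:R * r) * monom be (x r))
    @[r --> +oo] --> \sum_(be <- box_multi l)
      taylor_coef f be * (monom be (exp_coord e u) *+ (wdeg a be == l)).
  apply: cvg_big => [|be _]; first exact: add_continuous.
  have [->|cbe] := eqVneq (taylor_coef f be) 0.
    by rewrite mul0r; under eq_fun do rewrite mul0r; exact: cvg_cst.
  by apply: cvgM; [exact: cvg_cst|exact/monom_scaling_cvg/le_wdeg].
rewrite /wdeg_part /monom_sum big_filter big_mkcond/=.
rewrite (_ : \sum_(be <- _) _ = 0 + \sum_(be <- box_multi l)
    taylor_coef f be * (monom be (exp_coord e u) *+ (wdeg a be == l))); last first.
  by rewrite add0r; apply: eq_bigr => be _; case: eqP => _; rewrite ?mulr0.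
rewrite (_ : (fun r => _) = (fun r => expR (l%:R * r) * g (x r) +
    \sum_(be <- box_multi l) taylor_coef f be * (expR (l%:R * r) * monom be (x r)))).
  exact: cvgD cvg_g cvg_sum.
apply/funext => r; rewrite mulrBr /monom_sum mulr_sumr -[LHS](subrK (\sum_(be <- box_multi l)
  taylor_coef f be * (expR (l%:R * r) * monom be (x r)))).
by congr (_ - _ + _); apply: eq_bigr => be _; rewrite mulrCA.
Qed.

End Taylor.

(** * Cones of the subdivision *)

Section Farkas.
Variables (R : realType) (n : nat).
Implicit Types (b g h x y z : 'rV[R]_n) (s : seq 'rV[R]_n).

Fixpoint finite_cone s b : Prop := match s with
  | [::] => b = 0
  | g :: s' => exists c, 0 <= c /\ finite_cone s' (b - c *: g)
  end.

Lemma finite_cone_shift s (c : 'rV[R]_n -> R) h b : (forall g, g \in s -> 0 <= c g) ->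
  finite_cone [seq g + c g *: h | g <- s] b -> exists d, 0 <= d /\ finite_cone s (b - d *: h).
Proof.
elim: s b => [|g s IH] b c0 /=.
  by move=> ->; exists 0; rewrite scale0r subr0.
move=> [lam [l0 /IH[|d [d0 inC]]]]; first by move=> g' g's; apply: c0; rewrite inE g's orbT.
exists (lam * c g + d); split; first by rewrite addr_ge0// mulr_ge0// c0// mem_head.
exists lam; split=> //; congr (finite_cone s _): inC.
by apply/rowP => i; rewrite !mxE; ring.
Qed.

Lemma dotp_self_gt0 x : x != 0 -> 0 < dotp x x.
Proof.
have sq0 i : true -> 0 <= x ord0 i * x ord0 i by rewrite -expr2 sqr_ge0.
move=> x0; rewrite lt_neqAle eq_sym sumr_ge0 // andbT; apply: contra x0.
rewrite psumr_eq0// => /allP sq; apply/eqP/rowP => i; rewrite mxE; apply/eqP.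
by have := sq i (mem_index_enum i); rewrite -expr2 sqrf_eq0.
Qed.

(* Fourier-Motzkin elimination: when the first generator [h] is negative on the separating [y] of
   the others, project everything along [h] to the hyperplane orthogonal to [y]. *)
Lemma farkas s b : finite_cone s b \/
  exists y, (forall g, g \in s -> 0 <= dotp g y) /\ dotp b y < 0.
Proof.
move: {2}(size s) (erefl (size s)) => m; elim: m s b => [|m IH] s b.
  move/eqP; rewrite size_eq0 => /eqP ->; have [->|b0] := eqVneq b 0; first by left.
  by right; exists (- b); split=> //; rewrite linearN/= oppr_lt0 dotp_self_gt0.
case: s => [//|h s] /= [sm].
have [inC|[y [y0 by0]]] := IH s b sm.
  by left; exists 0; rewrite scale0r subr0.
have [hy|hy] := leP 0 (dotp h y).
  by right; exists y; split=> // g; rewrite inE => /predU1P[->//|]; exact: y0.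
have hy0 : dotp h y != 0 by rewrite lt_eqF.
pose c g := - (dotp g y / dotp h y).
have [|inC|[y' [y'0 by']]] := IH [seq g + c g *: h | g <- s] (b + c b *: h).
- by rewrite size_map.
- left; have [|d [d0 inC']] := finite_cone_shift _ inC.
    by move=> g /y0 gy; rewrite /c -mulrN mulr_ge0// oppr_ge0 invr_le0 ltW.
  exists (d - c b); split.
    by rewrite subr_ge0 (le_trans _ d0)// /c oppr_le0 mulr_le0// ?invr_le0 ltW.
  by congr (finite_cone s _): inC'; rewrite scalerBl; apply/rowP => i; rewrite !mxE; ring.
right; pose z := y' - (dotp h y' / dotp h y) *: y; exists z.
have hz : dotp h z = 0 by rewrite linearB/= dotpZr divfK// subrr.
have gz g : dotp g z = dotp (g + c g *: h) y'.
  by rewrite dotpDl dotpZl linearB/= dotpZr /c; field.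
split=> [g|]; last by rewrite gz.
rewrite inE => /predU1P[->|gs]; first by rewrite hz.
by rewrite gz; apply: y'0; apply: map_f.
Qed.

Lemma finite_cone_bound s b : finite_cone s b -> exists K, 0 <= K /\ forall u,
  (forall g, g \in s -> - 1 <= dotp g u) -> - K <= dotp b u.
Proof.
elim: s b => [|g s IH] b /=.
  by move=> ->; exists 0; split=> // u _; rewrite dotpC !linear0.
move=> [c [c0 /IH[K [K0 boundK]]]]; exists (K + c); split; first exact: addr_ge0.
move=> u su; have : - K <= dotp (b - c *: g) u.
  by apply: boundK => g' g's; apply: su; rewrite inE g's orbT.
rewrite dotpBl dotpZl => le_bc.
have : c * - 1 <= c * dotp g u by rewrite ler_wpM2l ?su ?mem_head.
by move: le_bc; rewrite mulrN1; set v := c * _; lra.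
Qed.

End Farkas.

Section Primitive.
Variables (R : realType) (n : nat).
Implicit Types (a b w : 'rV[int]_n) (S : seq 'rV[int]_n).

Definition primitive a := exists w : 'rV[int]_n, \sum_i a ord0 i * w ord0 i = 1.

Lemma int_mul_eq1 (x y : int) : 0 < x -> x * y = 1 -> x = 1.
Proof. by move=> x0 xy; have y0 : 0 < y; nia. Qed.

Lemma primitive_neq0 a : primitive a -> intR R a != 0.
Proof.
move=> [w aw]; apply/eqP => a0; have : (1 : int) = 0; last by [].
rewrite -[LHS]aw big1// => i _; have /rowP/(_ i) := a0; rewrite !mxE => /eqP.
by rewrite intr_eq0 => /eqP ->; rewrite mul0r.
Qed.

Lemma primitive_eq a b (c : R) : primitive a -> primitive b -> 0 <= c ->
  intR R b = c *: intR R a -> b = a.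
Proof.
move=> [w aw] pb; have [w' bw'] := pb => c_ge0 E.
have c0 : 0 < c.
  rewrite lt_neqAle c_ge0 andbT eq_sym; apply/eqP => c0.
  by have := primitive_neq0 pb; rewrite E c0 scale0r eqxx.
have Ei i : ((b ord0 i)%:~R : R) = c * (a ord0 i)%:~R by have /rowP/(_ i) := E; rewrite !mxE.
have pairing (v : 'rV[int]_n) :
    ((\sum_i b ord0 i * v ord0 i)%:~R : R) = c * (\sum_i a ord0 i * v ord0 i)%:~R.
  by rewrite !rmorph_sum/= mulr_sumr; apply: eq_bigr => i _; rewrite !rmorphM/= Ei mulrA.
have := pairing w; have := pairing w'; rewrite aw bw' mulr1.
set za := \sum_i a ord0 i * w' ord0 i; set zb := \sum_i b ord0 i * w ord0 i => cza czb.
have zb0 : 0 < zb by rewrite -(ltr0z R) czb.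
have zz : zb * za = 1.
  by apply/eqP; rewrite -(eqr_int R) rmorphM/= czb -cza.
have c1 : c = 1 by rewrite -czb (int_mul_eq1 zb0 zz).
by apply/rowP => i; apply/eqP; rewrite -(eqr_int R) Ei c1 mul1r.
Qed.

Lemma basis_primitive S i : completes_to_basis S -> (i < size S)%N -> primitive (nth 0 S i).
Proof.
move=> [sn [B [uB rB]]] iS; have iN : (i < n)%N := leq_trans iS sn.
exists (\row_k (invmx B) k (Ordinal iN)).
have := mulmxV uB => /matrixP/(_ (Ordinal iN) (Ordinal iN)).
rewrite !mxE eqxx => E; rewrite -[RHS]E; apply: eq_bigr => k _.
by rewrite -(rB (Ordinal iN) iS) !mxE.
Qed.

Lemma basis_uniq S : completes_to_basis S -> uniq S.
Proof.
move=> [sn [B [uB rB]]]; apply/(uniqP 0) => i j; rewrite !inE => iS jS.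
have [iN jN] := (leq_trans iS sn, leq_trans jS sn).
rewrite -(rB (Ordinal iN))// -(rB (Ordinal jN))// => /(congr1 (fun x => x *m invmx B)).
rewrite -!row_mul mulmxV// => /rowP/(_ (Ordinal iN)); rewrite !mxE eqxx -val_eqE/=.
by case: eqP.
Qed.

Lemma gcone_gen S i : (i < size S)%N -> gcone S (intR R (nth 0 S i)).
Proof.
move=> iS; exists (fun k => (k == i)%:R); split=> //.
rewrite (bigD1 (Ordinal iS))//= eqxx scale1r big1 ?addr0// => k.
by rewrite -val_eqE/= => /negbTE ->; rewrite scale0r.
Qed.

Lemma gcone_hyperplane S : completes_to_basis S -> (size S < n)%N ->
  exists2 w : 'rV[R]_n, w != 0 & forall x, gcone S x -> dotp w x = 0.
Proof.
move=> [sn [B [uB rB]]] Sn; pose i0 := Ordinal Sn.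
have BV i j : \sum_k B i k * (invmx B) k j = (i == j)%:R.
  by have := mulmxV uB => /matrixP/(_ i j); rewrite !mxE.
exists (\row_k ((invmx B) k i0)%:~R).
  apply/eqP => w0; have := BV i0 i0; rewrite eqxx big1// => k _.
  by have /rowP/(_ k) := w0; rewrite !mxE => /eqP; rewrite intr_eq0 => /eqP ->; rewrite mulr0.
move=> x [lam [_ ->]]; rewrite linear_sum/= big1// => i _; rewrite dotpZr.
suff -> : dotp (\row_k ((invmx B) k i0)%:~R) (intR R (nth 0 S i)) = 0 by rewrite mulr0.
have iN : (i < n)%N := ltn_trans (ltn_ord i) Sn.
have := BV (Ordinal iN) i0; rewrite -val_eqE/= (ltn_eqF (ltn_ord i)) => /(congr1 (intr : int -> R)).
rewrite rmorph_sum/= => E; rewrite -[RHS]E; apply: eq_bigr => k _.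
by rewrite rmorphM/= !mxE mulrC -(rB (Ordinal iN))//= mxE.
Qed.

Lemma ray_generators S a : completes_to_basis S -> primitive a ->
  (forall x : 'rV[R]_n, gcone S x <-> exists2 c : R, 0 <= c & x = c *: intR R a) -> S = [:: a].
Proof.
move=> bS pa ray.
have gen i : (i < size S)%N -> nth 0 S i = a.
  move=> iS; have /ray[c c0 E] := gcone_gen iS.
  exact: primitive_eq pa (basis_primitive bS iS) c0 E.
case: S bS ray gen => [|b S] bS ray gen.
  have /ray[lam [_ ]] : exists2 c : R, 0 <= c & intR R a = c *: intR R a.
    by exists 1; rewrite ?scale1r.
  by rewrite big_ord0 => a0; have := primitive_neq0 pa; rewrite a0 eqxx.
have ba : b = a := gen 0%N isT; case: S bS ray gen => [|b' S] bS _ gen; first by rewrite ba.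
have b'a : b' = a := gen 1%N isT.
by have := basis_uniq bS; rewrite ba b'a /= mem_head.
Qed.

End Primitive.

Lemma poly_neq0_near0 (R : realType) (p : {poly R}) : p != 0 ->
  \forall r \near (0 : R)^'+, p.[r] != 0.
Proof.
elim/poly_ind: p => [|p c IH]; first by rewrite eqxx.
have [->|c0] := eqVneq c 0; last first.
  move=> _; apply: cvg_within; apply: (@continuous_horner R (p * 'X + c%:P) 0 [set z | z != 0]).
  rewrite [(_ + _).[0]]hornerMXaddC mulr0 add0r.
  by apply: open_nbhs_nbhs; split; [exact: open_neq|].
rewrite addr0 mulf_eq0 polyX_eq0 orbF => /IH pr0.
by near=> r; rewrite hornerMX mulf_neq0//; near: r.
Unshelve. all: by end_near. Qed.

Lemma near_all_seq (I : eqType) (X : Type) (s : seq I) (F : set_system X) (Q : I -> X -> Prop) :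
  Filter F -> (forall i, i \in s -> \forall r \near F, Q i r) ->
  \forall r \near F, forall i, i \in s -> Q i r.
Proof.
move=> FF; elim: s => [|i s IH] nQ; first by near=> r.
have ns : \forall r \near F, forall j, j \in s -> Q j r.
  by apply: IH => j js; apply: nQ; rewrite inE js orbT.
by apply: filterS2 (nQ i (mem_head _ _)) ns => r Qi Qs j; rewrite inE => /predU1P[->//|/Qs].
Unshelve. all: by end_near. Qed.

Section Cones.
Variables (R : realType) (n : nat) (P : set 'rV[R]_n) (Sig : seq (seq 'rV[int]_n)).
Hypothesis ss : simplicial_subdivision P Sig.
Implicit Types (S T : seq 'rV[int]_n) (u w x : 'rV[R]_n).

Definition chart S := (S \in Sig) && (size S == n).
Definition gens S (j i : 'I_n) : nat := `|(nth 0%R S j) ord0 i|%N.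
Local Notation gen S j := (intR R (nth 0 S (nat_of_ord j))).

Let fan : is_fan R Sig. Proof. by have [] := ss. Qed.
Let basis S : S \in Sig -> completes_to_basis S. Proof. by have [_ _ _] := ss; exact. Qed.

Lemma gens_nonneg S k i : S \in Sig -> (k < size S)%N ->
  nth 0 S k ord0 i = `|(nth 0%R S k) ord0 i|%N.
Proof.
move=> SS kS; have [_ + _ _] := ss => /seteqP[sub _].
have /sub/(_ i) : (\bigcup_(S in [set S | S \in Sig]) @gcone R n S) (intR R (nth 0 S k)).
  by exists S => //; exact: gcone_gen.
by rewrite mxE ler0z => h; rewrite gez0_abs.
Qed.

Lemma chart_dir_gens S (j : 'I_n) : chart S -> chart_dir R (gens S) j = gen S j.
Proof.
move=> /andP[SS /eqP sz]; apply/rowP => i; rewrite !mxE /gens.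
by rewrite [in RHS]gens_nonneg ?sz.
Qed.

Lemma chart_unit S : chart S -> (\matrix_(j, i) (gens S j i)%:R : 'M[R]_n) \in unitmx.
Proof.
move=> cS; have /andP[SS /eqP sz] := cS; have [_ [B [uB rB]]] := basis SS.
have -> : (\matrix_(j, i) (gens S j i)%:R : 'M[R]_n) = map_mx intr B.
  apply/matrixP => j i; rewrite !mxE; have /rowP/(_ i) := chart_dir_gens j cS.
  by rewrite !mxE => ->; rewrite -(rB j) ?sz// mxE.
by rewrite unitmxE det_map_mx; move: uB; rewrite unitmxE; exact: rmorph_unit.
Qed.

Lemma chart_primitive S (j : 'I_n) : chart S -> primitive (nth 0 S j).
Proof. by move=> /andP[SS /eqP sz]; apply: basis_primitive; [exact: basis|rewrite sz]. Qed.

Lemma chart_gcone_gen S (j : 'I_n) : chart S -> gcone S (gen S j).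
Proof. by move=> /andP[_ /eqP sz]; apply: gcone_gen; rewrite sz. Qed.

Lemma chart_gen_sum S u : chart S -> u = \sum_j chart_coord (gens S) j u *: gen S j.
Proof.
move=> cS; rewrite [LHS](chart_dir_sum (chart_unit cS)).
by apply: eq_bigr => j _; rewrite chart_dir_gens.
Qed.

Definition chart_covec S (j : 'I_n) : 'rV[R]_n :=
  \row_i invmx (\matrix_(j, i) (gens S j i)%:R : 'M[R]_n) i j.

Lemma chart_coord_dotp S j u : chart_coord (gens S) j u = dotp (chart_covec S j) u.
Proof. by rewrite /chart_coord mxE; apply: eq_bigr => i _; rewrite !mxE mulrC. Qed.

Lemma chart_coord_gen S (j k : 'I_n) : chart S ->
  chart_coord (gens S) j (gen S k) = (j == k)%:R.
Proof.
move=> cS; have := chart_coord_shift (chart_unit cS) 0 1 j k.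
by rewrite chart_dir_gens// add0r scale1r chart_coord0 add0r => ->.
Qed.

Lemma gconeE S u : chart S -> gcone S u <-> forall j, 0 <= chart_coord (gens S) j u.
Proof.
move=> cS; have /andP[SS /eqP sz] := cS; split.
  move=> [lam [l0 ->]] j; rewrite chart_coord_dotp linear_sum/=; apply: sumr_ge0 => k _.
  rewrite dotpZr mulr_ge0//; have kn : (k < n)%N := leq_trans (ltn_ord k) (eq_leq sz).
  by rewrite -chart_coord_dotp -[nat_of_ord k]/(nat_of_ord (Ordinal kn)) chart_coord_gen.
move=> u0; pose lam i := if insub i is Some j then chart_coord (gens S) j u else 0.
exists lam; split; first by rewrite /lam => i; case: insubP.
rewrite {1}(chart_gen_sum u cS) -(big_mkord xpredT (fun i => lam i *: intR R (nth 0 S i))).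
by rewrite sz big_mkord; apply: eq_bigr => j _; rewrite /lam valK.
Qed.

Lemma gcone_coord_ge0 S u (j : 'I_n) : chart S -> gcone S u -> 0 <= chart_coord (gens S) j u.
Proof. by move=> cS /(gconeE _ cS). Qed.

Lemma gcone_coord_gt0 S u : chart S -> gcone S u -> u != 0 ->
  exists j, 0 < chart_coord (gens S) j u.
Proof.
move=> cS Su; apply: contra_neqP => no; rewrite (chart_gen_sum u cS) big1// => j _.
suff -> : chart_coord (gens S) j u = 0 by rewrite scale0r.
apply/eqP; rewrite eq_le (gcone_coord_ge0 j cS Su) andbT leNgt; apply/negP => pos.
by apply: no; exists j.
Qed.

Lemma dotp_gen_eq0 S w u (k : 'I_n) : chart S -> gcone S u ->
  (forall i, 0 < chart_coord (gens S) i u -> 0 <= dotp w (gen S i)) -> dotp w u = 0 ->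
  0 < chart_coord (gens S) k u -> dotp w (gen S k) = 0.
Proof.
move=> cS Su w0; rewrite {1}(chart_gen_sum u cS) linear_sum/= => /eqP.
rewrite psumr_eq0 => [/allP/(_ k (mem_index_enum k))/=|i _].
  by rewrite dotpZr mulf_eq0 => /orP[/eqP ->|/eqP //]; rewrite ltxx.
rewrite dotpZr; have := gcone_coord_ge0 i cS Su; rewrite le_eqVlt.
by move=> /predU1P[<-|pos]; rewrite ?mul0r// mulr_ge0 ?w0// ltW.
Qed.

Definition other_coords S (j : 'I_n) : 'rV[R]_n := \sum_(i | i != j) chart_covec S i.

Lemma dotp_other_coords S j x :
  dotp (other_coords S j) x = \sum_(i | i != j) chart_coord (gens S) i x.
Proof. by rewrite dotpC linear_sum/=; apply: eq_bigr => i _; rewrite chart_coord_dotp dotpC. Qed.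

Lemma gcone_rayP S (j : 'I_n) x : chart S ->
  (gcone S `&` hyp (other_coords S j) 0) x <-> exists2 c : R, 0 <= c & x = c *: gen S j.
Proof.
move=> cS; rewrite /hyp/= dotp_other_coords; split=> [[Sx /eqP]|[c c0 ->]].
  rewrite psumr_eq0 => [/allP other0|i _]; last exact: gcone_coord_ge0.
  exists (chart_coord (gens S) j x); first exact: gcone_coord_ge0.
  rewrite {1}(chart_gen_sum x cS) (bigD1 j)//= big1 ?addr0// => i ij.
  by have := other0 i (mem_index_enum i); rewrite ij => /eqP ->; exact: scale0r.
have coordc i : chart_coord (gens S) i (c *: gen S j) = c * (i == j)%:R.
  by rewrite chart_coord_dotp dotpZr -chart_coord_dotp chart_coord_gen.
split; first by apply/(gconeE _ cS) => i; rewrite coordc mulr_ge0.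
by rewrite big1// => i /negbTE ij; rewrite coordc ij mulr0.
Qed.

Lemma gens_skeleton1 S (j : 'I_n) : chart S -> skeleton1 Sig (nth 0 S j).
Proof.
move=> cS; have /andP[SS _] := cS; have [face _ _] := fan.
have [|T TS FE] := face S SS (gcone S `&` hyp (other_coords S j) 0).
  exists (other_coords S j); split=> // x Sx; rewrite dotp_other_coords.
  by apply: sumr_ge0 => i _; exact: gcone_coord_ge0.
rewrite /skeleton1/= -(@ray_generators R _ T (nth 0 S j))//; [exact: basis|exact: chart_primitive|].
by move=> x; rewrite -FE; exact: gcone_rayP.
Qed.

Lemma shared_face_gen S T u (k : 'I_n) : chart S -> chart T -> gcone S u -> gcone T u ->
  0 < chart_coord (gens S) k u -> gcone T (gen S k).
Proof.
move=> cS cT Su Tu ku; have [/andP[SS _] /andP[TS _]] := (cS, cT).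
have [_ /(_ S T SS TS)[[w [w0 wE]] _] _] := fan.
suff : (gcone S `&` gcone T) (gen S k) by case.
rewrite wE; split; first exact: chart_gcone_gen.
apply: (dotp_gen_eq0 cS Su _ _ ku) => [i _|]; first by apply: w0; exact: chart_gcone_gen.
by have : (gcone S `&` gcone T) u by []; rewrite wE => -[].
Qed.

Lemma shared_gen S T u (k : 'I_n) : chart S -> chart T -> gcone S u -> gcone T u ->
  0 < chart_coord (gens S) k u -> exists j : 'I_n, nth 0 S k = nth 0 T j.
Proof.
move=> cS cT Su Tu ku; have Sk := chart_gcone_gen k cS.
have Tk := shared_face_gen cS cT Su Tu ku.
have [j kj] := gcone_coord_gt0 cT Tk (primitive_neq0 R (chart_primitive k cS)).
have Sj i := @shared_face_gen T S _ i cT cS Tk Sk.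
have other0 i : i != k -> chart_coord (gens S) i (gen T j) = 0.
  move=> ik; rewrite chart_coord_dotp; apply: (dotp_gen_eq0 cT Tk _ _ kj) => [l pos|].
    by rewrite -chart_coord_dotp; apply: gcone_coord_ge0 (Sj l pos).
  by rewrite -chart_coord_dotp chart_coord_gen// (negbTE ik).
exists j; symmetry; apply: (primitive_eq (c := chart_coord (gens S) k (gen T j))).
- exact: chart_primitive.
- exact: chart_primitive.
- exact: gcone_coord_ge0 (Sj j kj).
rewrite {1}(chart_gen_sum (gen T j) cS) (bigD1 k)//= big1 ?addr0// => i /other0 ->.
by rewrite scale0r.
Qed.

Lemma shared_coord S T u (k j : 'I_n) : chart S -> chart T -> gcone S u -> gcone T u ->
  nth 0 S k = nth 0 T j -> chart_coord (gens S) k u = chart_coord (gens T) j u.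
Proof.
move=> cS cT Su Tu E; rewrite [in RHS](chart_gen_sum u cS) [RHS]chart_coord_dotp linear_sum/=.
have term i : dotp (chart_covec T j) (chart_coord (gens S) i u *: gen S i) =
    if i == k then chart_coord (gens S) k u else 0.
  rewrite dotpZr -chart_coord_dotp; case: eqVneq => [->|ik].
    by rewrite E chart_coord_gen// eqxx mulr1.
  have := gcone_coord_ge0 i cS Su; rewrite le_eqVlt => /predU1P[<-|pos]; first by rewrite mul0r.
  have [j' E'] := shared_gen cS cT Su Tu pos.
  rewrite E' chart_coord_gen//; have [jj|] := eqVneq j j'; last by rewrite mulr0.
  have := chart_coord_gen i k cS; rewrite E jj -E' chart_coord_gen// eqxx (negbTE ik) => /eqP.
  by rewrite oner_eq0.
by rewrite (eq_bigr _ (fun i _ => term i)) -big_mkcond big_pred1_eq.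
Qed.

Lemma cone_functional_bound S T (b : 'rV[R]_n) : chart S -> chart T ->
  (forall u, gcone S u -> gcone T u -> dotp b u <= 0) ->
  exists K, 0 <= K /\ forall u, (forall j, - 1 <= chart_coord (gens S) j u) ->
    (forall j, - 1 <= chart_coord (gens T) j u) -> dotp b u <= K.
Proof.
move=> cS cT b_le0; pose covecs S' := [seq chart_covec S' j | j <- enum 'I_n].
have in_covecs S' j : chart_covec S' j \in covecs S' by rewrite map_f ?mem_enum.
have [inC|[y [y0 yb]]] := farkas (covecs S ++ covecs T) (- b).
  have [K [K0 boundK]] := finite_cone_bound inC; exists K; split=> // u Su Tu.
  rewrite -lerN2 -dotpNl; apply: boundK => g.
  by rewrite mem_cat => /orP[] /mapP[j _ ->]; rewrite -chart_coord_dotp.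
exfalso; move: yb; rewrite dotpNl oppr_lt0 ltNge => /negP; apply; apply: b_le0.
  by apply/(gconeE _ cS) => j; rewrite chart_coord_dotp y0// mem_cat in_covecs.
by apply/(gconeE _ cT) => j; rewrite chart_coord_dotp y0// mem_cat in_covecs orbT.
Qed.

Definition moment_curve u (r : R) : 'rV[R]_n := \row_i (u ord0 i + r ^+ i.+1).

Definition moment_poly w u : {poly R} := (dotp w u)%:P + \poly_(k < n.+1)
  (if k is k'.+1 then (if insub k' is Some i then w ord0 i else 0) else 0).

Lemma horner_moment_poly w u r : (moment_poly w u).[r] = dotp w (moment_curve u r).
Proof.
rewrite hornerD hornerC horner_poly big_ord_recl/= mul0r add0r /dotp -big_split/=.
by apply: eq_bigr => i _; rewrite mxE mulrDr /bump/= valK.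
Qed.

Lemma moment_poly_neq0 w u : w != 0 -> moment_poly w u != 0.
Proof.
apply: contra_neq => p0; apply/rowP => i; rewrite mxE.
have := congr1 (fun p : {poly R} => p`_i.+1) p0; rewrite coef0 coefD coefC/= coef_poly add0r.
by rewrite ltnS ltn_ord valK.
Qed.

Lemma dotp_moment_curve_lt0 w u : dotp w u < 0 ->
  \forall r \near (0 : R)^'+, dotp w (moment_curve u r) < 0.
Proof.
move=> wu; under eq_near do rewrite -horner_moment_poly; apply: cvg_within.
apply: (@continuous_horner R (moment_poly w u) 0 [set z | z < 0]).
have -> : (moment_poly w u).[0] = dotp w u.
  by rewrite horner_moment_poly; congr dotp; apply/rowP => i; rewrite mxE expr0n addr0.
by apply: open_nbhs_nbhs; split; [exact: open_lt|].
Qed.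

(* A point outside the maximal cones can be pushed along the moment curve, which meets the lower
   dimensional cones only for finitely many parameters, to a point outside all the cones. *)
Lemma charts_cover u : (forall i, 0 < u ord0 i) -> exists2 S, chart S & gcone S u.
Proof.
move=> u0; apply: contrapT => no.
have off_cone S : S \in Sig -> \forall r \near (0 : R)^'+, ~ gcone S (moment_curve u r).
  move=> SS; have [sz|sz] := eqVneq (size S) n.
    have cS : chart S by rewrite /chart SS sz eqxx.
    have [j uj] : exists j, chart_coord (gens S) j u < 0.
      apply: contrapT => nneg; apply: no; exists S => //; apply/(gconeE _ cS) => j.
      by rewrite leNgt; apply/negP => neg; apply: nneg; exists j.
    rewrite chart_coord_dotp in uj; apply: filterS (dotp_moment_curve_lt0 uj) => r neg.
    by move=> /(gcone_coord_ge0 j cS); rewrite leNgt chart_coord_dotp neg.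
  have [|w w0 wS] := gcone_hyperplane R (basis SS).
    by rewrite ltn_neqAle sz; have [] := basis SS.
  apply: filterS (poly_neq0_near0 (moment_poly_neq0 u w0)) => r /eqP pr0 /wS.
  by rewrite -horner_moment_poly.
have {}off_cone := near_all_seq (at_right_proper_filter (0 : R)) off_cone.
have [r [r0 off]] := filter_ex (filterI (nbhs_right_gt 0) off_cone).
have [_ /seteqP[_ cov] _ _] := ss.
have [S SS Su] : (\bigcup_(S in [set S | S \in Sig]) @gcone R n S) (moment_curve u r).
  by apply: cov => i; rewrite mxE addr_ge0 ?exprn_ge0// ltW.
exact: off Su.
Qed.

End Cones.

(** * Newton polyhedra *)

Section Dickson.
Variables (X I : eqType) (c : I -> X -> nat).
Implicit Types (js : seq I) (A T : set X) (M : seq X).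

Definition minorized js A M :=
  forall x, A x -> exists2 m, m \in M & forall j, j \in js -> (c j m <= c j x)%N.

Lemma minorized_sub js A M M' : {subset M <= M'} -> minorized js A M -> minorized js A M'.
Proof. by move=> MM' AM x /AM[m /MM' mM le_m]; exists m. Qed.

Lemma minorized_below js j T :
  (forall A, exists2 M, (forall m, m \in M -> A m) & minorized js A M) ->
  forall k, exists2 M, (forall m, m \in M -> T m) &
    minorized (j :: js) (T `&` [set x | (c j x < k)%N]) M.
Proof.
move=> min_js; elim=> [|k [M MT minM]]; first by exists [::] => // x [].
have [M' M'T minM'] := min_js (T `&` [set x | c j x = k]).
exists (M ++ M') => [m|x [Tx]]; first by rewrite mem_cat => /orP[/MT//|/M'T[]].
rewrite /= ltnS leq_eqVlt => /orP[/eqP xk|xk]; last first.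
  by have [m mM le_m] := minM x (conj Tx xk); exists m; rewrite // mem_cat mM.
have [m mM' le_m] := minM' x (conj Tx xk); exists m; first by rewrite mem_cat mM' orbT.
by move=> i; rewrite inE => /predU1P[->|/le_m//]; have [_ ->] := M'T m mM'; rewrite xk.
Qed.

Lemma dickson js T : exists2 M, (forall m, m \in M -> T m) & minorized js T M.
Proof.
elim: js T => [|j js IH] T.
  have [[x Tx]|no] := pselect (exists x, T x); last first.
    by exists [::] => // x Tx; case: no; exists x.
  by exists [:: x] => [m|y _]; [rewrite inE => /eqP ->|exists x; rewrite ?mem_head].
have [M0 M0T minM0] := IH T; pose K := \max_(m <- M0) c j m.
have leK m : m \in M0 -> (c j m <= K)%N by move=> mM0; exact: (leq_bigmax_seq _ mM0).
have [M1 M1T minM1] := minorized_below j T IH K.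
exists (M0 ++ M1) => [m|x Tx]; first by rewrite mem_cat => /orP[/M0T|/M1T].
have [xK|xK] := ltnP (c j x) K.
  by apply: minorized_sub minM1 _ _ => // m mM1; rewrite mem_cat mM1 orbT.
have [m mM0 le_m] := minM0 x Tx; exists m; first by rewrite mem_cat mM0.
by move=> i; rewrite inE => /predU1P[->|/le_m//]; exact: leq_trans (leK m mM0) xK.
Qed.

End Dickson.

Section Newton.
Variables (R : realType) (n : nat).
Implicit Types (g : 'rV[R]_n -> R) (a x y : 'rV[R]_n) (al be m : 'rV[nat]_n).

Lemma support_minimal g : exists2 M : seq 'rV[nat]_n,
  (forall m, m \in M -> taylor_coef g m != 0) &
  forall al, taylor_coef g al != 0 -> exists2 m, m \in M & forall i, (m ord0 i <= al ord0 i)%N.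
Proof.
have [M MT minM] := dickson (fun (i : 'I_n) al => al ord0 i) (enum 'I_n)
  [set al | taylor_coef g al != 0].
exists M => [m /MT//|al /minM[m mM le_m]]; exists m => // i.
by apply: le_m; rewrite mem_enum.
Qed.

Lemma le_dotp a x y : orthant a -> (forall i, x ord0 i <= y ord0 i) -> dotp a x <= dotp a y.
Proof. by move=> a0 xy; apply: ler_sum => i _; apply: ler_wpM2l. Qed.

Lemma dotp_le_inj a x y : (forall i, 0 < a ord0 i) -> (forall i, x ord0 i <= y ord0 i) ->
  dotp a y <= dotp a x -> x = y.
Proof.
move=> a0 xy le_yx; have term0 i : 0 <= a ord0 i * (y - x) ord0 i.
  by rewrite mulr_ge0 ?(ltW (a0 i))// !mxE subr_ge0.
have /eqP : dotp a (y - x) = 0.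
  by apply/eqP; rewrite eq_le {2}/dotp sumr_ge0// linearB/= subr_le0 le_yx.
rewrite /dotp psumr_eq0// => /allP all0; apply/rowP => i.
have := all0 i (mem_index_enum i); rewrite /= mulf_eq0 gt_eqF//= !mxE subr_eq0.
by move/eqP.
Qed.

Lemma newton_support g al x : taylor_coef g al != 0 -> (forall i, (al ord0 i)%:R <= x ord0 i) ->
  newton g x.
Proof.
move=> Tal h; exists 1%N, (fun=> 1), (fun=> x); split=> //; first by rewrite big_ord1.
  by move=> _; exists al.
by rewrite big_ord1 scale1r.
Qed.

Lemma newton_natR g al : taylor_coef g al != 0 -> newton g (natR R al).
Proof. by move=> Tal; apply: newton_support Tal _ => i; rewrite mxE. Qed.

Lemma newton_valid g a (L : R) : orthant a ->
  (forall al, taylor_coef g al != 0 -> L <= dotp a (natR R al)) -> newton g `<=` hyp_plus a L.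
Proof.
move=> a0 supp_ge x [k [w [p [w0 w1 pA ->]]]]; rewrite /hyp_plus/= linear_sum/=.
rewrite -[L]mul1r -w1 mulr_suml; apply: ler_sum => i _; rewrite dotpZr; apply: ler_wpM2l => //.
have [al Tal le_p] := pA i; apply: le_trans (supp_ge al Tal) _; apply: le_dotp => // j.
by rewrite mxE.
Qed.

Lemma newton_orthant g : newton g `<=` @orthant R n.
Proof.
move=> x gx i; rewrite -(dotp_evec i x).
apply: (newton_valid (L := 0) _ _ gx).
  by move=> k; rewrite mxE; case: (_ && _).
by move=> al _; rewrite dotp_evec mxE.
Qed.

Lemma cons_rowB k (t s c : R) (x y : 'rV[R]_k) :
  cons_row t x - c *: cons_row s y = cons_row (t - c * s) (x - c *: y).
Proof. by apply/rowP => i; rewrite !mxE; case: unliftP => [j _|_]; rewrite ?mxE. Qed.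

Lemma dotp_cons k (t : R) (x : 'rV[R]_k) (y : 'rV[R]_k.+1) :
  dotp (cons_row t x) y = t * y ord0 ord0 + dotp x (\row_j y ord0 (lift ord0 j)).
Proof.
rewrite /dotp big_ord_recl cons_row_head; congr (_ + _).
by apply: eq_bigr => j _; rewrite cons_row_tail mxE.
Qed.

Lemma finite_cone_evec (s : seq 'I_n) (t : R) x :
  finite_cone [seq cons_row 0 (evec R i) | i <- s] (cons_row t x) -> t = 0 /\ orthant x.
Proof.
elim: s x => [|i s IH] x /=.
  move=> /rowP E; split; first by have := E ord0; rewrite cons_row_head mxE.
  by move=> j; have := E (lift ord0 j); rewrite cons_row_tail mxE => ->.
move=> [c [c0]]; rewrite cons_rowB mulr0 subr0 => /IH[-> xi0]; split=> // j.
by have := xi0 j; rewrite !mxE subr_ge0; apply: le_trans; rewrite mulr_ge0.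
Qed.

Definition newton_gens (M : seq 'rV[nat]_n) : seq 'rV[R]_n.+1 :=
  [seq cons_row 1 (natR R m) | m <- M] ++ [seq cons_row 0 (evec R i) | i <- enum 'I_n].

Lemma finite_cone_hull (M : seq 'rV[nat]_n) (t : R) x :
  finite_cone (newton_gens M) (cons_row t x) ->
  exists (k : nat) (w : 'I_k -> R) (p : 'I_k -> 'rV[R]_n) y,
   [/\ forall i, 0 <= w i, \sum_(i < k) w i = t, forall i, exists2 m, m \in M & p i = natR R m,
     orthant y & x = \sum_(i < k) w i *: p i + y].
Proof.
elim: M t x => [|m M IH] t x /=.
  move=> /finite_cone_evec[-> x0]; exists 0%N, (fun=> 0), (fun=> 0), x; split=> //.
  - by rewrite big_ord0.
  - by case.
  - by rewrite big_ord0 add0r.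
move=> [c [c0]]; rewrite cons_rowB mulr1 => /IH[k [w [p [y [w0 w1 pM y0 xE]]]]].
exists k.+1, (fun i => if unlift ord0 i is Some j then w j else c),
  (fun i => if unlift ord0 i is Some j then p j else natR R m), y; split=> //.
- by move=> i; case: unliftP.
- rewrite big_ord_recl unlift_none (eq_bigr w) => [|i _]; last by rewrite liftK.
  by rewrite w1 addrC subrK.
- move=> i; case: unliftP => [j _|_]; last by exists m; rewrite ?mem_head.
  by have [m' m'M ->] := pM j; exists m'; rewrite // inE m'M orbT.
- rewrite big_ord_recl unlift_none (eq_bigr (fun i => w i *: p i)) => [|i _]; last by rewrite liftK.
  by rewrite -addrA -xE addrC subrK.
Qed.

Lemma newton_gens_dual (M : seq 'rV[nat]_n) (y : 'rV[R]_n.+1) :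
  (forall h, h \in newton_gens M -> 0 <= dotp h y) ->
  orthant (\row_j y ord0 (lift ord0 j)) /\
  forall m, m \in M -> - y ord0 ord0 <= dotp (\row_j y ord0 (lift ord0 j)) (natR R m).
Proof.
move=> y0; split=> [i|m mM].
  have := y0 (cons_row 0 (evec R i)); rewrite dotp_cons mul0r add0r dotp_evec; apply.
  rewrite mem_cat; apply/orP; right.
  by apply: (map_f (fun i => cons_row 0 (evec R i))); rewrite mem_enum.
have := y0 (cons_row 1 (natR R m)).
rewrite dotp_cons mul1r dotpC -lerBlDl sub0r; apply.
by rewrite mem_cat (map_f (fun m => cons_row 1 (natR R m))).
Qed.

Lemma newton_dual g x : newton g x <-> forall a (L : R), orthant a ->
  (forall al, taylor_coef g al != 0 -> L <= dotp a (natR R al)) -> L <= dotp a x.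
Proof.
split=> [gx a L a0 La|dual]; first exact: newton_valid gx.
have [M MT minM] := support_minimal g.
have [inC|[y [/newton_gens_dual[a0 yM] yx]]] := farkas (newton_gens M) (cons_row 1 x).
  have [k [w [p [y [w0 w1 pM y0 xE]]]]] := finite_cone_hull inC.
  exists k, w, (fun i => p i + y); split=> //.
    move=> i; have [m mM ->] := pM i; exists m; first exact: MT.
    by move=> j; rewrite !mxE lerDl.
  under eq_bigr do rewrite scalerDr; by rewrite big_split/= -scaler_suml w1 scale1r.
exfalso; move: yx; rewrite dotp_cons mul1r ltNge => /negP; apply.
rewrite dotpC -lerBlDl sub0r; apply: dual => // al /minM[m mM mal].
apply: le_trans (yM m mM) _; apply: le_dotp => // i.
by rewrite !mxE ler_nat.
Qed.

Lemma newton_closed g : closed (newton g).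
Proof.
have -> : newton g = \bigcap_(q in [set q : 'rV[R]_n * R | orthant q.1 /\
   forall al, taylor_coef g al != 0 -> q.2 <= dotp q.1 (natR R al)]) [set x | q.2 <= dotp q.1 x].
  apply/seteqP; split=> x.
    by move=> /newton_dual dual [a L] /= [a0 La]; exact: dual.
  by move=> dual; apply/newton_dual => a L a0 La; exact: (dual (a, L)).
apply: closed_bigI => -[a L] _ /=.
apply: (@preimage_closed _ _ (dotp a) [set z | L <= z]); last exact: closed_ge.
by move=> x _; exact: dotp_continuous.
Qed.

Lemma support_argmin g a : orthant a -> newton g !=set0 -> exists2 al, taylor_coef g al != 0 &
  forall be, taylor_coef g be != 0 -> dotp a (natR R al) <= dotp a (natR R be).
Proof.
move=> a0 [x [k [w [p [w0 w1 pA _]]]]]; have [M MT minM] := support_minimal g.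
have M0 : M != [::].
  case: k w p w0 w1 pA => [|k] w p w0 w1 pA.
    by move: w1; rewrite big_ord0 => /eqP; rewrite eq_sym oner_eq0.
  have [al /minM[m mM _] _] := pA ord0; by case: (M) mM.
have [b bM bmin] := seq_argmin (fun m => dotp a (natR R m)) M0.
exists b; first exact: MT.
move=> be /minM[m mM mbe]; apply: le_trans (bmin m mM) _; apply: le_dotp => // i.
by rewrite !mxE ler_nat.
Qed.

Lemma lmin_attained g a al : orthant a -> taylor_coef g al != 0 ->
  (forall be, taylor_coef g be != 0 -> dotp a (natR R al) <= dotp a (natR R be)) ->
  lmin (newton g) a = dotp a (natR R al).
Proof.
move=> a0 Tal al_min; have gal := newton_natR Tal.
have lb : lbound [set dotp a z | z in newton g] (dotp a (natR R al)).
  by move=> _ [z gz <-]; exact: newton_valid gz.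
apply/eqP; rewrite eq_le; apply/andP; split.
  by apply: ge_inf; [exists (dotp a (natR R al))|exists (natR R al)].
by apply: lb_le_inf => //; exists (dotp a (natR R al)), (natR R al).
Qed.

(* The zero vector is a limit of normals of [gam], so [gam] contains a point of the support; a point
   of smaller value at [u] would remain smaller at normals of [gam] close to [u]. *)
Lemma cone_minimizer g gam (S : seq 'rV[int]_n) : newton g !=set0 ->
  gcone S `<=` closure (dual_cone (newton g) gam) ->
  exists2 al, taylor_coef g al != 0 & forall u, gcone S u ->
    forall be, taylor_coef g be != 0 -> dotp u (natR R al) <= dotp u (natR R be).
Proof.
move=> g0 S_gam.
have S0 : gcone S (0 : 'rV[R]_n).
  by exists (fun=> 0); split=> //; rewrite big1// => i _; rewrite scale0r.
have [a [[a0 aE] _]] := S_gam _ S0 setT filterT.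
have [al Tal amin] := support_argmin a0 g0; exists al => //.
have gam_al : gam (natR R al).
  by rewrite -aE; split; [rewrite /hyp/= (lmin_attained a0 Tal amin)|exact: newton_natR].
move=> u /S_gam clos_u be Tbe; rewrite leNgt; apply/negP => lt.
have : nbhs u [set v | dotp (natR R be - natR R al) v < 0].
  apply: open_nbhs_nbhs; split; first exact: open_dotp_lt.
  by rewrite /= dotpBl subr_lt0 !(dotpC _ u).
move=> /clos_u[b [[b0 bE] /=]]; rewrite dotpBl subr_lt0 !(dotpC _ b) => lt_b.
have [al' Tal' bmin] := support_argmin b0 g0.
move: gam_al; rewrite -bE /hyp/= (lmin_attained b0 Tal' bmin) => -[bal _].
by have := bmin be Tbe; rewrite -bal leNgt lt_b.
Qed.

Definition int_row (a : 'I_n -> nat) : 'rV[int]_n := \row_i (a i)%:Z.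

Lemma intR_int_row (a : 'I_n -> nat) : intR R (int_row a) = nat_row R a.
Proof. by apply/rowP => i; rewrite !mxE. Qed.

Lemma dotp_wdeg (a : 'I_n -> nat) be : dotp (nat_row R a) (natR R be) = (wdeg a be)%:R.
Proof. by rewrite /wdeg natr_sum; apply: eq_bigr => i _; rewrite !mxE natrM. Qed.

Lemma nat_row_orthant (a : 'I_n -> nat) : orthant (nat_row R a).
Proof. by move=> i; rewrite mxE. Qed.

Definition min_wdeg g (a : 'I_n -> nat) (l : nat) :=
  (exists2 al, taylor_coef g al != 0 & wdeg a al = l) /\
  forall be, taylor_coef g be != 0 -> (l <= wdeg a be)%N.

Lemma min_wdeg_exists g (a : 'I_n -> nat) : newton g !=set0 -> exists l, min_wdeg g a l.
Proof.
move=> g0; have [al Tal al_min] := support_argmin (nat_row_orthant a) g0.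
exists (wdeg a al); split; first by exists al.
by move=> be /al_min; rewrite !dotp_wdeg ler_nat.
Qed.

Lemma lmin_min_wdeg g (a : 'I_n -> nat) l : min_wdeg g a l ->
  lmin (newton g) (nat_row R a) = l%:R.
Proof.
move=> [[al Tal <-] le_l].
rewrite (lmin_attained (nat_row_orthant a) Tal) ?dotp_wdeg// => be Tbe.
by rewrite !dotp_wdeg ler_nat le_l.
Qed.

Lemma min_wdeg_valid g (a : 'I_n -> nat) l : min_wdeg g a l ->
  newton g `<=` hyp_plus (nat_row R a) l%:R.
Proof.
move=> [_ le_l]; apply: newton_valid; first exact: nat_row_orthant.
by move=> al Tal; rewrite dotp_wdeg ler_nat le_l.
Qed.

Lemma min_wdeg_face g (a : 'I_n -> nat) l : min_wdeg g a l ->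
  is_face (newton g) (newton g `&` hyp (nat_row R a) l%:R).
Proof.
move=> min_l; exists (int_row a), l%:Z; rewrite /valid intR_int_row; split=> //.
exact: min_wdeg_valid.
Qed.

Lemma min_wdeg_face_natR g (a : 'I_n -> nat) al : taylor_coef g al != 0 ->
  (newton g `&` hyp (nat_row R a) (wdeg a al)%:R) (natR R al).
Proof. by move=> Tal; split; [exact: newton_natR|rewrite /hyp/= dotp_wdeg]. Qed.

Lemma min_wdeg_compact_face g (a : 'I_n -> nat) l : (forall i, 0 < a i)%N -> min_wdeg g a l ->
  is_compact_face (newton g) (newton g `&` hyp (nat_row R a) l%:R).
Proof.
move=> a0 min_l; split; first exact: min_wdeg_face.
have [[al Tal <-] _] := min_l; split; first by exists (natR R al); exact: min_wdeg_face_natR.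
apply: (@subclosed_compact _ _ (cube (wdeg a al)%:R)).
- apply: closedI; first exact: newton_closed.
  apply: (@preimage_closed _ _ (dotp (nat_row R a)) [set z | z = _]); last exact: closed_eq.
  by move=> x _; exact: dotp_continuous.
- exact: cube_compact.
- move=> x [/newton_orthant x0 xl] i; rewrite ger0_norm// -xl /dotp (bigD1 i)//=.
  apply: ler_wpDr; first by apply: sumr_ge0 => k _; rewrite mulr_ge0// mxE.
  by apply: ler_peMl => //; rewrite mxE ler1n.
Qed.

Lemma compact_face_normal_gt0 g gam (a : 'rV[int]_n) (l : int) al :
  valid (newton g) a l -> newton g `&` hyp (intR R a) l%:~R = gam -> compact gam ->
  taylor_coef g al != 0 -> gam (natR R al) -> forall i, 0 < intR R a ord0 i.
Proof.
move=> va aE cg Tal gal i.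
have lal : dotp (intR R a) (natR R al) = l%:~R by move: gal; rewrite -aE => -[].
have ray_newton (t : R) : 0 <= t -> newton g (natR R al + t *: evec R i).
  by move=> t0; apply: newton_support Tal _ => j; rewrite !mxE lerDl mulr_ge0.
have ray_dotp (t : R) :
    dotp (intR R a) (natR R al + t *: evec R i) = l%:~R + t * intR R a ord0 i.
  by rewrite linearD/= lal dotpZr [dotp _ (evec R i)]dotpC dotp_evec.
rewrite lt_neqAle; apply/andP; split; last first.
  by have := va _ (ray_newton 1 ler01); rewrite /hyp_plus/= ray_dotp mul1r lerDl.
apply/eqP => a0.
have ray_gam (t : R) : 0 <= t -> gam (natR R al + t *: evec R i).
  by move=> t0; rewrite -aE; split; [exact: ray_newton|rewrite /hyp/= ray_dotp -a0 mulr0 addr0].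
have [|||c _ cmax] := @compact_EVT_max _ R (fun x : 'rV[R]_n => x ord0 i) gam.
- by exists (natR R al).
- exact: cg.
- by apply: continuous_subspaceT => x; exact: coord_continuous.
have c0 : 0 <= c ord0 i by apply: le_trans (cmax _ (mem_set gal)); rewrite mxE.
have := cmax _ (mem_set (ray_gam (c ord0 i + 1) (addr_ge0 c0 ler01))).
rewrite !mxE !eqxx mulr1 leNgt => /negP; apply.
by apply: (@lt_le_trans _ _ (c ord0 i + 1)); rewrite ?ltrDl// lerDr.
Qed.

Lemma newton_boundary_minimal g al be : newton_boundary g (natR R al) ->
  taylor_coef g al != 0 -> taylor_coef g be != 0 -> (forall i, be ord0 i <= al ord0 i)%N ->
  be = al.
Proof.
move=> [gam [[a [l [va aE]]] [_ cg]] gal] Tal Tbe beal.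
have apos := compact_face_normal_gt0 va aE cg Tal gal.
suff /rowP E : natR R be = natR R al.
  by apply/rowP => i; have := E i; rewrite !mxE => /eqP; rewrite eqr_nat => /eqP.
apply: (dotp_le_inj apos) => [i|]; first by rewrite !mxE ler_nat.
have -> : dotp (intR R a) (natR R al) = l%:~R by move: gal; rewrite -aE => -[].
by apply: va; exact: newton_natR.
Qed.

Lemma nat_weight_gt0 a y : orthant a -> 0 < dotp a y -> \forall N \near \oo,
  0 < dotp (nat_row R (fun i => (Num.truncn (N%:R * a ord0 i)).+1)) y.
Proof.
move=> a0 ay; pose D : R := \sum_i `|y ord0 i|.
have D0 : 0 <= D by apply: sumr_ge0.
near=> N; apply: (@lt_le_trans _ _ (N%:R * dotp a y - D)).
  rewrite subr_gt0 -ltr_pdivrMr//.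
  apply: (@lt_le_trans _ _ (Num.bound (D / dotp a y))%:R).
    by apply: archi_boundP; rewrite divr_ge0// ltW.
  by rewrite ler_nat; near: N; exact: nbhs_infty_ge.
rewrite /dotp mulr_sumr /D -sumrB; apply: ler_sum => i _; rewrite [nat_row _ _ _ _]mxE mulrA.
set b := (Num.truncn _).+1; have round : `|b%:R - N%:R * a ord0 i| <= 1.
  have /truncn_itv/andP[lo hi] : 0 <= N%:R * a ord0 i by rewrite mulr_ge0.
  by rewrite ger0_norm ?subr_ge0 ?(ltW hi)// lerBlDl /b -natr1 lerD2r.
rewrite lerBlDr -lerBlDl -mulrBl; apply: le_trans (ler_norm _) _.
by rewrite normrM distrC ler_piMl.
Unshelve. all: by end_near. Qed.

Lemma positive_nat_weight a (D : seq 'rV[R]_n) : orthant a ->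
  (forall y, y \in D -> 0 < dotp a y) ->
  exists2 b : 'I_n -> nat, (forall i, 0 < b i)%N & forall y, y \in D -> 0 < dotp (nat_row R b) y.
Proof.
move=> a0 D0.
have [N ND] := filter_ex (near_all_seq eventually_filter (fun y yD => nat_weight_gt0 a0 (D0 y yD))).
by exists (fun i => (Num.truncn (N%:R * a ord0 i)).+1).
Qed.

(* Real weights are approximated by positive integer ones, whose minimizing face is compact. *)
Lemma newton_boundary_dominates g (M : seq 'rV[nat]_n) : newton g !=set0 ->
  (forall al, taylor_coef g al != 0 -> newton_boundary g (natR R al) -> al \in M) ->
  forall a (L : R), orthant a -> (forall m, m \in M -> L <= dotp a (natR R m)) ->
  forall be, taylor_coef g be != 0 -> L <= dotp a (natR R be).
Proof.
move=> g0 boundaryM a L a0 LM be Tbe; rewrite leNgt; apply/negP => lt.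
have [_ /mapP[m mM ->]|b b0 bM] :=
    @positive_nat_weight a [seq natR R m - natR R be | m <- M] a0.
  by rewrite linearB/= subr_gt0; apply: lt_le_trans lt (LM m mM).
have [l min_l] := min_wdeg_exists b g0; have [[al Tal dl] lb] := min_l.
have /bM : natR R al - natR R be \in [seq natR R m - natR R be | m <- M].
  apply: (map_f (fun m => natR R m - natR R be)); apply: boundaryM => //.
  exists (newton g `&` hyp (nat_row R b) l%:R); first exact: min_wdeg_compact_face.
  by rewrite -dl; exact: min_wdeg_face_natR.
by rewrite linearB/= !dotp_wdeg subr_gt0 ltr_nat dl ltnNge lb.
Qed.

Lemma newton_principal g : newton g !=set0 -> newton (principal_part g) = newton g.
Proof.
move=> g0; have [M0 MT minM] := support_minimal g.
pose M := undup [seq al <- M0 | `[< newton_boundary g (natR R al) >]].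
have inM al : taylor_coef g al != 0 -> newton_boundary g (natR R al) -> al \in M.
  move=> Tal bal; have [m mM0 mal] := minM al Tal.
  have mE := newton_boundary_minimal bal Tal (MT m mM0) mal.
  by rewrite mem_undup mem_filter -mE mM0 andbT mE; apply/asboolP.
have MB al : al \in M -> newton_boundary g (natR R al) /\ taylor_coef g al != 0.
  by rewrite mem_undup mem_filter => /andP[/asboolP bal /MT].
have pE : principal_part g = monom_sum M (taylor_coef g).
  apply/funext => x; rewrite /principal_part /gam_part_poly /monom_sum.
  rewrite [RHS]fsbig_seq ?undup_uniq//; symmetry; apply: fsbig_widen.
    by move=> al /= /MB[].
  move=> al [/= bal alM]; apply/eqP; rewrite mulf_eq0; apply/orP; left.
  by apply/negPn/negP => Tal; apply: alM; exact: inM.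
have TE al : taylor_coef (principal_part g) al != 0 <-> al \in M.
  rewrite pE taylor_coef_monom_sum ?undup_uniq//; case: ifP => [/MB[_ ->]|_]; first by [].
  by rewrite eqxx.
apply/seteqP; split=> x /newton_dual dual; apply/newton_dual => a L a0 La; apply: dual => // al.
  by move=> /TE/MB[_]; exact: La.
by move=> Tal; apply: (newton_boundary_dominates g0 inM a0 _ Tal) => m /TE; exact: La.
Qed.

End Newton.

(** * Lower bound for the gradient *)

Lemma derive_eq0_quadratic (R : realType) (K : R -> R) (C d : R) : is_derive (0 : R) 1 K d ->
  (\forall h \near (0 : R)^'+, `|K h - K 0| <= C * h ^+ 2) -> d = 0.
Proof.
move=> [dK <-] quad.
have quot_cvg := cvg_dnbhs_at_right dK.
suff : h^-1 *: ((K \o shift 0) (h *: 1) - K 0) @[h --> (0 : R)^'+] --> (0 : R).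
  exact: cvg_unique quot_cvg.
apply/cvgr0Pnorm_le => e e0.
have C1 : 0 < `|C| + 1 by rewrite ltr_wpDl.
near=> h; have h0 : 0 < h by [].
rewrite /= [h *: 1]mulr1 addr0 normrM normfV (gtr0_norm h0) mulrC ler_pdivrMr//.
have quad_h : `|K h - K 0| <= C * h ^+ 2 by near: h.
apply: le_trans quad_h _; rewrite expr2 mulrA ler_wpM2r ?(ltW h0)//.
apply: (@le_trans _ _ ((`|C| + 1) * h)).
  by rewrite ler_wpM2r ?(ltW h0)// (le_trans (ler_norm _))// lerDl.
rewrite mulrC -ler_pdivlMr//; near: h; apply: nbhs_right_le; exact: divr_gt0.
Unshelve. all: by end_near. Qed.

Section ClusterPoint.
Variables (R : realType) (n : nat).

(* Compactness of [0, +oo]^n, through the coordinates [expR (- s)]. *)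
Lemma nonneg_rows_cluster (s : nat -> 'rV[R]_n) : (forall m j, 0 <= s m ord0 j) ->
  exists (J : pred 'I_n) (sb : 'rV[R]_n), (forall j, 0 <= sb ord0 j) /\
    forall (eta : R) M, 0 < eta -> exists2 m, (M <= m)%N & forall j,
      if J j then expR (- s m ord0 j) <= eta else `|s m ord0 j - sb ord0 j| <= eta.
Proof.
move=> s0; pose y m : 'rV[R]_n := \row_j expR (- s m ord0 j).
have y1 m : cube 1 (y m).
  by move=> j; rewrite mxE ger0_norm ?expR_ge0// expR_le1 oppr_le0.
have [yb [cyb cl_yb]] := @cube_compact R n 1 (y @ \oo) _ (filterE _ y1).
have freq (Q : set 'rV[R]_n) M : nbhs yb Q -> exists2 m, (M <= m)%N & Q (y m).
  move=> nQ; have tail : (y @ \oo) [set y m | m in [set m | (M <= m)%N]].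
    by exists M => // m Mm; exists m.
  by have [z [[m Mm <-] Qm]] := cl_yb _ _ tail nQ; exists m.
have coordP i (Q : set R) : open Q -> Q (yb ord0 i) -> nbhs yb [set z : 'rV[R]_n | Q (z ord0 i)].
  by move=> oQ Qyb; apply: (@coord_continuous R 1 n ord0 i yb Q); exact: open_nbhs_nbhs.
have yb0 j : 0 <= yb ord0 j.
  rewrite leNgt; apply/negP => yj; have [m _] := freq _ 0%N (coordP j _ (@open_lt R 0) yj).
  by rewrite /= mxE ltNge expR_ge0.
pose J j := yb ord0 j == 0.
have ybp j : ~~ J j -> 0 < yb ord0 j by move=> nJ; rewrite lt_neqAle eq_sym nJ yb0.
exists J, (\row_j if J j then 0 else - ln (yb ord0 j)); split=> [j|eta M e0].
  rewrite mxE; case: ifP => // nJ; rewrite oppr_ge0 ln_le0//.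
  by apply: le_trans (ler_norm _) (cyb j).
have near_j j : nbhs yb [set z : 'rV[R]_n | if J j then z ord0 j <= eta
    else `|ln (yb ord0 j) - ln (z ord0 j)| <= eta].
  have [/eqP Jj|nJ] := boolP (J j).
    have := coordP j _ (@open_lt R eta); rewrite /= Jj => /(_ e0).
    by apply: filterS => z /ltW.
  have c : {for yb, continuous (fun z : 'rV[R]_n => ln (z ord0 j))}.
    apply: (@continuous_comp _ _ _ (fun z : 'rV[R]_n => z ord0 j) (@ln R)).
      exact: coord_continuous.
    exact: continuous_ln (ybp j nJ).
  by have /cvgrPdist_le/(_ _ e0) := c.
have near_all : nbhs yb [set z : 'rV[R]_n | forall j, if J j then z ord0 j <= eta
    else `|ln (yb ord0 j) - ln (z ord0 j)| <= eta] by exact: filter_forall near_j.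
have [m Mm close] := freq _ M near_all; exists m => // j.
have := close j; case: ifP => [_|nJ]; first by rewrite mxE.
by rewrite !mxE nJ expRK !opprK addrC.
Qed.

End ClusterPoint.

Section ScaledDerivatives.
Variables (R : realType) (n : nat) (A : 'I_n -> 'I_n -> nat).
Hypothesis uB : (\matrix_(j, i) (A j i)%:R : 'M[R]_n) \in unitmx.
Variables (c1 : R) (F : 'rV[R]_n -> R) (l : 'I_n -> nat).
Local Notation Omega := (@upper_box R n c1).
Local Notation chart_dir := (chart_dir R A).
Local Notation chart_coord := (@chart_coord R n A).
Local Notation cone_region := (@cone_region R n A c1).
Local Notation cone_symbol := (symbol Omega cone_region chart_dir chart_coord 1).
Local Notation level := (fun j => (l j)%:Z).
Local Notation weight_l := (weight chart_coord level).
Hypothesis symF : forall N, cone_symbol N level F.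
Implicit Types (u v p : 'rV[R]_n) (dl : 'I_n -> R) (J : pred 'I_n).

Let open_Omega : open Omega. Proof. exact: open_upper_box. Qed.
Let regionS : cone_region `<=` Omega. Proof. exact: cone_region_sub. Qed.
Let gain01 : 0 <= (1 : int) <= 1. Proof. by []. Qed.
Let coord_ge0 u k : cone_region u -> 0 <= chart_coord k u. Proof. by case. Qed.
Let coord_shift := chart_coord_shift uB.
Let region_shift := chart_region_shift (@upper_box_shift R n A c1) coord_shift.

Lemma chart_coord_comb u (s : seq 'I_n) dl j : uniq s ->
  chart_coord j (u + \sum_(k <- s) dl k *: chart_dir k) = chart_coord j u + dl j *+ (j \in s).
Proof.
elim: s u => [|k s IH] u us; first by rewrite big_nil addr0 mulr0n addr0.
move: us => /= /andP[ks us]; rewrite big_cons addrA IH// coord_shift -addrA; congr (_ + _).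
rewrite inE; have [->|jk] := eqVneq j k; last by rewrite mulr0n add0r.
by rewrite (negbTE ks) mulr0n addr0.
Qed.

Lemma chart_coordD u dl j :
  chart_coord j (u + \sum_k dl k *: chart_dir k) = chart_coord j u + dl j.
Proof. by rewrite chart_coord_comb ?index_enum_uniq// mem_index_enum. Qed.

Lemma chart_coord_inj u v : (forall j, chart_coord j u = chart_coord j v) -> u = v.
Proof.
move=> E; rewrite (chart_dir_sum uB u) (chart_dir_sum uB v).
by apply: eq_bigr => j _; rewrite E.
Qed.

Lemma cone_region_comb u (s : seq 'I_n) dl : cone_region u -> (forall j, 0 <= dl j) ->
  cone_region (u + \sum_(k <- s) dl k *: chart_dir k).
Proof.
move=> Ru dl0; elim: s u Ru => [|k s IH] u Ru; first by rewrite big_nil addr0.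
by rewrite big_cons addrA; apply: IH; exact: region_shift.
Qed.

Definition scaled_derive k u := 'D_(chart_dir k) F u / weight_l u.

Lemma scaled_deriveK k u : scaled_derive k u * weight_l u = 'D_(chart_dir k) F u.
Proof. by rewrite divfK// gt_eqF// weight_gt0. Qed.

Lemma scaled_derive_shift k j : exists2 C, 0 <= C & forall u (r : R), cone_region u -> 0 <= r ->
  `|scaled_derive k (u + r *: chart_dir j) - scaled_derive k u| <=
    C * Num.min (expR (- chart_coord j u)) r.
Proof.
have sDF N : cone_symbol N level (fun u => 'D_(chart_dir k) F u).
  exact: (symbol_derive open_Omega regionS gain01 coord_ge0 k (symF N.+1)).
have [C [C0 bD]] := symbol_bounded_ge0 (symbol_raise j (sDF 1%N)).
exists C => // u r Ru r0; have [Ou _] := Ru; have w0 := weight_gt0 chart_coord level u.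
pose K t := expR ((l j)%:~R * t) * 'D_(chart_dir k) F (u + t *: chart_dir j).
have KE t : scaled_derive k (u + t *: chart_dir j) = K t / weight_l u.
  rewrite /scaled_derive (weight_shift coord_shift) /K invfM -[(expR (- (_ * t)))^-1]expRN opprK.
  by rewrite mulrA mulrC mulrA.
have K0 : scaled_derive k u = K 0 / weight_l u by rewrite -KE scale0r addr0.
pose dK t := expR ((l j)%:~R * t) *
  weight_derive chart_dir level j (fun u => 'D_(chart_dir k) F u) (u + t *: chart_dir j).
have dKP t : 0 <= t <= r -> is_derive t 1 K (dK t).
  move=> /andP[t0 _].
  exact: (is_derive_exp_line (@upper_box_shift R n A c1) j Ou t0 (sDF 1%N)).
have dK_le t : 0 <= t <= r ->
    `|dK t| <= C * (weight_l u * expR (- chart_coord j u)) * expR (- t).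
  move=> /andP[t0 _]; rewrite normrM ger0_norm ?expR_ge0//.
  apply: le_trans (ler_wpM2l (expR_ge0 _) (bD _ (region_shift j Ru t0))) _.
  by rewrite mulrCA (weight_raise_shift coord_shift) weight_raise !mul1r mulrA.
rewrite KE K0 -mulrBl normrM [`|_^-1|]ger0_norm ?invr_ge0 ?(ltW w0)// ler_pdivrMr//.
rewrite minr_pMr// minr_pMl ?(ltW w0)// le_min; apply/andP; split.
  by rewrite -mulrA [_ * weight_l u]mulrC; exact: increment_le_expRN r0 dKP dK_le.
rewrite mulrAC -[X in _ * X]subr0; apply: (increment_le_cst r0 dKP) => t tr.
apply: le_trans (dK_le t tr) _; rewrite -!mulrA; apply: ler_wpM2l => //.
apply: ler_piMr; first exact: ltW.
by rewrite -expRD expR_le1 -opprD oppr_le0 addr_ge0 ?coord_ge0//; case/andP: tr.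
Qed.

Lemma scaled_derive_comb k : exists2 C, 0 <= C & forall u dl (b : R),
  cone_region u -> (forall j, 0 <= dl j) ->
  (forall j, Num.min (expR (- chart_coord j u)) (dl j) <= b) ->
  `|scaled_derive k (u + \sum_j dl j *: chart_dir j) - scaled_derive k u| <= C * b.
Proof.
have /choice[C CP] : forall j, exists C, 0 <= C /\ forall u (r : R), cone_region u -> 0 <= r ->
    `|scaled_derive k (u + r *: chart_dir j) - scaled_derive k u| <=
      C * Num.min (expR (- chart_coord j u)) r.
  by move=> j; have [C C0 bC] := scaled_derive_shift k j; exists C.
exists (\sum_j C j); first by apply: sumr_ge0 => j _; have [] := CP j.
move=> u dl b Ru dl0 le_b.
suff bound (s : seq 'I_n) : uniq s ->
    `|scaled_derive k (u + \sum_(j <- s) dl j *: chart_dir j) - scaled_derive k u| <=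
      \sum_(j <- s) C j * b.
  by rewrite mulr_suml; exact: (bound (index_enum 'I_n) (index_enum_uniq _)).
elim: s => [|j s IH] us; first by rewrite !big_nil addr0 subrr normr0.
move: us => /= /andP[js us]; rewrite !big_cons [dl j *: _ + _]addrC addrA.
set v := u + _; have Rv : cone_region v by exact: cone_region_comb.
rewrite -(subrKA (scaled_derive k v)); apply: le_trans (ler_normD _ _) _.
apply: lerD; last exact: IH.
have [C0 bC] := CP j; apply: le_trans (bC v (dl j) Rv (dl0 j)) _; apply: ler_wpM2l => //.
by rewrite /v chart_coord_comb// (negbTE js) mulr0n addr0.
Qed.

Lemma scaled_derive_close k : exists2 C, 0 <= C & forall u v (b : R),
  cone_region u -> cone_region v ->
  (forall j, `|chart_coord j u - chart_coord j v| <= b \/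
     expR (- chart_coord j u) <= b /\ expR (- chart_coord j v) <= b) ->
  `|scaled_derive k u - scaled_derive k v| <= C * b.
Proof.
have [C C0 comb] := scaled_derive_comb k.
exists (C + C) => [|u v b Ru Rv close]; first exact: addr_ge0.
pose sup j := Num.max (chart_coord j u) (chart_coord j v).
pose up w := w + \sum_j (sup j - chart_coord j w) *: chart_dir j.
have up_uv : up u = up v.
  by apply: chart_coord_inj => j; rewrite !chart_coordD !(addrC (chart_coord j _)) !subrK.
have up_close w : w = u \/ w = v -> `|scaled_derive k (up w) - scaled_derive k w| <= C * b.
  move=> wuv; have Rw : cone_region w by case: wuv => ->.
  apply: (comb _ _ _ Rw) => j.
    by rewrite subr_ge0 /sup le_max; case: wuv => ->; rewrite lexx ?orbT.
  rewrite ge_min; have [|[bu bv]] := close j; last by case: wuv => ->; rewrite ?bu ?bv.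
  rewrite ler_distl => /andP[lo hi]; apply/orP; right; rewrite lerBlDr ge_max.
  by case: wuv => ->; apply/andP; split; lra.
rewrite mulrDl -(subrKA (scaled_derive k (up u))); apply: le_trans (ler_normD _ _) _.
by rewrite distrC {2}up_uv; apply: lerD; apply: up_close; [left|right].
Qed.

Lemma increment_le_scaled_derive k : exists2 C, 0 <= C & forall p (h : R),
  cone_region p -> 0 <= h ->
  `|F (p + h *: chart_dir k) - F p| <= (`|scaled_derive k p| + C * h) * weight_l p * h.
Proof.
have [C C0 shift_le] := scaled_derive_shift k k; exists C => // p h Rp h0.
have along t : 0 <= t <= h -> cone_region (p + t *: chart_dir k).
  by move=> /andP[t0 _]; exact: region_shift.
have := @increment_le_cst R (fun t => F (p + t *: chart_dir k))
  (fun t => 'D_(chart_dir k) F (p + t *: chart_dir k)) 0 h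
  ((`|scaled_derive k p| + C * h) * weight_l p) h0.
rewrite scale0r addr0 subr0; apply=> t th; have [Ot _] := along t th.
  exact: is_derive_line (diff_derivable (symbol_differentiable (symF 1%N) Ot)).
rewrite -scaled_deriveK normrM (gtr0_norm (weight_gt0 _ _ _)).
case/andP: th => t0 th; apply: ler_pM; rewrite ?(ltW (weight_gt0 _ _ _))//.
  rewrite -[scaled_derive k (_ + _)](subrK (scaled_derive k p)) addrC.
  apply: le_trans (ler_normD _ _) _; rewrite lerD2l; apply: le_trans (shift_le _ _ Rp t0) _.
  by rewrite ler_wpM2l// ge_min th orbT.
rewrite (weight_shift coord_shift) ler_piMr ?(ltW (weight_gt0 _ _ _))//.
by rewrite expR_le1 oppr_le0 mulr_ge0.
Qed.

Definition face_dir J : 'rV[R]_n := \sum_(j | J j) chart_dir j.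

Lemma chart_coord_face_dir u J (r : R) j :
  chart_coord j (u + r *: face_dir J) = chart_coord j u + (if J j then r else 0).
Proof.
rewrite -(chart_coordD u (fun j => if J j then r else 0)) /face_dir scaler_sumr big_mkcond/=.
by congr (chart_coord j (u + _)); apply: eq_bigr => i _; case: (J i); rewrite ?scale0r.
Qed.

Lemma weight_face_dir u J (r : R) :
  weight_l (u + r *: face_dir J) = weight_l u * expR (- ((\sum_(j | J j) l j)%:R * r)).
Proof.
have -> : (\sum_(j | J j) l j)%:R * r = \sum_j (l j)%:R * (if J j then r else 0).
  rewrite natr_sum mulr_suml big_mkcond/=.
  by apply: eq_bigr => j _; case: (J j); rewrite ?mulr0.
rewrite /weight -expRD -opprD; congr (expR (- _)); rewrite -big_split/=.
by apply: eq_bigr => j _; rewrite chart_coord_face_dir mulrDr.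
Qed.

Lemma cone_region_face_dir u J (r : R) : cone_region u -> 0 <= r ->
  cone_region (u + r *: face_dir J).
Proof.
move=> [Ou su] r0; split=> [i|j].
  rewrite !mxE; apply: lt_le_trans (Ou i) _; rewrite lerDl mulr_ge0// summxE sumr_ge0// => j _.
  by rewrite mxE.
by rewrite chart_coord_face_dir addr_ge0//; case: ifP.
Qed.

Lemma unbounded_face (u : nat -> 'rV[R]_n) J (sb : 'rV[R]_n) :
  (forall m i, m%:R < u m ord0 i) ->
  (forall (eta : R) M, 0 < eta -> exists2 m, (M <= m)%N & forall j,
     if J j then expR (- chart_coord j (u m)) <= eta
     else `|chart_coord j (u m) - sb ord0 j| <= eta) ->
  forall i, exists2 j, J j & (0 < A j i)%N.
Proof.
move=> um close i; apply: contrapT => no.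
pose B : R := \sum_j (sb ord0 j + 1) * (A j i)%:R.
have [m Bm near_sb] := close 1 (Num.bound `|B|) ltr01.
have := um m i; rewrite ltNge => /negP; apply; rewrite (chart_coordE uB (u m) i).
apply: (@le_trans _ _ B); last first.
  apply: le_trans (ler_norm _) _; apply: le_trans (ltW (archi_boundP (normr_ge0 _))) _.
  by rewrite ler_nat.
apply: ler_sum => j _; have := near_sb j; case: ifPn => [Jj _|_].
  have -> : A j i = 0%N by apply/eqP; rewrite -leqn0 leqNgt; apply/negP => Aji; apply: no; exists j.
  by rewrite !mulr0.
by rewrite ler_distl => /andP[_ le_sb]; rewrite ler_wpM2r.
Qed.

Lemma cone_region_anchor J (sb : 'rV[R]_n) : (forall j, 0 <= sb ord0 j) ->
  (forall i, exists2 j, J j & (0 < A j i)%N) ->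
  exists2 ub, cone_region ub &
    forall j, chart_coord j ub = sb ord0 j + (if J j then `|c1| + 1 else 0).
Proof.
move=> sb0 faceJ; pose coord j := sb ord0 j + (if J j then `|c1| + 1 else 0).
have coord0 j : 0 <= coord j by rewrite addr_ge0//; case: ifP.
pose ub := 0 + \sum_j coord j *: chart_dir j.
have ubE j : chart_coord j ub = coord j by rewrite chart_coordD chart_coord0 add0r.
exists ub => //; split=> [i|j]; last by rewrite ubE.
rewrite (chart_coordE uB ub i); have [j Jj Aji] := faceJ i.
rewrite (bigD1 j)//= ubE; apply: (@lt_le_trans _ _ (coord j)).
  by rewrite /coord Jj (le_lt_trans (ler_norm _))// ltr_wpDl// ltrDl.
apply: ler_wpDr; first by apply: sumr_ge0 => k _; rewrite ubE mulr_ge0.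
by rewrite ler_peMr// ler1n.
Qed.

(* Along a subsequence some coordinates converge and the others, those in [J], tend to infinity; the
   limit of the scaled derivatives does not depend on the way they do. *)
Lemma scaled_derive_degenerate :
  (forall m : nat, exists u, [/\ cone_region u, forall i, m%:R < u ord0 i &
     forall k, `|scaled_derive k u| <= (m.+1)%:R^-1]) ->
  exists J ub, [/\ forall i, exists2 j, J j & (0 < A j i)%N, cone_region ub &
    forall k, scaled_derive k (ub + r *: face_dir J) @[r --> +oo] --> (0 : R)].
Proof.
move=> /choice[u uP].
have Ru m : cone_region (u m) by have [] := uP m.
have [|J [sb [sb0 close]]] := @nonneg_rows_cluster R n (fun m => \row_j chart_coord j (u m)).
  by move=> m j; rewrite mxE; exact: coord_ge0.
have {}close (eta : R) M : 0 < eta -> exists2 m, (M <= m)%N & forall j,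
     if J j then expR (- chart_coord j (u m)) <= eta
     else `|chart_coord j (u m) - sb ord0 j| <= eta.
  move=> /(close eta M)[m Mm near_sb]; exists m => // j.
  by have := near_sb j; rewrite mxE.
have faceJ : forall i, exists2 j, J j & (0 < A j i)%N.
  by apply: (unbounded_face _ close) => m i; have [_ um _] := uP m.
have [ub Rub ubE] := cone_region_anchor sb0 faceJ.
exists J, ub; split=> // k; apply/cvgr0Pnorm_le => e e0.
have [C C0 same] := scaled_derive_close k.
have C1 : 0 < C + 1 by rewrite ltr_wpDl.
pose eta := e / (C + 1); have eta0 : 0 < eta by rewrite divr_gt0.
have [m Mm near_sb] := close eta (Num.bound eta^-1) eta0.
have small_um : `|scaled_derive k (u m)| <= eta.
  have [_ _ /(_ k)/le_trans] := uP m; apply.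
  rewrite -[leRHS]invrK lef_pV2 ?posrE ?invr_gt0//.
  apply: le_trans (ltW (archi_boundP _)) _; first by rewrite invr_ge0 ltW.
  by rewrite ler_nat (leq_trans Mm).
have small : \forall r \near +oo, `|expR (- r)| <= eta.
  by apply: cvgr0_norm_le; [exact: cvgr_expR|].
near=> r; have r0 : 0 <= r by near: r; exact: nbhs_pinfty_ge.
rewrite -[scaled_derive k _](subrK (scaled_derive k (u m))).
apply: le_trans (ler_normD _ _) _.
rewrite -[e](divfK (lt0r_neq0 C1)) -/eta mulrC mulrDl mul1r; apply: lerD => //.
apply: same => // [|j]; first exact: cone_region_face_dir.
rewrite chart_coord_face_dir ubE; have := near_sb j; case: ifP => [Jj um_j|nJ um_j]; last first.
  by left; rewrite !addr0 distrC.
right; split=> //; apply: (@le_trans _ _ (expR (- r))).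
  by rewrite ler_expR lerN2 lerDr !addr_ge0.
by apply: le_trans (ler_norm _) _; near: r.
Unshelve. all: by end_near. Qed.

End ScaledDerivatives.

Section ChartLowerBound.
Variables (R : realType) (n : nat) (A : 'I_n -> 'I_n -> nat).
Hypothesis uB : (\matrix_(j, i) (A j i)%:R : 'M[R]_n) \in unitmx.
Variables (c1 : R) (U : set 'rV[R]_n) (f : 'rV[R]_n -> R) (l : 'I_n -> nat).
Hypothesis (oU : open U) (cU : cube (expR (- c1)) `<=` U) (smooth_f : smooth_on U f).
Hypothesis min_l : forall j, min_wdeg f (A j) (l j).
Local Notation Omega := (@upper_box R n c1).
Local Notation chart_dir := (chart_dir R A).
Local Notation chart_coord := (@chart_coord R n A).
Local Notation cone_region := (@cone_region R n A c1).
Local Notation cone_symbol := (symbol Omega cone_region chart_dir chart_coord 1).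
Local Notation weight_l := (weight chart_coord (fun j => (l j)%:Z)).
Implicit Types (u : 'rV[R]_n) (J : pred 'I_n) (a : 'I_n -> nat).

Lemma tscale_exp_coord e u (a : 'rV[nat]_n) (r : R) :
  tscale a (expR (- r)) (exp_coord e u) = exp_coord e (u + r *: nat_row R (a ord0)).
Proof. by apply/rowP => i; rewrite exp_coord_shift [LHS]mxE mulrC. Qed.

Lemma pullback_symbol_min_wdeg e : hatE U f ->
  forall N, cone_symbol N (fun j => (l j)%:Z) (pullback e f).
Proof.
move=> [_ _ _ hat]; apply: (symbol_of_decay uB) => [N|u j [Ou _]].
  exact: (pullback_symbol uB e N oU cU smooth_f).
pose a : 'rV[nat]_n := \row_i A j i.
have aE : natR R a = nat_row R (A j) by apply/rowP => i; rewrite !mxE.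
have aE' : nat_row R (a ord0) = nat_row R (A j) by apply/rowP => i; rewrite !mxE.
have Ux : U (exp_coord e u) by apply: cU; exact: exp_coord_upper_box.
have := hat _ (min_wdeg_face (min_l j)) _ Ux a (l j); rewrite aE.
move=> /(_ (min_wdeg_valid (min_l j)) erefl)[_ [v /cvgrPdist_le/(_ 1 ltr01)[d /= d0 near_v]]].
exists (`|v| + 1); near=> r; have t0 : 0 < expR (- r) := expR_gt0 _.
have td : expR (- r) < d.
  rewrite -[ltRHS]lnK ?posrE// ltr_expR ltrNl.
  by near: r; apply: nbhs_pinfty_gt; exact: num_real.
have := near_v (expR (- r)); rewrite /ball/= sub0r normrN gtr0_norm// => /(_ td t0).
rewrite tscale_exp_coord aE' -expRM_natl mulrN => close.
rewrite -ler_pdivrMr ?expR_gt0// -[expR _]gtr0_norm ?expR_gt0// -normf_div.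
by rewrite -[X in `|X|](subKr v); apply: le_trans (ler_normB _ _) _; rewrite lerD2l.
Unshelve. all: by end_near. Qed.

Lemma gam_part_poly_hyp a (l0 : nat) : (forall i, 0 < a i)%N ->
  gam_part_poly f (newton f `&` hyp (nat_row R a) l0%:R) = wdeg_part f a l0.
Proof.
move=> a0; apply/funext => x; rewrite /gam_part_poly /wdeg_part /monom_sum.
rewrite [RHS]fsbig_seq ?wdeg_multi_uniq//.
have hypE be : hyp (nat_row R a) l0%:R (natR R be) <-> be \in wdeg_multi a l0.
  rewrite mem_wdeg_multi// /hyp/= dotp_wdeg.
  by split=> [/eqP|/eqP ->]; rewrite ?eqr_nat.
apply: fsbig_widen => be [/=]; first by move=> _ /hypE.
move=> /hypE hbe off; apply/eqP; rewrite mulf_eq0; apply/orP; left.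
by apply/negPn/negP => Tbe; apply: off; split; [exact: newton_natR|].
Qed.

Lemma pd_eq0_of_pullback (g : 'rV[R]_n -> R) e u : differentiable g (exp_coord e u) ->
  (forall k, 'D_(chart_dir k) (pullback e g) u = 0) -> forall j, pd j g (exp_coord e u) = 0.
Proof.
move=> dg crit j.
pose v : 'cV[R]_n := \col_i (exp_coord e u ord0 i * pd i g (exp_coord e u)).
have Bv : (\matrix_(j, i) (A j i)%:R : 'M[R]_n) *m v = 0.
  apply/matrixP => k z; have := crit k; rewrite derive_pullback// => /eqP.
  rewrite -oppr_eq0 -sumrN => /eqP sum0; rewrite !mxE -[RHS]sum0.
  by apply: eq_bigr => i _; rewrite !mxE mulrN opprK.
have : v j ord0 = 0 by rewrite -[v](mulKmx uB) Bv mulmx0 mxE.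
by rewrite mxE => /eqP; rewrite mulf_eq0 (negbTE (exp_coord_neq0 e u j)) => /eqP.
Qed.

Variables (e : seq bool) (al0 : 'rV[nat]_n).
Hypothesis (coef_al0 : taylor_coef f al0 != 0) (wdeg_al0 : forall j, wdeg (A j) al0 = l j).
Hypothesis symF : forall N, cone_symbol N (fun j => (l j)%:Z) (pullback e f).
Local Notation scaled_derive := (scaled_derive A (pullback e f) l).

Definition face_vec J (i : 'I_n) : nat := (\sum_(j | J j) A j i)%N.
Definition face_level J : nat := (\sum_(j | J j) l j)%N.

Lemma face_dirE J : face_dir R A J = nat_row R (face_vec J).
Proof.
by apply/rowP => i; rewrite summxE mxE natr_sum; apply: eq_bigr => j _; rewrite mxE.
Qed.

Lemma min_wdeg_face_vec J : min_wdeg f (face_vec J) (face_level J).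
Proof.
have degE be : wdeg (face_vec J) be = (\sum_(j | J j) wdeg (A j) be)%N.
  by rewrite /wdeg exchange_big/=; apply: eq_bigr => i _; rewrite big_distrl.
split=> [|be Tbe]; first by exists al0 => //; rewrite degE; apply: eq_bigr.
by rewrite degE; apply: leq_sum => j _; have [_] := min_l j; exact.
Qed.

Lemma scaled_derive_small :
  ~ (exists (m : nat) (c : R), 0 < c /\ forall u, cone_region u -> (forall i, m%:R < u ord0 i) ->
       c * weight_l u ^+ 2 <= \sum_k ('D_(chart_dir k) (pullback e f) u) ^+ 2) ->
  forall m : nat, exists u, [/\ cone_region u, forall i, m%:R < u ord0 i &
    forall k, `|scaled_derive k u| <= (m.+1)%:R^-1].
Proof.
move=> unbounded m; apply: contrapT => large; apply: unbounded.
exists m, ((m.+1)%:R^-1 ^+ 2); split; first by rewrite exprn_gt0// invr_gt0 ltr0n.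
move=> u Ru um; rewrite leNgt; apply/negP => lt; apply: large; exists u; split=> // k.
have w0 := weight_gt0 chart_coord (fun j => (l j)%:Z) u.
rewrite /scaled_derive normrM [`|_^-1|]gtr0_norm ?invr_gt0// ler_pdivrMr//.
rewrite -(@ler_pXn2r _ 2)// ?nnegrE ?mulr_ge0 ?(ltW w0) ?invr_ge0//.
rewrite exprMn real_normK ?num_real//; apply: ltW; apply: le_lt_trans lt.
by rewrite (bigD1 k)//= lerDl; apply: sumr_ge0 => i _; rewrite sqr_ge0.
Qed.

Lemma derive_wdeg_part_eq0 J ub k : (forall i, exists2 j, J j & (0 < A j i)%N) ->
  cone_region ub -> scaled_derive k (ub + r *: face_dir R A J) @[r --> +oo] --> (0 : R) ->
  'D_(chart_dir k) (pullback e (wdeg_part f (face_vec J) (face_level J))) ub = 0.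
Proof.
move=> faceJ Rub psi0; pose l0 := face_level J; pose W := weight_l ub.
pose p r := ub + r *: face_dir R A J.
pose G := pullback e (wdeg_part f (face_vec J) l0).
have a0 i : (0 < face_vec J i)%N.
  by have [j Jj Aji] := faceJ i; rewrite /face_vec (bigD1 j)//= ltn_addr.
have [C C0 incr] := increment_le_scaled_derive uB symF k.
have limG v : expR (l0%:R * r) * pullback e f (v + r *: face_dir R A J) @[r --> +oo] --> G v.
  rewrite face_dirE; have [_ le_l0] := min_wdeg_face_vec J.
  exact: (taylor_scaling_cvg (expR_gt0 (- c1)) oU cU smooth_f a0 le_l0).
have quad h : 0 <= h -> `|G (ub + h *: chart_dir k) - G ub| <= W * C * h ^+ 2.
  move=> h0; pose Gr r v := expR (l0%:R * r) * pullback e f (v + r *: face_dir R A J).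
  have lim_norm : `|Gr r (ub + h *: chart_dir k) - Gr r ub| @[r --> +oo] -->
      `|G (ub + h *: chart_dir k) - G ub|.
    by apply: cvg_norm; apply: cvgB; exact: limG.
  have lim_bound : (`|scaled_derive k (p r)| + C * h) * W * h @[r --> +oo] -->
      (`|0 : R| + C * h) * W * h.
    apply: cvgM; last exact: cvg_cst.
    apply: cvgM; last exact: cvg_cst.
    by apply: cvgD; [exact: cvg_norm|exact: cvg_cst].
  have -> : W * C * h ^+ 2 = (`|0 : R| + C * h) * W * h by rewrite normr0 add0r; ring.
  apply: (ler_cvg_to lim_norm lim_bound); near=> r.
  have r0 : 0 <= r by near: r; exact: nbhs_pinfty_ge.
  rewrite /Gr -mulrBr normrM ger0_norm ?expR_ge0// addrAC.
  have Rp := cone_region_face_dir uB J Rub r0.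
  apply: le_trans (ler_wpM2l (expR_ge0 _) (incr _ _ Rp h0)) _.
  rewrite (weight_face_dir uB) -/l0 -/W -/(p r); set x := expR _; set y := expR _.
  rewrite (_ : x * _ = x * y * ((`|scaled_derive k (p r)| + C * h) * W * h)); last by ring.
  by rewrite expRxMexpNx_1 mul1r.
have dG : differentiable G ub.
  apply: differentiable_pullback.
  by apply: smooth_on_differentiable openT _ I; exact: smooth_on_monom_sum.
have {}dG := (is_derive_lineP _ _ _ _).1 (differentiable_is_derive (chart_dir k) dG).
apply: (derive_eq0_quadratic (C := W * C) dG); near=> h.
by rewrite scale0r addr0 quad// ltW.
Unshelve. all: by end_near. Qed.

Lemma chart_lower_bound : (0 < n)%N -> nondeg_over_R U f -> exists (m : nat) (c : R), 0 < c /\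
  forall u, cone_region u -> (forall i, m%:R < u ord0 i) ->
    c * weight_l u ^+ 2 <= \sum_k ('D_(chart_dir k) (pullback e f) u) ^+ 2.
Proof.
move=> n0 nondeg; apply: contrapT => /scaled_derive_small/(scaled_derive_degenerate uB symF).
move=> [J [ub [faceJ Rub psi0]]].
have a0 i : (0 < face_vec J i)%N.
  by have [j Jj Aji] := faceJ i; rewrite /face_vec (bigD1 j)//= ltn_addr.
have Ux : U (exp_coord e ub) by apply: cU; apply: exp_coord_upper_box; case: Rub.
have compact_gam := min_wdeg_compact_face a0 (min_wdeg_face_vec J).
have [j] := nondeg _ compact_gam _ Ux (fun i => exp_coord_neq0 e ub i).
rewrite gam_part_poly_hyp// => /eqP; apply; apply: pd_eq0_of_pullback => [|k].
  by apply: smooth_on_differentiable openT _ I; exact: smooth_on_monom_sum.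
exact: derive_wdeg_part_eq0.
Qed.

End ChartLowerBound.

(** * Partition of unity *)

Section BoundedSmooth.
Variable R : realType.
Implicit Types (phi : R -> R) (p : {poly R}).

Definition bounded_smooth phi := exists2 D : set (R -> R), D phi & forall psi, D psi ->
  (exists C, forall x, `|psi x| <= C) /\
  exists2 dpsi, D dpsi & forall x : R, is_derive x 1 psi (dpsi x).

Lemma bounded_smooth_trig : bounded_smooth (@cos R) /\ bounded_smooth (@sin R).
Proof.
pose D : set (R -> R) := [set psi | exists a b, psi = (fun x => a * cos x + b * sin x)].
have closed psi : D psi -> (exists C, forall x, `|psi x| <= C) /\
    exists2 dpsi, D dpsi & forall x : R, is_derive x 1 psi (dpsi x).
  move=> [a [b ->]]; split.
    exists (`|a| + `|b|) => x; apply: le_trans (ler_normD _ _) _; rewrite !normrM.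
    by apply: lerD; rewrite ler_piMr// ler_norml ?cos_geN1 ?cos_le1 ?sin_geN1 ?sin_le1.
  exists (fun x => b * cos x - a * sin x); first by exists b, (- a); apply/funext => x; ring.
  move=> x; apply: (is_derive_eq (is_derive_add (is_derive_scale a (is_derive_cos x))
    (is_derive_scale b (is_derive_sin x)))).
  by ring.
split; exists D => //; [exists 1, 0|exists 0, 1]; apply/funext => x; ring.
Qed.

(* The derivatives of [exp (- 1 / x)], extended by [0], are the functions of this form. *)
Definition flatexp p (x : R) : R := if 0 < x then p.[x^-1] * expR (- x^-1) else 0.

Lemma flatexp_bounded p : exists C, forall x, `|flatexp p x| <= C.
Proof.
have [C bp] := horner_le_expR p (ltr01 : 0 < 1 :> R); exists `|C| => x.
rewrite /flatexp; case: ifP => x0; last by rewrite normr0.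
rewrite normrM [`|expR _|]ger0_norm ?expR_ge0// expRN ler_pdivrMr ?expR_gt0//.
apply: le_trans (bp _ _) _; first by rewrite invr_ge0 ltW.
by rewrite mul1r ler_wpM2r ?expR_ge0// ler_norm.
Qed.

Lemma is_derive_flatexp p (x : R) : is_derive x 1 (flatexp p) (flatexp ('X^2 * (p - p^`()%R)) x).
Proof.
have [x0|x0|->] := ltgtP x 0.
- rewrite [X in is_derive _ _ _ X]/flatexp ltNge (ltW x0)/=.
  apply: (near_eq_is_derive _ (is_derive_const (0 : R) x 1)); near=> y.
  by rewrite /flatexp ltNge ltW//; near: y; exact: lt_nbhsl.
- have Di := is_derive_inv (lt0r_neq0 x0) (is_derive_id x 1).
  have De := is_derive_comp (F := expR) (h := fun y : R => - y^-1)
    (is_derive_expR _) (is_derive_opp Di).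
  have Dp := is_derive_comp (F := horner p) (h := fun y : R => y^-1)
    (is_derive_poly p x^-1) Di.
  have D : is_derive x 1 (fun y : R => p.[y^-1] * expR (- y^-1))
      (flatexp ('X^2 * (p - p^`()%R)) x).
    apply: (is_derive_eq (is_derive_mul Dp De)).
    by rewrite /flatexp x0 hornerM hornerXn hornerD hornerN; field; rewrite gt_eqF.
  apply: (near_eq_is_derive _ D); near=> y; rewrite /flatexp ifT//.
  by near: y; exact: lt_nbhsr.
have flatexp0 q : flatexp q 0 = 0 by rewrite /flatexp ltxx.
have [C bC] := flatexp_bounded ('X^2 * p).
rewrite flatexp0; apply: (@is_derive_quadratic R _ _ _ C) => r.
rewrite add0r flatexp0 subr0 mulr0 subr0.
have -> : flatexp p r = flatexp ('X^2 * p) r * r ^+ 2.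
  rewrite /flatexp; case: ifP => r0; last by rewrite mul0r.
  by rewrite hornerM hornerXn; field; rewrite gt_eqF.
by rewrite normrM [`|r ^+ 2|]ger0_norm ?sqr_ge0// ler_wpM2r// sqr_ge0.
Unshelve. all: by end_near. Qed.

Lemma bounded_smooth_flatexp p : bounded_smooth (flatexp p).
Proof.
exists [set flatexp q | q in setT] => [|_ [q _ <-]]; first by exists p.
split; first exact: flatexp_bounded.
exists (flatexp ('X^2 * (q - q^`()%R))); last exact: is_derive_flatexp.
by exists ('X^2 * (q - q^`()%R)).
Qed.

Lemma flatexp1_ge0 x : 0 <= flatexp 1 x.
Proof. by rewrite /flatexp hornerC mul1r; case: ifP; rewrite ?expR_ge0. Qed.

Definition smoothstep (x : R) : R := flatexp 1 (x + 1) * (flatexp 1 (x + 1) + flatexp 1 (- x))^-1.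

Lemma smoothstep_denominator x : expR (- 2) <= flatexp 1 (x + 1) + flatexp 1 (- x).
Proof.
have half (y : R) : 2^-1 <= y -> expR (- 2) <= flatexp 1 y.
  move=> hy; have y0 : 0 < y by apply: lt_le_trans hy; rewrite invr_gt0.
  by rewrite /flatexp y0 hornerC mul1r ler_expR lerN2 -[leRHS]invrK lef_pV2// posrE invr_gt0.
have [hx|hx] := leP (- 2^-1) x.
  by apply: ler_wpDr; [exact: flatexp1_ge0|apply: half; lra].
by apply: ler_wpDl; [exact: flatexp1_ge0|apply: half; rewrite lerNr ltW].
Qed.

Lemma smoothstep_ge0 x : 0 <= smoothstep x.
Proof. by rewrite mulr_ge0 ?flatexp1_ge0// invr_ge0 addr_ge0// flatexp1_ge0. Qed.

Lemma smoothstep1 x : 0 <= x -> smoothstep x = 1.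
Proof.
move=> x0; have := smoothstep_denominator x; rewrite /smoothstep.
have -> : flatexp 1 (- x) = 0 by rewrite /flatexp ltNge oppr_le0 x0.
rewrite addr0 => denom; rewrite divff// gt_eqF//; apply: lt_le_trans denom; exact: expR_gt0.
Qed.

Lemma smoothstep0 x : x <= - 1 -> smoothstep x = 0.
Proof.
by move=> x0; rewrite /smoothstep {1}/flatexp ltNge -lerBrDr sub0r x0/= mul0r.
Qed.

Lemma smoothstep_near x : x < - 1 \/ 0 < x ->
  \forall r \near (0 : R), smoothstep (x + r) = smoothstep x.
Proof.
have near_addr (O : set R) : open O -> O x -> \forall r \near (0 : R), O (x + r).
  move=> oO Ox; have cx : x + r @[r --> (0 : R)] --> x + 0.
    by apply: cvgD; [exact: cvg_cst|exact: cvg_id].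
  by apply: cx; rewrite addr0; exact: open_nbhs_nbhs.
move=> [x1|x0].
  apply: filterS (near_addr _ (@open_lt _ _) x1) => r /= xr1.
  by rewrite !smoothstep0// ltW.
apply: filterS (near_addr _ (@open_gt _ _) x0) => r /= xr0.
by rewrite !smoothstep1// ltW.
Qed.

End BoundedSmooth.

Section DirectionalInvariance.
Variables (R : realType) (V : normedModType R).

Lemma near_line (W : set V) (u v : V) : nbhs u W -> \forall r \near (0 : R), W (u + r *: v).
Proof.
have cl : u + r *: v @[r --> (0 : R)] --> u + 0 *: v.
  by apply: cvgD; [exact: cvg_cst|apply: cvgZr_tmp; exact: cvg_id].
by move=> nW; apply: cl; rewrite scale0r addr0.
Qed.

Lemma derive_near_cst (h : V -> R) (u v : V) :
  (\forall r \near (0 : R), h (u + r *: v) = h u) -> 'D_v h u = 0.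
Proof.
move=> near_cst; apply: derive_val; apply/is_derive_lineP.
apply: (near_eq_is_derive _ (is_derive_const (h u) (0 : R) 1)).
by apply: filterS near_cst.
Qed.

End DirectionalInvariance.

Section SymbolConstructions.
Variables (R : realType) (n : nat) (Omega region : set 'rV[R]_n).
Variables (d : 'I_n -> 'rV[R]_n) (s : 'I_n -> 'rV[R]_n -> R).
Hypothesis (open_Omega : open Omega) (regionS : region `<=` Omega).
Implicit Types (F h : 'rV[R]_n -> R) (nu : 'I_n -> int).

Lemma symbol_comp (g : int) (phi : R -> R) F : bounded_smooth phi ->
  (forall u, Omega u -> differentiable F u) ->
  (forall N j, symbol Omega region d s g N (raise g (fun=> 0) j) (fun u => 'D_(d j) F u)) ->
  forall N, symbol Omega region d s g N (fun=> 0) (fun u => phi (F u)).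
Proof.
move=> [D Dphi closedD] dF sDF N.
have dcomp psi u : D psi -> Omega u -> differentiable (fun u => psi (F u)) u.
  move=> /closedD[_ [dpsi _ psiD]] Ou; apply: differentiable_compR (dF u Ou).
  by have [] := psiD (F u).
elim: N phi Dphi => [|N IH] phi Dphi; have [[C bphi] [dphi Ddphi phiD]] := closedD phi Dphi.
  split=> [u Ou||//]; first exact/differentiable_continuous/dcomp.
  by exists C => u _; rewrite weight0 mulr1.
apply: symbolS => [u||j]; [exact: dcomp|by exists C => u _; rewrite weight0 mulr1|].
have := symbolM open_Omega regionS (IH _ Ddphi) (sDF N j).
rewrite (_ : (fun i => 0 + _) = raise g (fun=> 0) j); last by apply/funext => i; rewrite add0r.
apply: (eq_symbol open_Omega regionS) => u Ou; rewrite /weight_derive mul0r addr0; symmetry.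
apply: derive_val; apply: (is_derive_comp (F := phi)).
exact: differentiable_is_derive (dF u Ou).
Qed.

Local Notation flat_symbol := (symbol Omega region d s 0).
Local Notation graded_symbol := (symbol Omega region d s 1).

Lemma symbol_comp_graded (phi : R -> R) F : bounded_smooth phi ->
  (forall N, graded_symbol N (fun=> 0) F) ->
  forall N, graded_symbol N (fun=> 0) (fun u => phi (F u)).
Proof.
move=> bphi sF; apply: (symbol_comp bphi) => [u|N j].
  exact: symbol_differentiable (sF 1%N).
apply: (eq_symbol open_Omega regionS) (symbol_raise j (sF N.+1)) => u _.
by rewrite /weight_derive mul0r addr0.
Qed.

Lemma flatexp_symbol N p v (c : R) :
  flat_symbol N (fun=> 0) (fun u => flatexp p (dotp v u + c)).
Proof.
have Daff u w : is_derive u w (fun u => dotp v u + c) (dotp v w).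
  by have := is_derive_add (is_derive_dotp v u w) (is_derive_const c u w); rewrite addr0.
apply: (symbol_comp (F := fun u => dotp v u + c) (bounded_smooth_flatexp p)) => [u _|N' j].
  by apply: differentiable_add; [exact: differentiable_dotp|exact: differentiable_cst].
rewrite (_ : raise _ _ _ = fun=> 0); last by apply/funext => i; rewrite /raise mul0rn addr0.
apply: (eq_symbol open_Omega regionS) (symbol_cst d s 0 open_Omega regionS N' (dotp v (d j))).
by move=> u _; rewrite derive_val.
Qed.

Lemma smoothstep_symbol N v : flat_symbol N (fun=> 0) (fun u => smoothstep (dotp v u)).
Proof.
have num := flatexp_symbol N 1 v 1.
have opp : flat_symbol N (fun=> 0) (fun u => flatexp 1 (- dotp v u)).
  apply: (eq_symbol open_Omega regionS) (flatexp_symbol N 1 (- v) 0) => u _.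
  by rewrite dotpNl addr0.
have denom := symbolD open_Omega regionS num opp.
have inv := symbolV open_Omega regionS (expR_gt0 (- 2 : R)) _ _ denom.
apply: (@eq_symbol_weight _ _ _ _ _ _ _ _ (fun k => 0 + - 0)) => [k|]; first by rewrite subr0.
apply: (symbolM open_Omega regionS num); apply: inv => u _.
  by rewrite weight0 mulr1; apply: le_trans (smoothstep_denominator _) (ler_norm _).
by rewrite gt_eqF//; apply: lt_le_trans (smoothstep_denominator _); exact: expR_gt0.
Qed.

Lemma flat_symbol_prod N (I : eqType) (r : seq I) (h : I -> 'rV[R]_n -> R) :
  (forall i, i \in r -> flat_symbol N (fun=> 0) (h i)) ->
  flat_symbol N (fun=> 0) (fun u => \prod_(i <- r) h i u).
Proof.
elim: r => [|i r IH] sh.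
  apply: (eq_symbol open_Omega regionS) (symbol_cst d s 0 open_Omega regionS N 1) => u _.
  by rewrite big_nil.
apply: (eq_symbol open_Omega regionS (h := fun u => h i u * \prod_(i <- r) h i u)).
  by move=> u _; rewrite big_cons.
apply: (@eq_symbol_weight _ _ _ _ _ _ _ _ (fun k => 0 + 0)) => //.
apply: (symbolM open_Omega regionS); first by apply: sh; rewrite mem_head.
by apply: IH => k kr; apply: sh; rewrite inE kr orbT.
Qed.

Variables (O : set 'rV[R]_n) (depth : R).
Hypothesis (open_O : open O) (region_O : region `<=` O) (O_Omega : O `<=` Omega).
Hypothesis (coord_ge0 : forall u k, region u -> 0 <= s k u).
Hypothesis (coord_continuous : forall k, continuous (s k)).

Lemma weight_bounded_shallow (Z : pred 'I_n) h nu : weight_bounded region s (fun=> 0) h ->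
  (forall u k, O u -> Z k -> depth < s k u -> h u = 0) ->
  (forall k, ~~ Z k -> nu k = 0) -> (forall k, 0 <= nu k) -> weight_bounded region s nu h.
Proof.
move=> [C bh] deep0 nuZ nu0; pose W := expR (\sum_k (nu k)%:~R * depth).
exists (`|C| * W) => u Ru.
have [[k /andP[Zk sk]]|shallow] := pselect (exists k, Z k && (depth < s k u)).
  rewrite (deep0 u k) ?normr0 ?mulr_ge0 ?expR_ge0//; exact: region_O.
have := bh u Ru; rewrite weight0 mulr1 => /le_trans; apply.
rewrite -mulrA; apply: le_trans (ler_norm _) _; apply: ler_peMr => //.
rewrite /weight -expRD; apply: le_trans (expR_ge1Dx _); rewrite lerDl subr_ge0.
apply: ler_sum => k _; have [Zk|nZ] := boolP (Z k); last by rewrite nuZ// !mul0r.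
rewrite ler_wpM2l ?ler0z// leNgt; apply/negP => sk; apply: shallow; exists k.
by rewrite Zk sk.
Qed.

(* Where the coordinate [s k] is large the function is constant along [d k]; on the rest of the
   region every weight supported on [Z] is bounded below. *)
Lemma locally_constant_symbol N (Z : pred 'I_n) h nu :
  (forall N, flat_symbol N (fun=> 0) h) ->
  (forall u k, O u -> Z k -> depth < s k u -> h u = 0) ->
  (forall u k, O u -> depth < s k u -> 'D_(d k) h u = 0) ->
  (forall k, ~~ Z k -> nu k = 0) -> (forall k, 0 <= nu k) -> graded_symbol N nu h.
Proof.
elim: N Z h nu => [|N IH] Z h nu sh deep0 deepD nuZ nu0;
  have bh := weight_bounded_shallow (symbol_bounded (sh 0%N)) deep0 nuZ nu0.
  by split=> // u; exact: symbol_continuous (sh 0%N).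
have open_deep k : open (O `&` [set u | depth < s k u]).
  apply: openI => //; apply: (@open_comp _ _ (s k) [set z | depth < z]); last exact: open_gt.
  by move=> x _; exact: coord_continuous.
have gain00 : 0 <= (0 : int) <= 1 by [].
apply: symbolS => [u||j]; [exact: symbol_differentiable (sh 1%N)|exact: bh|].
have sD N' : flat_symbol N' (fun=> 0) (fun u => 'D_(d j) h u).
  exact: (symbol_derive open_Omega regionS gain00 coord_ge0 j (sh N'.+1)).
have deepDD u k : O u -> depth < s k u -> 'D_(d k) ('D_(d j) h) u = 0.
  move=> Ou sk; rewrite (symbol_derive_comm open_Omega regionS gain00 coord_ge0 k j (sh 3%N)).
    by apply: (derive_eq0 _ (open_deep k)) => // x [Ox sx]; exact: deepD.
  exact: O_Omega.
have deepD0 u k : O u -> Z k -> depth < s k u -> 'D_(d j) h u = 0.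
  by move=> Ou Zk sk; apply: (derive_eq0 _ (open_deep k)) => // x [Ox sx]; exact: deep0 sx.
have raise0 k : 0 <= raise 1 nu j k by rewrite addr_ge0// mulrn_wge0.
have [Zj|nZj] := boolP (Z j).
  have raiseZ k : ~~ Z k -> raise 1 nu j k = 0.
    by move=> nZ; rewrite raise_other ?nuZ//; apply: contra nZ => /eqP ->.
  apply: (symbolD open_Omega regionS); first exact: (IH Z).
  by apply: (symbolZ open_Omega regionS); exact: (IH Z).
apply: (eq_symbol open_Omega regionS (h := fun u => 'D_(d j) h u)).
  by move=> u _; rewrite /weight_derive nuZ// mul0r addr0.
apply: (IH [pred k | Z k || (k == j)]) => // [u k Ou /= /orP[Zk|/eqP ->]|k /=].
- exact: deepD0.
- exact: deepD.
by rewrite negb_or => /andP[nZ kj]; rewrite raise_other ?nuZ.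
Qed.

End SymbolConstructions.

Section Partition.
Variables (R : realType) (n : nat) (P : set 'rV[R]_n) (Sig : seq (seq 'rV[int]_n)).
Hypothesis ss : simplicial_subdivision P Sig.
Variable c1 : R.
Hypothesis c10 : 0 <= c1.
Implicit Types (S T X : seq 'rV[int]_n) (u : 'rV[R]_n) (K : R).
Local Notation Omega := (@upper_box R n c1).
Local Notation chart := (chart Sig).
Local Notation chart_dir S := (chart_dir R (gens S)).
Local Notation chart_coord S := (@chart_coord R n (gens S)).
Local Notation cone_region S := (@cone_region R n (gens S) c1).
Local Notation chart_symbol S := (symbol Omega (cone_region S) (chart_dir S) (chart_coord S)).

Let open_Omega : open Omega. Proof. exact: open_upper_box. Qed.
Let regionS S : cone_region S `<=` Omega. Proof. exact: cone_region_sub. Qed.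
Let coord_ge0 S u k : cone_region S u -> 0 <= chart_coord S k u. Proof. by case. Qed.

Definition charts := [seq S <- Sig | size S == n].

Lemma mem_charts S : (S \in charts) = chart S.
Proof. by rewrite mem_filter andbC. Qed.

Definition cone_cutoff S u := \prod_(j <- index_enum 'I_n) smoothstep (chart_coord S j u).
Definition cutoff_sum u := \sum_(S <- charts) cone_cutoff S u.
Definition part_of_unity S u := cone_cutoff S u * (cutoff_sum u)^-1.

Lemma cone_cutoff_ge0 S u : 0 <= cone_cutoff S u.
Proof. by apply: prodr_ge0 => j _; exact: smoothstep_ge0. Qed.

Lemma cone_cutoff_eq0 S u j : chart_coord S j u <= - 1 -> cone_cutoff S u = 0.
Proof.
move=> uj; rewrite /cone_cutoff (bigD1_seq j) ?mem_index_enum ?index_enum_uniq//=.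
by rewrite smoothstep0// mul0r.
Qed.

Lemma upper_box_chart u : Omega u -> exists2 S, chart S & cone_region S u.
Proof.
move=> Ou; have [|S cS Su] := charts_cover ss (u := u).
  by move=> i; apply: le_lt_trans c10 (Ou i).
by exists S => //; split=> // j; exact: (gcone_coord_ge0 ss).
Qed.

Lemma cutoff_sum_ge1 u : Omega u -> 1 <= cutoff_sum u.
Proof.
move=> /upper_box_chart[S cS [Ou Su]]; rewrite /cutoff_sum.
have SC : S \in charts by rewrite mem_charts.
rewrite (perm_big _ (perm_to_rem SC)) big_cons/=; apply: ler_wpDr.
  by apply: sumr_ge0 => T _; exact: cone_cutoff_ge0.
by rewrite /cone_cutoff big1_seq// => j _; rewrite smoothstep1.
Qed.

Lemma part_of_unity_sum u : Omega u -> \sum_(S <- charts) part_of_unity S u = 1.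
Proof.
move=> Ou; rewrite /part_of_unity -mulr_suml divff// gt_eqF//.
exact: lt_le_trans ltr01 (cutoff_sum_ge1 Ou).
Qed.

Lemma mem_gens T (a : 'rV[int]_n) : chart T -> a \in T -> exists i : 'I_n, a = nth 0 T i.
Proof.
move=> /andP[_ /eqP sz] /(nthP 0)[i iT <-].
by exists (Ordinal (leq_trans iT (eq_leq sz))).
Qed.

Lemma gens_mem T (i : 'I_n) : chart T -> nth 0 T i \in T.
Proof. by move=> /andP[_ /eqP sz]; apply: mem_nth; rewrite sz. Qed.

Lemma gens_inj T (i j : 'I_n) : chart T -> nth 0 T i = nth 0 T j -> i = j.
Proof.
move=> cT E; have := chart_coord_gen ss i j cT; rewrite -E (chart_coord_gen ss)// eqxx.
by case: eqVneq => // _ /eqP; rewrite oner_eq0.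
Qed.

Definition separates S T (k : 'I_n) K := forall u,
  (forall j, - 1 <= chart_coord S j u) -> (forall j, - 1 <= chart_coord T j u) ->
  (nth 0 S k \notin T -> chart_coord S k u <= K) /\
  (forall i : 'I_n, nth 0 S k = nth 0 T i -> chart_coord S k u - chart_coord T i u <= K).

Lemma separatesW S T k K K' : K <= K' -> separates S T k K -> separates S T k K'.
Proof.
move=> KK' sepK u Su Tu; have [notin_le shared_le] := sepK u Su Tu.
by split=> [kT|i E]; [exact: le_trans (notin_le kT) KK'|exact: le_trans (shared_le i E) KK'].
Qed.

Lemma separation S T (k : 'I_n) : chart S -> chart T -> exists K, separates S T k K.
Proof.
move=> cS cT; have [kT|kT] := boolP (nth 0 S k \in T).
  have [i E] := mem_gens cT kT.
  have [|K [K0 bound]] :=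
      cone_functional_bound ss (b := chart_covec R S k - chart_covec R T i) cS cT.
    move=> u Su Tu; rewrite dotpBl -!chart_coord_dotp subr_le0.
    by rewrite (shared_coord ss cS cT Su Tu E).
  exists K => u Su Tu; split=> [|i' E']; first by rewrite kT.
  have <- : i = i' by apply: (gens_inj cT); rewrite -E -E'.
  by have := bound u Su Tu; rewrite dotpBl -!chart_coord_dotp.
have [|K [K0 bound]] := cone_functional_bound ss (b := chart_covec R S k) cS cT.
  move=> u Su Tu; rewrite -chart_coord_dotp leNgt; apply/negP => pos.
  by have [j E] := shared_gen ss cS cT Su Tu pos; move: kT; rewrite E gens_mem.
exists K => u Su Tu; split=> [_|i E]; last by move: kT; rewrite E gens_mem.
by have := bound u Su Tu; rewrite -chart_coord_dotp.
Qed.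

Lemma uniform_separation S : chart S ->
  exists2 K, 0 <= K & forall T k, T \in charts -> separates S T k K.
Proof.
move=> cS; have near_sep T : T \in charts -> \forall K \near +oo, forall k, separates S T k K.
  rewrite mem_charts => cT; apply: filter_forall => k; have [K sepK] := separation k cS cT.
  by near=> K'; apply: separatesW sepK; near: K'; apply: nbhs_pinfty_ge; exact: num_real.
have near_all := near_all_seq proper_pinfty_nbhs near_sep.
have [K [K0 sepK]] := filter_ex (filterI (nbhs_pinfty_ge (num_real (0 : R))) near_all).
by exists K => // T k /sepK.
Unshelve. all: by end_near. Qed.

Lemma chart_coord_continuous S k : continuous (chart_coord S k).
Proof.
rewrite (_ : chart_coord S k = dotp (chart_covec R S k)); first exact: dotp_continuous.
by apply/funext => u; rewrite chart_coord_dotp.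
Qed.

Definition chart_nbhd S : set 'rV[R]_n := Omega `&` [set u | forall k, - 1 < chart_coord S k u].

Lemma open_chart_nbhd S : open (chart_nbhd S).
Proof.
apply: openI => //; rewrite openE => u Su; rewrite /interior/=.
have near_k k : nbhs u [set v | - 1 < chart_coord S k v].
  apply: (@chart_coord_continuous S k u [set z | - 1 < z]).
  by apply: open_nbhs_nbhs; split; [exact: open_gt|exact: Su].
exact: filter_forall near_k.
Qed.

Lemma cone_cutoff_symbol S X N : chart_symbol S 0 N (fun=> 0) (cone_cutoff X).
Proof.
apply: (flat_symbol_prod open_Omega (@regionS S)) => j _.
have step := smoothstep_symbol (chart_dir S) (chart_coord S) open_Omega (@regionS S) N
  (chart_covec R X j).
by apply: (eq_symbol open_Omega (@regionS S)) step => u _; rewrite chart_coord_dotp.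
Qed.

Lemma part_of_unity_flat S T N : chart_symbol S 0 N (fun=> 0) (part_of_unity T).
Proof.
apply: (@eq_symbol_weight _ _ _ _ _ _ _ _ (fun k => 0 + - 0)) => [k|]; first by rewrite subr0.
apply: (symbolM open_Omega (@regionS S)); first exact: cone_cutoff_symbol.
apply: (symbolV open_Omega (@regionS S) ltr01) => [u [Ou _]|u Ou|].
- by rewrite weight0 mul1r; apply: le_trans (ler_norm _); exact: cutoff_sum_ge1.
- by rewrite gt_eqF//; apply: lt_le_trans ltr01 (cutoff_sum_ge1 Ou).
- by apply: (symbol_sum open_Omega (@regionS S)) => X _; exact: cone_cutoff_symbol.
Qed.

Lemma cone_cutoff_deep S X u (k : 'I_n) K : separates S X k K -> chart_nbhd S u ->
  K < chart_coord S k u -> nth 0 S k \notin X -> cone_cutoff X u = 0.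
Proof.
move=> sepK [_ Su] ku kX.
have [Xu|] := pselect (forall j, - 1 <= chart_coord X j u); last first.
  by move=> /asboolPn/existsp_asboolPn[j /negP]; rewrite -ltNge => /ltW; exact: cone_cutoff_eq0.
have [|/(_ kX) le_K _] := sepK u _ Xu; first by move=> j; exact: ltW.
by have := lt_le_trans ku le_K; rewrite ltxx.
Qed.

Lemma cone_cutoff_near_cst S X u (k : 'I_n) K : chart S -> chart X -> 0 <= K ->
  separates S X k K -> chart_nbhd S u -> K < chart_coord S k u ->
  \forall r \near (0 : R), cone_cutoff X (u + r *: chart_dir S k) = cone_cutoff X u.
Proof.
move=> cS cX K0 sepK Su ku.
have [kX|kX] := boolP (nth 0 S k \in X); last first.
  have open_deep : open (chart_nbhd S `&` [set u | K < chart_coord S k u]).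
    apply: openI (@open_chart_nbhd S) _.
    apply: (@open_comp _ _ (chart_coord S k) [set z | K < z]); last exact: open_gt.
    by move=> x _; exact: chart_coord_continuous.
  have := near_line (chart_dir S k) (open_nbhs_nbhs (conj open_deep (conj Su ku))).
  apply: filterS => r [Sr kr].
  by rewrite (cone_cutoff_deep sepK Su)// (cone_cutoff_deep sepK Sr).
have [i E] := mem_gens cX kX.
have line (r : R) : cone_cutoff X (u + r *: chart_dir S k) =
    smoothstep (chart_coord X i u + r) * \prod_(j | j != i) smoothstep (chart_coord X j u).
  rewrite (chart_dir_gens ss)// E -(chart_dir_gens ss)// /cone_cutoff (bigD1 i)//=.
  rewrite (chart_coord_shift (chart_unit ss cX)) eqxx; congr (_ * _).
  apply: eq_bigr => j /negbTE ji.
  by rewrite (chart_coord_shift (chart_unit ss cX)) ji addr0.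
have line0 := line 0; rewrite scale0r !addr0 in line0.
have [[j /andP[ji uj]]|no] := pselect (exists j, (j != i) && (chart_coord X j u <= - 1)).
  by apply: filterE => r; rewrite line line0 (bigD1 j)//= (smoothstep0 uj) mul0r !mulr0.
have [ui|ui] := ltP (chart_coord X i u) (- 1).
  by apply: filterS (smoothstep_near (or_introl ui)) => r stepE; rewrite line line0 stepE.
have Xu j : - 1 <= chart_coord X j u.
  have [->//|ji] := eqVneq j i; rewrite leNgt; apply/negP => uj; apply: no.
  by exists j; rewrite ji ltW.
have ui0 : 0 < chart_coord X i u.
  have [|_ /(_ i E)] := sepK u _ Xu; first by case: Su => _ Su j; exact: ltW.
  by move: ku; lra.
by apply: filterS (smoothstep_near (or_intror ui0)) => r stepE; rewrite line line0 stepE.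
Qed.

Lemma derive_part_of_unity_deep S T u (k : 'I_n) K : chart S -> chart T -> 0 <= K ->
  (forall X, X \in charts -> separates S X k K) -> chart_nbhd S u -> K < chart_coord S k u ->
  'D_(chart_dir S k) (part_of_unity T) u = 0.
Proof.
move=> cS cT K0 sepK Su ku; apply: derive_near_cst.
have near_cst X : X \in charts ->
    \forall r \near (0 : R), cone_cutoff X (u + r *: chart_dir S k) = cone_cutoff X u.
  move=> XC; have cX : chart X by rewrite -mem_charts.
  exact: cone_cutoff_near_cst cS cX K0 (sepK X XC) Su ku.
apply: filterS (near_all_seq (nbhs_filter (0 : R)) near_cst) => r cst.
rewrite /part_of_unity cst ?mem_charts//; congr (_ * _^-1).
by apply: eq_big_seq => X; exact: cst.
Qed.

Lemma part_of_unity_symbol S T N (nu : 'I_n -> int) : chart S -> chart T ->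
  (forall k : 'I_n, nth 0 S k \in T -> nu k = 0) -> (forall k, 0 <= nu k) ->
  chart_symbol S 1 N nu (part_of_unity T).
Proof.
move=> cS cT nuT nu0; have [K K0 sepK] := uniform_separation cS.
have TC : T \in charts by rewrite mem_charts.
apply: (locally_constant_symbol open_Omega (@regionS S) (@open_chart_nbhd S) _ _ (@coord_ge0 S)
  (@chart_coord_continuous S) N (depth := K) (Z := [pred k : 'I_n | nth 0 S k \notin T])) => //.
- by move=> u [Ou su]; split=> // k; apply: lt_le_trans (su k); rewrite oppr_lt0.
- by move=> u [].
- by move=> N'; exact: part_of_unity_flat.
- move=> u k Su kT ku.
  by rewrite /part_of_unity (cone_cutoff_deep (sepK T k TC) Su ku kT) mul0r.
- by move=> u k; apply: derive_part_of_unity_deep => // X; exact: sepK.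
- by move=> k; rewrite negbK; exact: nuT.
Qed.

End Partition.

(** * Oscillatory integrals *)

Section OscillatoryIntegrals.
Variables (R : realType) (n : nat) (P : set 'rV[R]_n) (Sig : seq (seq 'rV[int]_n)).
Hypothesis ss : simplicial_subdivision P Sig.
Variables (c1 c0 : R).
Hypothesis (c10 : 0 <= c1) (c01 : c1 < c0).
Implicit Types (S : seq 'rV[int]_n) (u v : 'rV[R]_n) (h k : 'rV[R]_n -> R) (a b : 'rV[int]_n).
Implicit Types (mu nu : 'rV[int]_n -> int).
Local Notation Omega := (@upper_box R n c1).
Local Notation chart := (chart Sig).
Local Notation chart_coord S := (@chart_coord R n (gens S)).
Local Notation chart_dir S := (@chart_dir R n (gens S)).
Local Notation cone_region S := (@cone_region R n (gens S) c1).
Local Notation cone_symbol S := (symbol Omega (cone_region S) (chart_dir S) (chart_coord S) 1).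

Let open_Omega : open Omega. Proof. exact: open_upper_box. Qed.
Let regionS S : cone_region S `<=` Omega. Proof. exact: cone_region_sub. Qed.
Let gain01 : 0 <= (1 : int) <= 1. Proof. by []. Qed.
Let coord_ge0 S u (k : 'I_n) : cone_region S u -> 0 <= chart_coord S k u. Proof. by case. Qed.

Definition fan_symbol nu h :=
  forall S, chart S -> forall N, cone_symbol S N (fun j : 'I_n => nu (nth 0 S j)) h.

Lemma eq_fan_symbol nu h k : (forall u, Omega u -> h u = k u) -> fan_symbol nu h -> fan_symbol nu k.
Proof. by move=> hk sh S cS N; apply: (eq_symbol open_Omega (@regionS S) hk); exact: sh. Qed.

Lemma eq_fan_symbol_weight mu nu h : (forall a, mu a = nu a) -> fan_symbol mu h -> fan_symbol nu h.
Proof. by move=> /funext ->. Qed.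

Lemma le_fan_symbol mu nu h : (forall a, nu a <= mu a) -> fan_symbol mu h -> fan_symbol nu h.
Proof.
move=> le_mu sh S cS N.
by apply: (le_symbol open_Omega (@regionS S) gain01 (@coord_ge0 S)) (sh S cS N).
Qed.

Lemma fan_symbolD nu h k :
  fan_symbol nu h -> fan_symbol nu k -> fan_symbol nu (fun u => h u + k u).
Proof. by move=> sh sk S cS N; apply: (symbolD open_Omega (@regionS S)); [exact: sh|exact: sk]. Qed.

Lemma fan_symbolB nu h k :
  fan_symbol nu h -> fan_symbol nu k -> fan_symbol nu (fun u => h u - k u).
Proof. by move=> sh sk S cS N; apply: (symbolB open_Omega (@regionS S)); [exact: sh|exact: sk]. Qed.

Lemma fan_symbolZ nu h (c : R) : fan_symbol nu h -> fan_symbol nu (fun u => c * h u).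
Proof. by move=> sh S cS N; apply: (symbolZ open_Omega (@regionS S)); exact: sh. Qed.

Lemma fan_symbolM mu nu h k : fan_symbol mu h -> fan_symbol nu k ->
  fan_symbol (fun a => mu a + nu a) (fun u => h u * k u).
Proof. by move=> sh sk S cS N; apply: (symbolM open_Omega (@regionS S)); [exact: sh|exact: sk]. Qed.

Lemma fan_symbol_sum (I : eqType) (r : seq I) nu (h : I -> 'rV[R]_n -> R) :
  (forall i, i \in r -> fan_symbol nu (h i)) -> fan_symbol nu (fun u => \sum_(i <- r) h i u).
Proof. by move=> sh S cS N; apply: (symbol_sum open_Omega (@regionS S)) => i ir; exact: sh. Qed.

Lemma fan_symbol_differentiable nu h u : fan_symbol nu h -> Omega u -> differentiable h u.
Proof.
move=> sh Ou; have [S cS _] := upper_box_chart ss c10 Ou.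
exact: symbol_differentiable (sh S cS 1%N) Ou.
Qed.

Lemma fan_symbol_derive nu h v : fan_symbol nu h -> fan_symbol nu (fun u => 'D_v h u).
Proof.
move=> sh S cS N; have vE := chart_dir_sum (chart_unit ss cS) v.
exact: (symbol_derive_span open_Omega (@regionS S) gain01 (@coord_ge0 S) vE (sh S cS N.+1)).
Qed.

Lemma fan_symbol_raise nu h a : fan_symbol nu h ->
  fan_symbol (fun b => nu b + (b == a)%:Z) (fun u => 'D_(intR R a) h u + (nu a)%:~R * h u).
Proof.
move=> sh S cS N; have [aS|aS] := boolP (a \in S).
  have [j ->] := mem_gens cS aS; rewrite -(chart_dir_gens ss)//.
  apply: (eq_symbol_weight _ (symbol_raise j (sh S cS N.+1))) => k; rewrite /raise; congr (_ + _).
  have -> : (nth 0 S k == nth 0 S j) = (k == j); last by case: (k == j).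
  by apply/eqP/eqP => [/(gens_inj ss cS)|->].
apply: (@eq_symbol_weight _ _ _ _ _ _ _ _ (fun j : 'I_n => nu (nth 0 S j))).
  move=> k; rewrite (_ : nth 0 S k == a = false) ?addr0//; apply/negbTE.
  by apply: contra aS => /eqP <-; exact: (gens_mem _ cS).
apply: (symbolD open_Omega (@regionS S)); first exact: fan_symbol_derive.
by apply: (symbolZ open_Omega (@regionS S)); exact: sh.
Qed.

Lemma fan_symbol_bounded h : fan_symbol (fun=> 0) h -> exists C, forall u, Omega u -> `|h u| <= C.
Proof.
move=> sh; have near_S S : S \in charts Sig ->
    \forall C \near +oo, forall u, cone_region S u -> `|h u| <= C.
  rewrite mem_charts => cS; have [C [_ bC]] := symbol_bounded_ge0 (sh S cS 0%N).
  near=> C' => u /bC; rewrite weight0 mulr1 => /le_trans; apply.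
  by near: C'; apply: nbhs_pinfty_ge; exact: num_real.
have [C bC] := filter_ex (near_all_seq proper_pinfty_nbhs near_S).
exists C => u /(upper_box_chart ss c10)[S cS]; apply: bC.
by rewrite mem_charts.
Unshelve. all: by end_near. Qed.

Lemma supp_ge_cases h u : supp_ge c0 h -> Omega u \/ exists i, u ord0 i < c0.
Proof.
move=> sh; have [|off] := pselect (Omega u); first by left.
right; apply: contrapT => ge_c0; apply: off => i; apply: lt_le_trans c01 _.
by rewrite leNgt; apply/negP => ui; apply: ge_c0; exists i.
Qed.

Lemma supp_ge_eq h k : supp_ge c0 h -> supp_ge c0 k -> (forall u, Omega u -> h u = k u) -> h = k.
Proof.
move=> sh sk hk; apply/funext => u; have [/hk//|[i ui]] := supp_ge_cases u sh.
by rewrite (sh u i)// (sk u i).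
Qed.

Lemma supp_ge_differentiable nu h u : fan_symbol nu h -> supp_ge c0 h -> differentiable h u.
Proof.
move=> fh sh; have [Ou|[i ui]] := supp_ge_cases u sh; first exact: fan_symbol_differentiable fh Ou.
apply: (near_eq_differentiable (h := cst 0)); last exact: differentiable_cst.
by apply: filterS (supp_ge_near0 sh ui) => x ->.
Qed.

Lemma fan_symbol_bounded_Cn N h : fan_symbol (fun=> 0) h -> supp_ge c0 h -> bounded_Cn N h.
Proof.
have cont k : fan_symbol (fun=> 0) k -> supp_ge c0 k -> continuous k.
  by move=> fk sk u; apply: differentiable_continuous; exact: supp_ge_differentiable fk sk.
have bounded k : fan_symbol (fun=> 0) k -> supp_ge c0 k -> exists C, forall u, `|k u| <= C.
  move=> fk sk; have [C bC] := fan_symbol_bounded fk; exists `|C| => u.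
  have [Ou|[i ui]] := supp_ge_cases u sk; first exact: le_trans (bC u Ou) (ler_norm _).
  by rewrite (sk u i)// normr0.
elim: N h => [|N IH] h fh sh;
  split=> //; [exact: cont|exact: bounded|exact: cont|exact: bounded|].
split=> [u i|i]; last by apply: IH; [exact: fan_symbol_derive|exact: supp_ge_derive].
by apply: diff_derivable; exact: supp_ge_differentiable fh sh.
Qed.

Definition amplitude nu h := fan_symbol nu h /\ supp_ge c0 h.

Lemma amplitude_integrand N h : amplitude (fun=> 0) h -> integrand N c0 h.
Proof. by move=> [fh sh]; split=> //; exact: fan_symbol_bounded_Cn. Qed.

Lemma le_amplitude mu nu h : (forall a, nu a <= mu a) -> amplitude mu h -> amplitude nu h.
Proof. by move=> le_mu [fh sh]; split=> //; exact: le_fan_symbol fh. Qed.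

Lemma amplitudeM mu nu h k : fan_symbol mu k -> amplitude nu h ->
  amplitude (fun a => mu a + nu a) (fun u => k u * h u).
Proof.
move=> fk [fh sh]; split; first exact: fan_symbolM.
by move=> u i ui; rewrite (sh u i)// mulr0.
Qed.

Lemma amplitudeM0 nu h k : fan_symbol (fun=> 0) k -> amplitude nu h ->
  amplitude nu (fun u => k u * h u).
Proof.
by move=> fk ah; apply: le_amplitude (amplitudeM fk ah) => a; rewrite add0r.
Qed.

Lemma amplitude_derive nu h v : amplitude nu h -> amplitude nu (fun u => 'D_v h u).
Proof. by move=> [fh sh]; split; [exact: fan_symbol_derive|exact: supp_ge_derive]. Qed.

Lemma amplitude_differentiable nu h u : amplitude nu h -> differentiable h u.
Proof. by move=> [fh sh]; exact: supp_ge_differentiable fh sh. Qed.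

Lemma amplitudeD nu h k : amplitude nu h -> amplitude nu k -> amplitude nu (fun u => h u + k u).
Proof.
move=> [fh sh] [fk sk]; split; first exact: fan_symbolD.
by move=> u i ui; rewrite (sh u i)// (sk u i)// addr0.
Qed.

Lemma amplitudeB nu h k : amplitude nu h -> amplitude nu k -> amplitude nu (fun u => h u - k u).
Proof.
move=> [fh sh] [fk sk]; split; first exact: fan_symbolB.
by move=> u i ui; rewrite (sh u i)// (sk u i)// subr0.
Qed.

Lemma amplitudeZ nu h (c : R) : amplitude nu h -> amplitude nu (fun u => c * h u).
Proof.
by move=> [fh sh]; split=> [|u i ui]; [exact: fan_symbolZ|rewrite (sh u i)// mulr0].
Qed.

Lemma amplitude_sum (I : eqType) (r : seq I) nu (h : I -> 'rV[R]_n -> R) :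
  (forall i, i \in r -> amplitude nu (h i)) -> amplitude nu (fun u => \sum_(i <- r) h i u).
Proof.
move=> ah; split; first by apply: fan_symbol_sum => i ir; have [] := ah i ir.
by move=> u i ui; rewrite big1_seq// => k kr; have [_ sh] := ah k kr; exact: sh ui.
Qed.

Lemma amplitude_raise nu h a : amplitude nu h -> amplitude (fun b => nu b + (b == a)%:Z)
  (fun u => 'D_(intR R a) h u + (nu a)%:~R * h u).
Proof.
move=> [fh sh]; split; first exact: fan_symbol_raise.
by move=> u i ui; rewrite (supp_ge_derive _ sh ui) (sh u i)// mulr0 addr0.
Qed.

Variables (F : 'rV[R]_n -> R) (level : 'rV[int]_n -> nat) (e : seq bool).
Local Notation level_int := (fun b => (level b)%:Z).
Local Notation coords := (index_enum 'I_n).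
Local Notation level_weight S := (weight (chart_coord S) (fun j : 'I_n => (level (nth 0 S j))%:Z)).

Definition grad_sqnorm u := \sum_(i <- coords) 'D_(evec R i) F u ^+ 2.

Hypothesis symF : fan_symbol level_int F.
Hypothesis grad_lower_bound : forall S, chart S -> exists2 c : R, 0 < c &
  forall u, cone_region S u -> c * level_weight S u ^+ 2 <= grad_sqnorm u.

Lemma grad_sqnorm_gt0 u : Omega u -> 0 < grad_sqnorm u.
Proof.
move=> /(upper_box_chart ss c10)[S cS Su]; have [c cp lower] := grad_lower_bound cS.
by apply: lt_le_trans (lower u Su); rewrite mulr_gt0// exprn_gt0// weight_gt0.
Qed.

Lemma grad_sqnorm_inv_symbol :
  fan_symbol (fun b => - (level_int b + level_int b)) (fun u => (grad_sqnorm u)^-1).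
Proof.
move=> S cS N; have [c cp lower] := grad_lower_bound cS.
apply: (symbolV open_Omega (@regionS S) cp) => [u Su|u Ou|].
- by rewrite weightD -expr2; apply: le_trans (ler_norm _); exact: lower.
- by rewrite gt_eqF// grad_sqnorm_gt0.
have sym_sq : fan_symbol (fun b => level_int b + level_int b) grad_sqnorm.
  apply: fan_symbol_sum => i _; apply: (fan_symbolM (h := fun u => 'D_(evec R i) F u));
    exact: fan_symbol_derive.
exact: (sym_sq S cS N).
Qed.

Definition grad_dual i u := 'D_(evec R i) F u * (grad_sqnorm u)^-1.

Lemma grad_dual_symbol i : fan_symbol (fun b => - level_int b) (grad_dual i).
Proof.
apply: (eq_fan_symbol_weight (mu := fun b => level_int b + - (level_int b + level_int b))).
  by move=> b; rewrite opprD addrA subrr add0r.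
by apply: fan_symbolM; [exact: fan_symbol_derive|exact: grad_sqnorm_inv_symbol].
Qed.

Lemma grad_dual_sum u : Omega u -> \sum_(i <- coords) 'D_(evec R i) F u * grad_dual i u = 1.
Proof.
move=> Ou; rewrite /grad_dual; under eq_bigr do rewrite mulrA -expr2.
by rewrite -mulr_suml divff// gt_eqF// grad_sqnorm_gt0.
Qed.

Definition phase (t psi : R) u := cos (t * F u + psi).

Lemma fan_symbolF : fan_symbol (fun=> 0) F.
Proof. exact: le_fan_symbol symF. Qed.

Lemma phase_symbol t psi : fan_symbol (fun=> 0) (phase t psi).
Proof.
have [bcos bsin] := bounded_smooth_trig R.
apply: (eq_fan_symbol (h := fun u => cos psi * cos (t * F u) - sin psi * sin (t * F u))).
  by move=> u _; rewrite /phase cosD mulrC [sin psi * _]mulrC.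
have tF S : chart S -> forall N, cone_symbol S N (fun=> 0) (fun u => t * F u).
  by move=> cS N; exact: (fan_symbolZ t fan_symbolF cS).
apply: fan_symbolB; apply: fan_symbolZ => S cS N.
  exact: (symbol_comp_graded open_Omega (@regionS S) bcos (tF S cS)).
exact: (symbol_comp_graded open_Omega (@regionS S) bsin (tF S cS)).
Qed.

Lemma is_derive_phase t psi u v : Omega u ->
  is_derive u v (phase t psi) (phase t (psi + pi / 2) u * (t * 'D_v F u)).
Proof.
move=> Ou; have dF := fan_symbol_differentiable symF Ou.
have Dt := is_derive_add (is_derive_scale t (differentiable_is_derive v dF))
  (is_derive_const psi u v).
have D := is_derive_comp (F := cos) (h := fun u => t * F u + psi) (is_derive_cos _) Dt.
by apply: (is_derive_eq D); rewrite addr0 /phase addrA cosDpihalf.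
Qed.

Lemma derive_phaseM t psi h u v : Omega u -> differentiable h u ->
  'D_v (fun u => phase t psi u * h u) u =
    t * ('D_v F u * (phase t (psi + pi / 2) u * h u)) + phase t psi u * 'D_v h u.
Proof.
move=> Ou dh; have Dphase := is_derive_phase t psi v Ou.
have D := is_derive_mul Dphase (differentiable_is_derive v dh).
by rewrite (derive_val (is_derive := D)); congr (_ + _); ring.
Qed.

Lemma phase_bound t psi u : `|phase t psi u| <= 1.
Proof. by rewrite /phase ler_norml cos_geN1 cos_le1. Qed.

Lemma amplitude_phase t psi nu h : amplitude nu h -> amplitude nu (fun u => phase t psi u * h u).
Proof. exact/amplitudeM0/phase_symbol. Qed.

Definition phase_int (psi t : R) h := orthant_int e (fun u => phase t psi u * h u).

Lemma integrand_phase t psi h : amplitude (fun=> 0) h ->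
  integrand 1 c0 (fun u => phase t psi u * h u).
Proof. by move=> ah; apply: amplitude_integrand; exact: amplitude_phase. Qed.

Lemma phase_intD psi t h k : amplitude (fun=> 0) h -> amplitude (fun=> 0) k ->
  phase_int psi t (fun u => h u + k u) = phase_int psi t h + phase_int psi t k.
Proof.
move=> ah ak; rewrite /phase_int -(orthant_intD e (integrand_phase t psi ah))//.
  by congr orthant_int; apply/funext => u; rewrite mulrDr.
exact: integrand_phase.
Qed.

Lemma phase_intZ psi t h (c : R) : amplitude (fun=> 0) h ->
  phase_int psi t (fun u => c * h u) = c * phase_int psi t h.
Proof.
move=> ah; rewrite /phase_int -(orthant_intZ e c (integrand_phase t psi ah)).
by congr orthant_int; apply/funext => u; rewrite mulrCA.
Qed.

Lemma phase_int_sum (I : eqType) (r : seq I) psi t (h : I -> 'rV[R]_n -> R) :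
  (forall i, i \in r -> amplitude (fun=> 0) (h i)) ->
  phase_int psi t (fun u => \sum_(i <- r) h i u) = \sum_(i <- r) phase_int psi t (h i).
Proof.
move=> ah; rewrite /phase_int -(orthant_int_sum e (c := c0)) => [|i ir].
  by congr orthant_int; apply/funext => u; rewrite mulr_sumr.
exact/integrand_phase/ah.
Qed.

Lemma phase_int_bound psi h : amplitude (fun=> 0) h ->
  exists M, forall t, `|phase_int psi t h| <= M.
Proof.
move=> ah; have [C bC] := bounded_Cn_bound (amplitude_integrand 0 ah).1.
exists (C * expR (- c0) ^+ n) => t; apply: (orthant_int_bound e (integrand_phase t psi ah)) => u.
by rewrite normrM; apply: le_trans (bC u); apply: ler_piMl => //; exact: phase_bound.
Qed.

Definition adjoint_grad h u :=
  \sum_(i <- coords) (grad_dual i u * h u - 'D_(evec R i) (fun x => grad_dual i x * h x) u).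

Lemma grad_dualM i nu h : amplitude nu h ->
  amplitude (fun b => nu b - level_int b) (fun x => grad_dual i x * h x).
Proof.
by move=> ah; apply: le_amplitude (amplitudeM (grad_dual_symbol i) ah) => b; rewrite addrC.
Qed.

Lemma amplitude_adjoint_grad nu h : amplitude nu h ->
  amplitude (fun b => nu b - level_int b) (adjoint_grad h).
Proof.
move=> ah; apply: amplitude_sum => i _; have ag := grad_dualM i ah.
by apply: amplitudeB => //; exact: amplitude_derive.
Qed.

Lemma orthant_int_derive_evec h i : amplitude (fun=> 0) h ->
  orthant_int e (fun u => 'D_(evec R i) h u) = orthant_int e h.
Proof. by move=> ah; apply: (orthant_int_derive e (c := c0)); exact: amplitude_integrand. Qed.

(* Integration by parts against the field [grad F / |grad F|^2]. *)
Lemma phase_int_adjoint_grad psi t h : amplitude level_int h ->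
  t * phase_int (psi + pi / 2) t h = phase_int psi t (adjoint_grad h).
Proof.
move=> ah.
have ah0 : amplitude (fun=> 0) h by exact: le_amplitude ah.
have ag i : amplitude (fun=> 0) (fun u => grad_dual i u * h u).
  by apply: le_amplitude (grad_dualM i ah) => b; rewrite subrr.
have aadj : amplitude (fun=> 0) (adjoint_grad h).
  by apply: le_amplitude (amplitude_adjoint_grad ah) => b; rewrite subrr.
pose w i u := phase t psi u * (grad_dual i u * h u).
have aw i : amplitude (fun=> 0) (w i) by exact: amplitude_phase.
have adw i : amplitude (fun=> 0) (fun u => w i u - 'D_(evec R i) (w i) u).
  by apply: amplitudeB => //; exact: amplitude_derive.
have aph := amplitude_phase t (psi + pi / 2) ah0.
have int0 : orthant_int e (fun u => \sum_(i <- coords) (w i u - 'D_(evec R i) (w i) u)) = 0.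
  rewrite (orthant_int_sum e (c := c0)) => [|i _]; last exact: amplitude_integrand.
  apply: big1 => i _; rewrite (orthant_intB e (c := c0)).
  - by rewrite orthant_int_derive_evec ?subrr.
  - exact: amplitude_integrand.
  - by apply: amplitude_integrand; exact: amplitude_derive.
rewrite /phase_int -(orthant_intZ e t (amplitude_integrand 1 aph)) -[LHS]addr0 -int0.
rewrite -(orthant_intD e (c := c0)); first last.
- by apply: amplitude_integrand; apply: amplitude_sum => i _.
- by apply: amplitude_integrand; exact: amplitudeZ.
congr orthant_int; apply: supp_ge_eq => [||u Ou].
- by have [] := amplitudeD (amplitudeZ t aph) (amplitude_sum (r := coords) (fun i _ => adw i)).
- by have [] := amplitude_phase t psi aadj.
rewrite /adjoint_grad mulr_sumr -[X in X + _]mul1r -[X in X * _ + _](grad_dual_sum Ou) mulr_suml.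
rewrite -big_split/=.
apply: eq_bigr => i _; have dg : differentiable (fun x => grad_dual i x * h x) u.
  exact: amplitude_differentiable (ag i).
by rewrite /w (derive_phaseM t psi (evec R i) Ou dg); ring.
Qed.

Lemma orthant_int_derive_intR h a : amplitude (fun=> 0) h ->
  orthant_int e (fun u => 'D_(intR R a) h u) = (sumz a)%:~R * orthant_int e h.
Proof.
move=> ah.
have -> : (fun u => 'D_(intR R a) h u) =
    (fun u => \sum_(i <- coords) (a ord0 i)%:~R * 'D_(evec R i) h u).
  apply/funext => u; rewrite {1}(row_sum_evec (intR R a)) derive_lincomb.
    by apply: eq_bigr => i _; rewrite mxE.
  exact: amplitude_differentiable ah.
have adh i : integrand 1 c0 (fun u => 'D_(evec R i) h u).
  by apply: amplitude_integrand; exact: amplitude_derive.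
rewrite (orthant_int_sum e (c := c0)) => [|i _]; last first.
  by apply: amplitude_integrand; apply: amplitudeZ; exact: amplitude_derive.
rewrite /sumz rmorph_sum/= mulr_suml; apply: eq_bigr => i _.
by rewrite (orthant_intZ e _ (adh i)) orthant_int_derive_evec.
Qed.

Lemma amplitude_deriveF nu h v : amplitude nu h ->
  amplitude (fun b => level_int b + nu b) (fun u => 'D_v F u * h u).
Proof. by apply: amplitudeM; exact: fan_symbol_derive. Qed.

Lemma phase_int_derive_intR psi t h a : amplitude (fun=> 0) h ->
  (sumz a)%:~R * phase_int psi t h =
    t * phase_int (psi + pi / 2) t (fun u => 'D_(intR R a) F u * h u) +
    phase_int psi t (fun u => 'D_(intR R a) h u).
Proof.
move=> ah; have aDF : amplitude (fun=> 0) (fun u => 'D_(intR R a) F u * h u).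
  by apply: le_amplitude (amplitude_deriveF (intR R a) ah) => b; rewrite addr0.
have aph := amplitude_phase t (psi + pi / 2) aDF.
have aD := amplitude_phase t psi (amplitude_derive (intR R a) ah).
have aphase := amplitude_phase t psi ah.
rewrite {1}/phase_int -(orthant_int_derive_intR a aphase) /phase_int.
rewrite -(orthant_intZ e t (amplitude_integrand 1 aph)).
rewrite -(orthant_intD e (amplitude_integrand 1 (amplitudeZ t aph)) (amplitude_integrand 1 aD)).
congr orthant_int; apply: supp_ge_eq => [||u Ou].
- by have [] := amplitude_derive (intR R a) aphase.
- by have [] := amplitudeD (amplitudeZ t aph) aD.
rewrite (derive_phaseM t psi (intR R a) Ou (amplitude_differentiable u ah)).
by congr (_ * _ + _); rewrite mulrCA.
Qed.

Lemma cos_taylor (x psi v r : R) :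
  `|cos ((v + r) * x + psi) - cos (v * x + psi) - r * (cos (v * x + (psi + pi / 2)) * x)|
    <= x ^+ 2 * r ^+ 2.
Proof.
have Daff (phi : R) (y : R) : is_derive y 1 (fun y : R => y * x + phi) x.
  apply: (is_derive_eq (is_derive_add (is_derive_mul (is_derive_id y 1) (is_derive_const x y 1))
    (is_derive_const phi y 1))).
  by rewrite mulr0 !addr0 mul1r.
have Dcos (phi : R) (y : R) : is_derive y 1 (fun y : R => cos (y * x + phi))
    (cos (y * x + (phi + pi / 2)) * x).
  apply: (is_derive_eq (is_derive_comp (F := cos) (h := fun y : R => y * x + phi)
    (is_derive_cos _) (Daff phi y))).
  by rewrite addrA cosDpihalf.
have Dcos_x (y : R) : is_derive y 1 (fun y : R => cos (y * x + (psi + pi / 2)) * x)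
    (cos (y * x + (psi + pi / 2 + pi / 2)) * x * x).
  apply: (is_derive_eq (is_derive_mul (Dcos (psi + pi / 2) y) (is_derive_const x y 1))).
  by rewrite mulr0 addr0.
have := @quadratic_remainder R (fun y => cos (y * x + psi)) _
  (fun y => cos (y * x + (psi + pi / 2 + pi / 2)) * x * x) v r (x ^+ 2)
  (fun t _ => Dcos psi (v + t * r)) (fun t _ => Dcos_x (v + t * r)).
apply=> t _; rewrite -mulrA -expr2 normrM [`|x ^+ 2|]ger0_norm ?sqr_ge0//.
by rewrite ler_piMl ?sqr_ge0// ler_norml cos_geN1 cos_le1.
Qed.

Lemma is_derive_phase_int (psi t : R) h : amplitude (fun=> 0) h ->
  is_derive t 1 (fun t : R => phase_int psi t h)
    (phase_int (psi + pi / 2) t (fun u => F u * h u)).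
Proof.
move=> ah; have aF := amplitudeM0 fan_symbolF ah.
have [C bC] := bounded_Cn_bound (amplitude_integrand 0 (amplitudeM0 fan_symbolF aF)).1.
apply: (@is_derive_quadratic _ _ _ _ (C * expR (- c0) ^+ n)) => r.
have ap := amplitude_phase (t + r) psi ah; have aq := amplitude_phase t psi ah.
have ad := amplitudeZ r (amplitude_phase t (psi + pi / 2) aF).
rewrite /phase_int -(orthant_intZ e r (amplitude_integrand 1 (amplitude_phase t _ aF))).
rewrite -(orthant_intB e (amplitude_integrand 1 ap) (amplitude_integrand 1 aq)).
rewrite -(orthant_intB e (amplitude_integrand 1 (amplitudeB ap aq)) (amplitude_integrand 1 ad)).
rewrite mulrAC; apply: (orthant_int_bound e (amplitude_integrand 1 (amplitudeB _ ad))) => [|u].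
  exact: amplitudeB.
have := cos_taylor (F u) psi t r; rewrite -/(phase t _ u) -/(phase (t + r) _ u) => taylor.
rewrite (_ : _ - _ = (phase (t + r) psi u - phase t psi u -
    r * (phase t (psi + pi / 2) u * F u)) * h u); last by ring.
rewrite normrM; apply: le_trans (ler_wpM2r (normr_ge0 _) taylor) _.
rewrite mulrAC; apply: ler_wpM2r; first exact: sqr_ge0.
by apply: le_trans (bC u); rewrite mulrA -expr2 normrM [`|F u ^+ 2|]ger0_norm// sqr_ge0.
Qed.

Definition euler_defect a u := 'D_(intR R a) F u + (level_int a)%:~R * F u.

Definition euler_step a (x : R) h u := (level a)%:R^-1 *
  ('D_(intR R a) h u + x * h u + adjoint_grad (fun y => euler_defect a y * h y) u).

Lemma amplitude_euler_defect a nu h : amplitude nu h ->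
  amplitude (fun b => level_int b + (b == a)%:Z + nu b) (fun y => euler_defect a y * h y).
Proof. by apply: amplitudeM; exact: fan_symbol_raise. Qed.

Lemma amplitude_adjoint_defect a nu h : amplitude nu h ->
  amplitude (fun b => nu b + (b == a)%:Z) (adjoint_grad (fun y => euler_defect a y * h y)).
Proof.
move=> ah; apply: le_amplitude (amplitude_adjoint_grad (amplitude_euler_defect a ah)) => b.
by rewrite le_eqVlt; apply/orP; left; apply/eqP; ring.
Qed.

Lemma amplitude_euler_step a (nu : 'rV[int]_n -> nat) h : amplitude (fun b => (nu b)%:Z) h ->
  amplitude (fun b => (nu b + (b == a))%N%:Z) (euler_step a (nu a)%:R h).
Proof.
move=> ah; apply: (le_amplitude (mu := fun b => (nu b)%:Z + (b == a)%:Z)) => [b|].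
  by rewrite PoszD.
by apply: amplitudeZ; apply: amplitudeD; [exact: amplitude_raise|exact: amplitude_adjoint_defect].
Qed.

Lemma phase_int_euler_step psi t a (x : R) h : (0 < level a)%N -> amplitude (fun=> 0) h ->
  t * phase_int (psi + pi / 2) t (fun u => F u * h u) =
    phase_int psi t (euler_step a x h) - ((sumz a)%:~R + x) / (level a)%:R * phase_int psi t h.
Proof.
move=> la ah; have lR : (level a)%:R != 0 :> R by rewrite pnatr_eq0 -lt0n.
have aD := amplitude_derive (intR R a) ah; have aF := amplitudeM0 fan_symbolF ah.
have aDF : amplitude (fun=> 0) (fun u => 'D_(intR R a) F u * h u).
  by apply: le_amplitude (amplitude_deriveF (intR R a) ah) => b; rewrite addr0.
have aadj : amplitude (fun=> 0) (adjoint_grad (fun y => euler_defect a y * h y)).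
  by apply: le_amplitude (amplitude_adjoint_defect a ah) => b; rewrite add0r.
have adef : amplitude level_int (fun y => euler_defect a y * h y).
  by apply: le_amplitude (amplitude_euler_defect a ah) => b; rewrite addr0 lerDl.
have by_parts := phase_int_adjoint_grad psi t adef.
have by_dilation := phase_int_derive_intR psi t a ah.
have defectE : phase_int (psi + pi / 2) t (fun y => euler_defect a y * h y) =
    phase_int (psi + pi / 2) t (fun u => 'D_(intR R a) F u * h u) +
    (level a)%:R * phase_int (psi + pi / 2) t (fun u => F u * h u).
  rewrite -(phase_intZ _ _ _ aF) -(phase_intD _ _ aDF (amplitudeZ _ aF)).
  by congr phase_int; apply/funext => u; rewrite /euler_defect mulrDl mulrA.
have stepE : phase_int psi t (euler_step a x h) = (level a)%:R^-1 *
    (phase_int psi t (fun u => 'D_(intR R a) h u) + x * phase_int psi t h +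
     phase_int psi t (adjoint_grad (fun y => euler_defect a y * h y))).
  rewrite phase_intZ; last by apply: amplitudeD aadj; apply: amplitudeD => //; exact: amplitudeZ.
  rewrite phase_intD// ?phase_intD ?phase_intZ//; first exact: amplitudeZ.
  by apply: amplitudeD => //; exact: amplitudeZ.
rewrite stepE -by_parts defectE; apply: (mulfI lR); move: by_dilation.
set I_F := phase_int _ _ (fun u => F u * _); set I_D := phase_int _ _ (fun u => 'D_ _ h u).
set I_DF := phase_int _ _ (fun u => 'D_ _ F u * _); set I_h := phase_int psi t h => by_dilation.
have -> : I_D = (sumz a)%:~R * I_h - t * I_DF by rewrite by_dilation addrC addKr.
by field.
Qed.

Lemma phase_int_ode (psi : R) a (nu : 'rV[int]_n -> nat) h (tau : R) : (0 < level a)%N ->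
  amplitude (fun b => (nu b)%:Z) h ->
  is_derive tau 1 (fun tau : R => phase_int psi (expR tau) h)
   (phase_int psi (expR tau) (euler_step a (nu a)%:R h) -
    ((sumz a)%:~R + (nu a)%:R) / (level a)%:R * phase_int psi (expR tau) h).
Proof.
move=> la ah; have ah0 : amplitude (fun=> 0) h by exact: le_amplitude ah.
have D := is_derive_comp (F := fun t : R => phase_int psi t h) (h := expR)
  (is_derive_phase_int psi (expR tau) ah0) (is_derive_expR tau).
by apply: (is_derive_eq D); rewrite mulrC; exact: phase_int_euler_step.
Qed.

Implicit Types (deg : 'rV[int]_n -> nat).

Fixpoint chain_exponents deg (s : seq 'rV[int]_n) : seq R :=
  if s is a :: s' then
    ((sumz a)%:~R + (deg a)%:R) / (level a)%:R :: chain_exponents (fun b => deg b + (b == a))%N s'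
  else [::].

Lemma phase_int_chain (psi : R) (s : seq 'rV[int]_n) deg h : (forall a, a \in s -> 0 < level a)%N ->
  amplitude (fun b => (deg b)%:Z) h ->
  exists2 h', amplitude (fun b => (deg b + count_mem b s)%N%:Z) h' &
    ode_chain (chain_exponents deg s) (fun tau => phase_int psi (expR tau) h)
      (fun tau => phase_int psi (expR tau) h').
Proof.
elim: s deg h => [|a s IH] deg h ls ah.
  by exists h => //; apply: le_amplitude ah => b; rewrite addn0.
have la := ls a (mem_head _ _).
have [h' ah' chain] := IH _ _ (fun b bs => ls b (mem_behead (s := a :: s) bs))
  (amplitude_euler_step a ah).
exists h'; first by apply: le_amplitude ah' => b /=; rewrite [a == b]eq_sym addnA.
exists (fun tau => phase_int psi (expR tau) (euler_step a (deg a)%:R h)); split=> // tau.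
exact: phase_int_ode.
Qed.

Lemma phase_int_decay (psi : R) (M : nat) h : amplitude (fun b => (M * level b)%N%:Z) h ->
  exp_decay M%:R (fun tau => phase_int psi (expR tau) h).
Proof.
elim: M psi h => [|M IH] psi h ah.
  have [K bK] := phase_int_bound psi ah; exists K; apply: nearW => tau.
  by rewrite mul0r oppr0 expR0 mulr1.
have ah_level : amplitude level_int h.
  by apply: le_amplitude ah => b; rewrite lez_nat mulSn leq_addr.
have aL : amplitude (fun b => (M * level b)%N%:Z) (adjoint_grad h).
  apply: le_amplitude (amplitude_adjoint_grad ah) => b.
  by rewrite mulSn PoszD addrAC subrr add0r.
have [K bK] := IH (psi - pi / 2) _ aL; exists K; apply: filterS bK => tau.
have := phase_int_adjoint_grad (psi - pi / 2) (expR tau) ah_level; rewrite subrK => <-.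
rewrite normrM [`|expR tau|]ger0_norm ?expR_ge0// -ler_pdivlMl ?expR_gt0// -expRN.
by move=> /le_trans; apply; rewrite mulrCA -expRD -natr1 mulrDl mul1r opprD addrC.
Qed.

Lemma chain_exponents_cat deg s1 s2 : chain_exponents deg (s1 ++ s2) =
  chain_exponents deg s1 ++ chain_exponents (fun b => deg b + count_mem b s1)%N s2.
Proof.
elim: s1 deg => [|a s1 IH] deg /=.
  by congr chain_exponents; apply/funext => b; rewrite addn0.
rewrite IH; congr (_ :: _ ++ chain_exponents _ _); apply/funext => b.
by rewrite [a == b]eq_sym addnA.
Qed.

Lemma chain_exponents_nseq deg a m x : (0 < level a)%N -> x \in chain_exponents deg (nseq m a) ->
  exists2 k, (deg a <= k)%N & x = ((sumz a)%:~R + k%:R) / (level a)%:R.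
Proof.
move=> la; elim: m deg => [|m IH] deg //=; rewrite inE => /predU1P[->|/IH[k le_k ->]].
  by exists (deg a).
by exists k => //; apply: leq_trans le_k; rewrite leq_addr.
Qed.

Lemma chain_exponents_nseq_uniq deg a m : (0 < level a)%N -> uniq (chain_exponents deg (nseq m a)).
Proof.
move=> la; have lR : (level a)%:R != 0 :> R by rewrite pnatr_eq0 -lt0n.
elim: m deg => [|m IH] deg //=; rewrite IH andbT; apply/negP => /(chain_exponents_nseq la)[k].
rewrite eqxx addn1 => lt_k /(divIf lR)/addrI/eqP; rewrite eqr_nat => /eqP nuk.
by move: lt_k; rewrite nuk ltnn.
Qed.

Definition schedule (M : nat) (s : seq 'rV[int]_n) := flatten [seq nseq (M * level a) a | a <- s].

Lemma schedule_level_gt0 M s a : a \in schedule M s -> (0 < level a)%N.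
Proof.
move=> /flattenP[_ /mapP[b bs ->]]; rewrite mem_nseq => /andP[+ /eqP ->].
by rewrite muln_gt0 => /andP[].
Qed.

Lemma count_schedule M s a : a \in s -> (M * level a <= count_mem a (schedule M s))%N.
Proof.
elim: s => [//|b s IH]; rewrite inE /schedule/= count_cat => /predU1P[->|/IH].
  by rewrite count_nseq/= eqxx mul1n leq_addr.
by move=> /leq_trans; apply; rewrite leq_addl.
Qed.

Lemma chain_exponents_count (M : nat) deg (s : seq 'rV[int]_n) x :
  (count_mem x (chain_exponents deg (schedule M s)) <= size s)%N.
Proof.
elim: s deg => [//|a s IH] deg; rewrite /schedule/= chain_exponents_cat count_cat.
rewrite -[(size s).+1]add1n leq_add//; have [l0|la] := posnP (level a); first by rewrite l0 muln0.
by rewrite count_uniq_mem ?leq_b1//; exact: chain_exponents_nseq_uniq.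
Qed.

Lemma chain_exponents_mem (M : nat) deg (s : seq 'rV[int]_n) x :
  x \in chain_exponents deg (schedule M s) ->
  exists a (k : nat), [/\ a \in s, (0 < level a)%N & x = ((sumz a)%:~R + k%:R) / (level a)%:R].
Proof.
elim: s deg => [//|a s IH] deg; rewrite /schedule/= chain_exponents_cat mem_cat.
case/orP => [|/IH[b [k [bs lb ->]]]]; last by exists b, k; split=> //; rewrite inE bs orbT.
have [l0|la] := posnP (level a); first by rewrite l0 muln0.
by move=> /(chain_exponents_nseq la)[k _ ->]; exists a, k; split=> //; rewrite mem_head.
Qed.

Definition expansion_exponents : set R := [set x | exists a (k : nat),
  [/\ skeleton1 Sig a, (0 < level a)%N & x = ((sumz a)%:~R + k%:R) / (level a)%:R]].

Lemma phase_int_expandable psi S h : chart S ->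
  (forall M : nat, amplitude (fun b => (if b \in S then 0 else M * level b)%N%:Z) h) ->
  expandable expansion_exponents n (fun tau => phase_int psi (expR tau) h).
Proof.
move=> cS ah N; pose M := N.+1; pose nu b := (if b \in S then 0 else M * level b)%N.
pose E := chain_exponents nu (schedule M S).
have [h' ah' chain] := phase_int_chain psi (@schedule_level_gt0 M S) (ah M).
have {}ah' : amplitude (fun b => (M * level b)%N%:Z) h'.
  apply: le_amplitude ah' => b; rewrite lez_nat; case: ifP => bS; last exact: leq_addr.
  by rewrite add0n count_schedule.
have NM : N%:R < M%:R :> R by rewrite ltr_nat.
have sub_undup : {subset E <= undup E} by move=> x; rewrite mem_undup.
have [p [sp dec]] :=
  ode_chain_expansion (undup_uniq E) sub_undup NM (phase_int_decay psi ah') chain.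
exists (undup E), (fun x => if x \in undup E then p x else 0).
apply: expansion_restrict dec => [|x|x]; first exact: undup_uniq.
- rewrite mem_undup => /chain_exponents_mem[a [k [aS la ->]]]; exists a, k; split=> //.
  by have [j ->] := mem_gens cS aS; exact: (gens_skeleton1 ss j cS).
- apply: leq_trans (sp x) _; apply: leq_trans (chain_exponents_count _ _ _ _) _.
  by have /andP[_ /eqP ->] := cS.
Qed.

End OscillatoryIntegrals.

(** * The asymptotic expansion *)

Section ComplexNumbers.
Local Open Scope complex_scope.
Variable R : realType.

Lemma complex_sum (I : Type) (s : seq I) (x y : I -> R) :
  \sum_(i <- s) (x i +i* y i) = (\sum_(i <- s) x i) +i* (\sum_(i <- s) y i).
Proof.
elim: s => [|i s IH]; first by rewrite !big_nil.
by rewrite !big_cons IH.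
Qed.

Lemma normc_le (x y : R) : Normc.normc (x +i* y) <= `|x| + `|y|.
Proof.
rewrite /Normc.normc -[leRHS]ger0_norm ?addr_ge0// -sqrtr_sqr ler_wsqrtr//.
by rewrite sqrrD !real_normK ?num_real// -addrA lerD2l lerDr mulrn_wge0// mulr_ge0.
Qed.

Lemma ln_power_sum (p : {poly R}) (m : nat) (t x : R) : 0 < t -> (size p <= m)%N ->
  \sum_(1 <= k < m.+1) p`_k.-1 * (t `^ (- x) * ln t ^+ k.-1) = p.[ln t] * expR (- (x * ln t)).
Proof.
move=> t0 sp; rewrite (horner_coef_wide _ sp) mulr_suml big_add1 big_mkord.
by apply: eq_bigr => k _; rewrite /powR gt_eqF// mulNr -mulrA [_ * expR _]mulrC.
Qed.

Lemma ln_power_sum_expsum (A : set R) (L : seq R) (m : nat) (B t : R) (p q : R -> {poly R}) :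
  0 < t -> uniq L -> (forall x, x \in L <-> A x /\ x <= B) ->
  (forall x, size (p x) <= m)%N -> (forall x, size (q x) <= m)%N ->
  \sum_(al \in [set al | A (- al)] `&` [set al | - B <= al]) \sum_(1 <= k < m.+1)
    ((p (- al))`_k.-1 +i* (q (- al))`_k.-1) * (t `^ al * ln t ^+ k.-1)%:C =
  expsum L p (ln t) +i* expsum L q (ln t).
Proof.
move=> t0 uL memL sp sq.
have -> : [set al | A (- al)] `&` [set al | - B <= al] = [set` [seq - x | x <- L]].
  apply/seteqP; split=> al /= => [[Aal Bal]|/mapP[x /memL[Ax xB] ->]].
    by apply/mapP; exists (- al); rewrite ?opprK//; apply/memL; rewrite lerNl.
  by rewrite opprK lerN2.
rewrite -fsbig_seq; last by rewrite map_inj_uniq//; exact: oppr_inj.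
rewrite big_map /expsum -complex_sum; apply: eq_bigr => x _; rewrite opprK.
rewrite -!(ln_power_sum _ t0 (m := m))// -complex_sum; apply: eq_bigr => k _.
by apply/eqP; rewrite eq_complex/= !mulr0 subr0 add0r !eqxx.
Qed.

Lemma expandable_asymp_expansion (n : nat) (A : set R) (I : R -> R[i]) :
  (forall B : R, finite_set (A `&` [set x | x <= B])) ->
  expandable A n (fun tau => complex.Re (I (expR tau))) ->
  expandable A n (fun tau => complex.Im (I (expR tau))) ->
  exists C, asymp_expansion n I [set al | A (- al)] C.
Proof.
move=> finA /expandable_uniform[p [sp dec_p]] /expandable_uniform[q [sq dec_q]].
exists (fun al k => (p (- al))`_k.-1 +i* (q (- al))`_k.-1) => N.
have /finite_seqP[s sE] := finA N%:R; pose L := undup s.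
have memL x : x \in L <-> A x /\ x <= N%:R.
  by rewrite mem_undup (_ : (A x /\ x <= N%:R) = [set` s] x) // -sE.
have [Kp bound_p] := dec_p N L (undup_uniq s) memL.
have [Kq bound_q] := dec_q N L (undup_uniq s) memL.
have [T [_ bound]] := filterI bound_p bound_q.
exists (Kp + Kq), (expR (T + 1)) => t Tt.
have t0 : 0 < t by apply: lt_le_trans Tt; exact: expR_gt0.
have /bound[] : T < ln t.
  by rewrite -ltr_expR lnK ?posrE//; apply: lt_le_trans Tt; rewrite ltr_expR ltrDl.
rewrite lnK ?posrE// (ln_power_sum_expsum t0 (undup_uniq s) memL sp sq).
rewrite /powR gt_eqF// mulNr; case: (I t) => x y /= bound_re bound_im.
by apply: le_trans (normc_le _ _) _; rewrite mulrDl lerD.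
Qed.

End ComplexNumbers.

Lemma expansion_exponents_finite (R : realType) (n : nat) (Sig : seq (seq 'rV[int]_n))
    (level : 'rV[int]_n -> nat) (B : R) : (forall a, skeleton1 Sig a -> 0 <= sumz a) ->
  finite_set (expansion_exponents Sig level `&` [set x | x <= B]).
Proof.
move=> sumz_ge0; pose exponents (a : 'rV[int]_n) : seq R :=
  [seq ((sumz a)%:~R + k%:R) / (level a)%:R | k <- iota 0 (Num.truncn (B * (level a)%:R)).+1].
apply: sub_finite_set (finite_seq (flatten [seq exponents (head 0 T) | T <- Sig])).
move=> _ [[a [k [Sa la ->]]] /= leB]; apply/flattenP; exists (exponents a).
  by apply/mapP; exists [:: a].
apply: (map_f (fun k : nat => ((sumz a)%:~R + k%:R) / (level a)%:R)).
have leB' : k%:R <= B * (level a)%:R.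
  by move: leB; rewrite ler_pdivrMr ?ltr0n//; apply: le_trans; rewrite lerDr ler0z sumz_ge0.
by rewrite mem_iota/= add0n ltnS truncn_ge_nat// (le_trans _ leB').
Qed.

Lemma newton_dim_gt0 (R : realType) (n : nat) (f : 'rV[R]_n -> R) :
  f 0 = 0 -> newton f !=set0 -> (0 < n)%N.
Proof.
case: n f => // f f0 g0.
have a0 : @orthant R 0 0 by case.
have [al] := support_argmin a0 g0; rewrite /taylor_coef /dmulti.
have -> : enum 'I_0 = [::] by apply: size0nil; rewrite -cardE card_ord.
by rewrite /= f0 mul0r eqxx.
Qed.

Lemma derive_sqr_le (R : realType) (n : nat) (F : 'rV[R]_n -> R) (u v : 'rV[R]_n) :
  differentiable F u ->
  'D_v F u ^+ 2 <= (\sum_i `|v ord0 i|) ^+ 2 * grad_sqnorm F u.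
Proof.
move=> dF; have ge0 : 0 <= grad_sqnorm F u.
  by apply: sumr_ge0 => i _; exact: sqr_ge0.
have le_sqrt i : `|'D_(evec R i) F u| <= Num.sqrt (grad_sqnorm F u).
  rewrite -sqrtr_sqr ler_wsqrtr// /grad_sqnorm (bigD1 i)//= lerDl.
  by apply: sumr_ge0 => j _; exact: sqr_ge0.
rewrite -real_normK ?num_real// -(sqr_sqrtr ge0) -exprMn.
apply: lerXn2r; rewrite ?nnegrE ?mulr_ge0 ?sqrtr_ge0 ?sumr_ge0//.
rewrite {1}(row_sum_evec v) derive_lincomb// mulr_suml.
apply: le_trans (ler_norm_sum _ _ _) (ler_sum _ _) => i _.
by rewrite normrM; apply: ler_wpM2l.
Qed.

Section Cubes.
Variables (R : realType) (n : nat).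

Definition open_cube (r : R) := [set x : 'rV[R]_n | forall i, `|x ord0 i| < r].

Lemma nbhs0_open_cube (r : R) : 0 < r -> nbhs (0 : 'rV[R]_n) (open_cube r).
Proof.
move=> r0; have near_i i : nbhs (0 : 'rV[R]_n) [set x : 'rV[R]_n | `|x ord0 i| < r].
  have cont : {for (0 : 'rV[R]_n), continuous (fun x : 'rV[R]_n => `|x ord0 i|)}.
    apply: (@continuous_comp _ _ _ (fun x : 'rV[R]_n => x ord0 i) Num.norm).
      exact: coord_continuous.
    exact: norm_continuous.
  apply: (cont [set z | z < r]); apply: open_nbhs_nbhs; split; first exact: open_lt.
  by rewrite /= mxE normr0.
exact: filter_forall near_i.
Qed.

Lemma near_cube_sub (U : set 'rV[R]_n) : open U -> U 0 ->
  \forall c \near +oo, cube (expR (- c)) `<=` U.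
Proof.
move=> oU U0; have /nbhs_ballP[d /= d0 ballU] : nbhs (0 : 'rV[R]_n) U by exact: open_nbhs_nbhs.
have d2 : 0 < d / 2 by rewrite divr_gt0.
near=> c => x cx; apply: ballU; rewrite -ball_normE /ball_/= sub0r normrN.
apply: (@le_lt_trans _ _ (d / 2)); last by rewrite ltr_pdivrMr// ltr_pMr// ltr1n.
apply: norm_row_le => [|i]; first exact: ltW.
apply: le_trans (cx i) _; rewrite -[leRHS]lnK ?posrE// ler_expR lerNl.
by near: c; apply: nbhs_pinfty_ge; exact: num_real.
Unshelve. all: by end_near. Qed.

End Cubes.

Lemma csupport_out (R : realType) (n : nat) (phi : 'rV[R]_n -> R[i]) (V : set 'rV[R]_n) x :
  csupport phi `<=` V -> ~ V x -> phi x = 0.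
Proof.
by move=> sV nV; apply/eqP/negPn/negP => px; apply: nV; apply: sV; exact: subset_closure.
Qed.

Lemma intn_phase_int (R : realType) (n : nat) (f g k : 'rV[R]_n -> R) (t p q c : R) :
  (forall e, e \in allsigns n ->
    integrand 1 c (fun u => phase (pullback e f) t p u * pullback e g u)) ->
  (forall e, e \in allsigns n ->
    integrand 1 c (fun u => phase (pullback e f) t q u * pullback e k u)) ->
  intn (fun x => cos (t * f x + p) * g x + cos (t * f x + q) * k x) = \sum_(e <- allsigns n)
    (phase_int (pullback e f) e p t (pullback e g) + phase_int (pullback e f) e q t (pullback e k)).
Proof.
move=> ig ik; pose h e u := phase (pullback e f) t p u * pullback e g u +
  phase (pullback e f) t q u * pullback e k u.
rewrite (intn_orthants (h := h) (c := c)) => [|e eA|x x0].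
- by apply: eq_big_seq => e eA; rewrite /phase_int -(orthant_intD e (ig e eA) (ik e eA)).
- exact: (integrandD (ig e eA) (ik e eA)).
- by rewrite /h /phase /pullback exp_coordK.
Qed.

Section PhaseExpansion.
Variables (R : realType) (n : nat) (U : set 'rV[R]_n) (f : 'rV[R]_n -> R).
Hypothesis (oU : open U) (U0 : U 0) (smooth_f : smooth_on U f) (f0 : f 0 = 0).
Hypothesis (g0 : newton f !=set0) (f_hatE : hatE U f) (nondeg : nondeg_over_R U f).
Variable Sig : seq (seq 'rV[int]_n).
Hypothesis ss : simplicial_subdivision (newton f) Sig.
Implicit Types (S : seq 'rV[int]_n) (a : 'rV[int]_n) (e : seq bool).

Definition ray_level a : nat := projT1 (cid (min_wdeg_exists (fun i => `|a ord0 i|%N) g0)).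

Lemma ray_level_min_wdeg a : min_wdeg f (fun i => `|a ord0 i|%N) (ray_level a).
Proof. exact: projT2 (cid (min_wdeg_exists (fun i => `|a ord0 i|%N) g0)). Qed.

Let gens_level S (j : 'I_n) : min_wdeg f (gens S j) (ray_level (nth 0 S j)).
Proof. exact: ray_level_min_wdeg. Qed.

Lemma chart_minimizer S : chart Sig S -> exists2 al, taylor_coef f al != 0 &
  forall j : 'I_n, wdeg (gens S j) al = ray_level (nth 0 S j).
Proof.
move=> cS; have /andP[SS /eqP sz] := cS; have [_ _ /(_ S SS)[gam [_ sub_dual]] _] := ss.
have [al Tal amin] := cone_minimizer g0 sub_dual; exists al => // j.
have [[be Tbe <-] lb] := gens_level S j; apply/eqP; rewrite eqn_leq lb// andbT.
have jS : (j < size S)%N by rewrite sz.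
have := amin (intR R (nth 0 S j)) (gcone_gen R jS) be Tbe.
by rewrite -(chart_dir_gens ss)// -[chart_dir R _ j]/(nat_row R (gens S j)) !dotp_wdeg ler_nat.
Qed.

Lemma skeleton1_nonneg a i : skeleton1 Sig a -> a ord0 i = `|a ord0 i|%N.
Proof. by move=> sa; exact: (gens_nonneg ss (S := [:: a]) (k := 0) i sa). Qed.

Lemma sumz_skeleton1_ge0 a : skeleton1 Sig a -> 0 <= sumz a.
Proof. by move=> sa; apply: sumr_ge0 => i _; rewrite (skeleton1_nonneg i sa). Qed.

Lemma expansion_exponents_sub :
  [set al : R | expansion_exponents Sig ray_level (- al)] `<=` exponent_set (newton f) Sig.
Proof.
move=> al [a [k [sa la alE]]]; left; exists k, a.
have -> : intR R a = nat_row R (fun i => `|a ord0 i|%N).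
  by apply/rowP => i; rewrite !mxE [in LHS](skeleton1_nonneg i sa).
by rewrite (lmin_min_wdeg (ray_level_min_wdeg a)) ltr0n -alE opprK.
Qed.

Definition grad_bounded_below (c : R) e S := exists2 d : R, 0 < d &
  forall u, cone_region (gens S) c u ->
    d * weight (@chart_coord R n (gens S)) (fun j : 'I_n => (ray_level (nth 0 S j))%:Z) u ^+ 2 <=
    grad_sqnorm (pullback e f) u.

Lemma near_grad_bounded_below e S : chart Sig S -> \forall c \near +oo, grad_bounded_below c e S.
Proof.
move=> cS; have uB := chart_unit ss cS; have [c cU] := filter_ex (near_cube_sub oU U0).
have symF := pullback_symbol_min_wdeg uB oU cU smooth_f (gens_level S) e f_hatE.
have [al Tal wal] := chart_minimizer cS.
have [m [d [d0 lower]]] :=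
  chart_lower_bound uB oU cU smooth_f (gens_level S) Tal wal symF (newton_dim_gt0 f0 g0) nondeg.
pose norm1 k : R := \sum_i `|chart_dir R (gens S) k ord0 i|.
pose K : R := \sum_k norm1 k ^+ 2 + 1.
have K0 : 0 < K by rewrite ltr_wpDl//; apply: sumr_ge0 => k _; exact: sqr_ge0.
near=> b; have cb : c <= b by near: b; apply: nbhs_pinfty_ge; exact: num_real.
have mb : m%:R <= b by near: b; apply: nbhs_pinfty_ge; exact: num_real.
exists (d / K) => [|u [Ou pos_u]]; first by rewrite divr_gt0.
have cu : cone_region (gens S) c u by split=> // i; exact: le_lt_trans (Ou i).
rewrite mulrAC ler_pdivrMr//.
apply: le_trans (lower u cu (fun i => le_lt_trans mb (Ou i))) _.
have df : differentiable (pullback e f) u by apply: (symbol_differentiable (symF 1%N)); case: cu.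
apply: le_trans (ler_sum _ (fun k _ => derive_sqr_le (chart_dir R (gens S) k) df)) _.
rewrite -mulr_suml mulrC ler_wpM2l ?lerDl//.
by apply: sumr_ge0 => i _; exact: sqr_ge0.
Unshelve. all: by end_near. Qed.

Lemma grad_bounded_below_ex : exists c : R, [/\ 0 <= c, cube (expR (- c)) `<=` U &
  forall e, e \in allsigns n -> forall S, chart Sig S -> grad_bounded_below c e S].
Proof.
have near_grad : \forall c \near +oo, forall e, e \in allsigns n ->
    forall S, S \in charts Sig -> grad_bounded_below c e S.
  apply: near_all_seq => e _; apply: near_all_seq => S.
  by rewrite mem_charts; exact: near_grad_bounded_below.
have near_ge0 := nbhs_pinfty_ge (num_real (0 : R)).
have [c [[c0 cU] grad]] := filter_ex (filterI (filterI near_ge0 (near_cube_sub oU U0)) near_grad).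
by exists c; split=> // e eA S cS; apply: grad => //; rewrite mem_charts.
Qed.

Variable c1 : R.
Hypothesis (c10 : 0 <= c1) (cU : cube (expR (- c1)) `<=` U).
Hypothesis grad_lower_bound :
  forall e, e \in allsigns n -> forall S, chart Sig S -> grad_bounded_below c1 e S.
Local Notation c0 := (c1 + 1).
Local Notation amplitude := (amplitude (R := R) Sig c1 c0).
Local Notation exponents := (expansion_exponents Sig ray_level).
Local Notation support_cube := (open_cube (n := n) (expR (- c0))).
Let c01 : c1 < c0. Proof. by rewrite ltrDl. Qed.

Lemma pullback_fan_symbol e : fan_symbol Sig c1 (fun a => (ray_level a)%:Z) (pullback e f).
Proof.
move=> S cS.
exact: (pullback_symbol_min_wdeg (chart_unit ss cS) oU cU smooth_f (gens_level S) e f_hatE).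
Qed.

Section TestFunction.
Variable g : 'rV[R]_n -> R.
Hypothesis (sg : smooth_on setT g) (g_out : forall x, ~ support_cube x -> g x = 0).

Lemma pullback_supp_ge e : supp_ge c0 (pullback e g).
Proof.
move=> u i ui; apply: g_out => /(_ i); rewrite norm_exp_coord ltr_expR ltrN2 => /(lt_trans ui).
by rewrite ltxx.
Qed.

Lemma pullback_amplitude e : amplitude (fun=> 0) (pullback e g).
Proof.
split; last exact: pullback_supp_ge.
by move=> S cS N; exact: (pullback_symbol (chart_unit ss cS) e N openT (fun _ _ => I) sg).
Qed.

Lemma localized_amplitude e S (nu : 'rV[int]_n -> int) : chart Sig S ->
  (forall a, a \in S -> nu a = 0) -> (forall a, 0 <= nu a) ->
  amplitude nu (fun u => part_of_unity Sig S u * pullback e g u).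
Proof.
move=> cS nuS nu0; apply: (le_amplitude (mu := fun a => nu a + 0)) => [a|]; first by rewrite addr0.
apply: amplitudeM (pullback_amplitude e) => T cT N.
by apply: (part_of_unity_symbol ss c10) => // k; exact: nuS.
Qed.

Lemma pullback_part_of_unity e : pullback e g =
  fun u => \sum_(S <- charts Sig) part_of_unity Sig S u * pullback e g u.
Proof.
apply/funext => u; rewrite -mulr_suml.
have [Ou|[i ui]] := supp_ge_cases c01 u (@pullback_supp_ge e).
  by rewrite (part_of_unity_sum ss c10 Ou) mul1r.
by rewrite (@pullback_supp_ge e u i ui) mulr0.
Qed.

Lemma pullback_phase_int_expandable psi e : e \in allsigns n ->
  expandable exponents n (fun tau => phase_int (pullback e f) e psi (expR tau) (pullback e g)).
Proof.
move=> eA; have symF := @pullback_fan_symbol e.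
have splitE t : phase_int (pullback e f) e psi t (pullback e g) =
    \sum_(S <- charts Sig) phase_int (pullback e f) e psi t
      (fun u => part_of_unity Sig S u * pullback e g u).
  rewrite [in LHS]pullback_part_of_unity.
  apply: (phase_int_sum ss c10 c01 e symF) => S; rewrite mem_charts => cS.
  exact: localized_amplitude.
under eq_fun do rewrite splitE.
apply: expandable_sum => S; rewrite mem_charts => cS.
apply: (phase_int_expandable ss c10 c01 e symF (grad_lower_bound eA) psi cS) => M.
by apply: localized_amplitude => // a ->.
Qed.

Lemma pullback_phase_integrand e psi t :
  integrand 1 c0 (fun u => phase (pullback e f) t psi u * pullback e g u).
Proof.
exact: (integrand_phase ss c10 c01 (@pullback_fan_symbol e) t psi (pullback_amplitude e)).
Qed.

End TestFunction.

Lemma intn_cos_expandable (g k : 'rV[R]_n -> R) p q :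
  smooth_on setT g -> (forall x, ~ support_cube x -> g x = 0) ->
  smooth_on setT k -> (forall x, ~ support_cube x -> k x = 0) ->
  expandable exponents n (fun tau =>
    intn (fun x => cos (expR tau * f x + p) * g x + cos (expR tau * f x + q) * k x)).
Proof.
move=> sg g_out sk k_out.
rewrite (_ : (fun tau => _) = fun tau => \sum_(e <- allsigns n)
    (phase_int (pullback e f) e p (expR tau) (pullback e g) +
     phase_int (pullback e f) e q (expR tau) (pullback e k))); last first.
  by apply/funext => tau; apply: intn_phase_int => e _; exact: pullback_phase_integrand.
by apply: expandable_sum => e eA; apply: expandableD; exact: pullback_phase_int_expandable.
Qed.

Variable phi : 'rV[R]_n -> R[i].
Hypothesis smooth_Re : smooth_on setT (fun x => complex.Re (phi x)).
Hypothesis smooth_Im : smooth_on setT (fun x => complex.Im (phi x)).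
Hypothesis supp_phi : csupport phi `<=` support_cube.

Let Re_out x : ~ support_cube x -> complex.Re (phi x) = 0.
Proof. by move=> /(csupport_out supp_phi) ->. Qed.

Let Im_out x : ~ support_cube x -> complex.Im (phi x) = 0.
Proof. by move=> /(csupport_out supp_phi) ->. Qed.

Lemma Re_osc_int_expandable :
  expandable exponents n (fun tau => complex.Re (osc_int f phi (expR tau))).
Proof.
have := intn_cos_expandable 0 (pi / 2) smooth_Re Re_out smooth_Im Im_out.
congr expandable; apply/funext => tau; congr intn; apply/funext => x.
by rewrite addr0 cosDpihalf mulNr.
Qed.

Lemma Im_osc_int_expandable :
  expandable exponents n (fun tau => complex.Im (osc_int f phi (expR tau))).
Proof.
have := intn_cos_expandable (- (pi / 2)) 0 smooth_Re Re_out smooth_Im Im_out.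
congr expandable; apply/funext => tau; congr intn; apply/funext => x.
by rewrite addr0 cosB cos_pihalf sin_pihalf mulr0 add0r mulr1.
Qed.

End PhaseExpansion.

Theorem theorem3p3 (R : realType) (n : nat) (U : set 'rV[R]_n)
    (f : 'rV[R]_n -> R) :
  open U -> U 0 -> smooth_on U f ->
  f 0 = 0 -> (forall j : 'I_n, pd j f 0 = 0) ->
  newton f !=set0 -> hatE U f -> nondeg_over_R U f ->
  forall Sig : seq (seq 'rV[int]_n),
  simplicial_subdivision (newton f) Sig ->
  exists V : set 'rV[R]_n,
    [/\ nbhs (0 : 'rV[R]_n) V, V `<=` U &
     exists A : set R, A `<=` exponent_set (newton f) Sig /\
     forall phi : 'rV[R]_n -> R[i],
       smooth_on setT (fun x => complex.Re (phi x)) ->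
       smooth_on setT (fun x => complex.Im (phi x)) ->
       csupport phi `<=` V ->
       exists C : R -> nat -> R[i],
         asymp_expansion n (osc_int f phi) A C]
  /\ newton (principal_part f) = newton f.
Proof.
move=> oU U0 smooth_f f0 _ g0 f_hatE nondeg Sig ss.
have [c [c_ge0 cU grad_lower_bound]] := grad_bounded_below_ex oU U0 smooth_f f0 g0 f_hatE nondeg ss.
exists (open_cube (expR (- (c + 1)))); split; last exact: newton_principal.
split; first by apply: nbhs0_open_cube; exact: expR_gt0.
  move=> x Vx; apply: cU => i; apply: le_trans (ltW (Vx i)) _.
  by rewrite ler_expR lerN2 lerDl.
exists [set al | expansion_exponents Sig (ray_level g0) (- al)].
split; first exact: expansion_exponents_sub.
move=> phi smooth_Re smooth_Im supp_phi; apply: expandable_asymp_expansion => [B||].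
- exact: expansion_exponents_finite (sumz_skeleton1_ge0 ss).
- exact: (Re_osc_int_expandable oU smooth_f f_hatE ss c_ge0 cU grad_lower_bound).
- exact: (Im_osc_int_expandable oU smooth_f f_hatE ss c_ge0 cU grad_lower_bound).
Qed.
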